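(* For all $j\ge2$, $1<r\le2$ and $-\frac1{r'}<s<\frac{j-1}{r'}$ there exists an NLS-like equation, i.e. a choice of coefficients $c_{k,\alpha,b}\in\mathbb{R}$ (for $1\le k\le j$, $\alpha\in\mathbb{N}_0^{2k+1}$ with $|\alpha|=2(j-k)$, $b\in\{+,-\}^{2k+1}$) in $$i\partial_tu+(-1)^{j+1}\partial_x^{2j}u=\sum_{k=1}^{j}\ \sum_{\substack{b\in\{\pm\}^{2k+1}\\ \alpha\in\mathbb{N}_0^{2k+1},\ |\alpha|=2(j-k)}}c_{k,\alpha,b}\ \partial_x^{\alpha_1}v_{b_1}\prod_{\ell=1}^{k}\partial_x^{\alpha_{2\ell}}v_{b_{2\ell}}\,\partial_x^{\alpha_{2\ell+1}}v_{b_{2\ell+1}},\qquad v_+=u,\ v_-=\overline{u},$$ such that for the Cauchy problem for this equation with $u(t=0)=u_0$, $x\in\mathbb{R}$, the flow map $S:\hat H^s_r(\mathbb{R})\times(-T,T)\to\hat H^s_r(\mathbb{R})$ (for any $T>0$) cannot be uniformly continuous on bounded subsets.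
   Context: $\langle\xi\rangle=(1+\xi^2)^{1/2}$, $\frac1r+\frac1{r'}=1$. The Fourier-Lebesgue space $\hat H^s_r(\mathbb{R})$ is the space of $u\in\mathcal{S}'(\mathbb{R})$ with $\|u\|_{\hat H^s_r}=\|\langle\xi\rangle^s\hat u\|_{L^{r'}(\mathbb{R})}<\infty$. The flow map is the map $S(u_0,t)=u(\cdot,t)$, where $u$ is the solution with datum $u_0$; in particular it agrees with smooth, spatially rapidly decaying classical solutions. Uniform continuity on bounded subsets is understood with respect to the data: for every bounded $B\subset\hat H^s_r(\mathbb{R})$ and $\varepsilon>0$ there is $\delta>0$ such that $u_0,v_0\in B$, $\|u_0-v_0\|_{\hat H^s_r}<\delta$ imply $\sup_{|t|<T}\|S(u_0,t)-S(v_0,t)\|_{\hat H^s_r}<\varepsilon$. The claim is that this fails. *)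

(* Defs.v *)
From HB Require Import structures.
From mathcomp Require Import all_boot all_order all_algebra.
From mathcomp Require Import complex.
From mathcomp Require Import all_classical all_reals all_analysis.

Set Implicit Arguments.
Unset Strict Implicit.
Unset Printing Implicit Defensive.

Import Order.TTheory GRing.Theory Num.Theory.
Import numFieldNormedType.Exports.
Import ComplexField.Normc.

Local Open Scope classical_set_scope.
Local Open Scope ring_scope.
Local Open Scope complex_scope.


Section Calculus.
Context {R : realType}.
Implicit Types (f g : R -> R[i]) (x : R).

Definition cderivable f x :=
  derivable (fun y => complex.Re (f y)) x 1 /\
  derivable (fun y => complex.Im (f y)) x 1.

Definition cderive f : R -> R[i] := fun x =>
  derive1 (fun y => complex.Re (f y)) x +i*
  derive1 (fun y => complex.Im (f y)) x.

Definition cderiven (n : nat) f : R -> R[i] := iter n cderive f.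

Definition cmeasurable f :=
  measurable_fun setT (fun x => complex.Re (f x)) /\
  measurable_fun setT (fun x => complex.Im (f x)).

Definition cintegrable f :=
  lebesgue_measure.-integrable setT (fun x => (complex.Re (f x))%:E) /\
  lebesgue_measure.-integrable setT (fun x => (complex.Im (f x))%:E).

Definition cintegral f : R[i] :=
  (\int[lebesgue_measure]_x complex.Re (f x)) +i*
  (\int[lebesgue_measure]_x complex.Im (f x)).

Definition expi x : R[i] := cos x +i* sin x.

Lemma derivable_lin (a b : R) (p q h : R -> R) x :
  derivable p x 1 -> derivable q x 1 -> derivable h x 1 ->
  derivable (fun y => a * p y + b * q y + h y) x 1 /\
  derive1 (fun y => a * p y + b * q y + h y) x =
    a * derive1 p x + b * derive1 q x + derive1 h x.
Proof.
move=> dp dq dh.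
have dap := @derivableZ _ _ _ p a x 1 dp.
have dbq := @derivableZ _ _ _ q b x 1 dq.
have dpq := @derivableD _ _ _ (a \*: p) (b \*: q) x 1 dap dbq.
split; first exact: (@derivableD _ _ _ ((a \*: p) \+ (b \*: q)) h x 1 dpq dh).
rewrite !derive1E.
rewrite (@deriveD _ _ _ ((a \*: p) \+ (b \*: q)) h x 1 dpq dh).
rewrite (@deriveD _ _ _ (a \*: p) (b \*: q) x 1 dap dbq).
by rewrite (@deriveZ _ _ _ p a x 1 dp) (@deriveZ _ _ _ q b x 1 dq).
Qed.

Lemma cderivable_lin (a : R[i]) f g x : cderivable f x -> cderivable g x ->
  cderivable (fun y => a * f y + g y) x /\
  cderive (fun y => a * f y + g y) x = a * cderive f x + cderive g x.
Proof.
case: a => [a b] [fr fi] [gr gi].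
have Er : (fun y => complex.Re ((a +i* b) * f y + g y)) =
  (fun y => a * complex.Re (f y) + (- b) * complex.Im (f y) + complex.Re (g y)).
  by apply/funext => y; case: (f y) (g y) => [p q] [p' q'] /=; rewrite mulNr.
have Ei : (fun y => complex.Im ((a +i* b) * f y + g y)) =
  (fun y => a * complex.Im (f y) + b * complex.Re (f y) + complex.Im (g y)).
  by apply/funext => y; case: (f y) (g y) => [p q] [p' q'].
have [dr er] := derivable_lin a (- b) fr fi gr.
have [di ei] := derivable_lin a b fi fr gi.
split; first by split; rewrite ?Er ?Ei.
by rewrite /cderive Er Ei er ei mulNr.
Qed.

End Calculus.

Section Schwartz.
Context {R : realType}.

Definition is_schwartz (f : R -> R[i]) : Prop :=
  (forall n x, cderivable (cderiven n f) x) /\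
  (forall m n, exists M : R, forall x,
     `|x| ^+ m * normc (cderiven n f x) <= M).

Definition schwartz_pred : {pred R -> R[i]} := [pred f | `[< is_schwartz f >]].

Lemma cderiven_lin (a : R[i]) (f g : R -> R[i]) n :
  (forall k x, cderivable (cderiven k f) x) ->
  (forall k x, cderivable (cderiven k g) x) ->
  cderiven n (a *: f + g) = a *: cderiven n f + cderiven n g.
Proof.
move=> sf sg; elim: n => [//|n IH].
rewrite /cderiven !iterS -!/(cderiven _ _) IH; apply/funext => x.
by have [_ ->] := cderivable_lin a (sf n x) (sg n x).
Qed.

Lemma normcD_le (a b : R[i]) : normc (a + b) <= normc a + normc b.
Proof. by rewrite -lecR rmorphD/=; exact: (@ler_normD _ R[i]). Qed.

Lemma schwartz_submod_closed : submod_closed schwartz_pred.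
Proof.
have sf0 n : cderiven n (0 : R -> R[i]) = 0.
  elim: n => [//|n IH]; rewrite /cderiven iterS -/(cderiven _ _) IH.
  apply/funext => x.
  transitivity (derive1 (cst (0 : R)) x +i* derive1 (cst (0 : R)) x) => //.
  by rewrite !derive1_cst.
split=> [|a f g].
  apply/asboolP; split=> [n x|m n].
    by rewrite sf0; split; exact: derivable_cst.
  by exists 0 => x; rewrite sf0 (@normc0 R) mulr0.
move=> /asboolP[sf df] /asboolP[sg dg]; apply/asboolP; split=> [n x|m n].
  by rewrite cderiven_lin//; have [] := cderivable_lin a (sf n x) (sg n x).
have [[Mf bf] [Mg bg]] := (df m n, dg m n).
exists (normc a * Mf + Mg) => x; rewrite cderiven_lin//.
have := normcD_le (a * cderiven n f x) (cderiven n g x).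
move=> /(ler_wpM2l (exprn_ge0 m (normr_ge0 x))) /le_trans; apply.
rewrite mulrDr lerD// normcM mulrCA ler_wpM2l//.
by case: a => ? ?; exact: sqrtr_ge0.
Qed.

HB.instance Definition _ :=
  GRing.isSubmodClosed.Build _ _ schwartz_pred schwartz_submod_closed.

Record schwartz := Schwartz {
  schwartz_val :> R -> R[i];
  schwartz_valP : schwartz_val \in schwartz_pred }.

HB.instance Definition _ := [isSub of schwartz for schwartz_val].
HB.instance Definition _ := [Choice of schwartz by <:].
HB.instance Definition _ := [SubChoice_isSubLmodule of schwartz by <:].

Definition seminorm (m n : nat) (phi : schwartz) : R :=
  sup [set `|x| ^+ m * normc (cderiven n phi x) | x in [set: R]].

Definition tempered (u : schwartz -> R[i]) : Prop :=
  scalar u /\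
  exists N (K : R), forall phi,
    normc (u phi) <= K * \sum_(m < N) \sum_(n < N) seminorm m n phi.

(* The functional of integration against [f]; it is a tempered distribution
   when [f] is, e.g., a Schwartz function or in a weighted L^p space. *)
Definition dist_of (f : R -> R[i]) : schwartz -> R[i] :=
  fun phi => cintegral (fun x => f x * phi x).

Definition fourier (f : R -> R[i]) : R -> R[i] := fun xi =>
  ((Num.sqrt (2 * pi))^-1)%:C * cintegral (fun x => expi (- (x * xi)) * f x).

(* [w] is the Fourier transform of the distribution [u], by duality.  As the
   Fourier transform maps Schwartz functions to Schwartz functions, every [phi]
   has a (unique) [psi]. *)
Definition is_fourier (u w : schwartz -> R[i]) : Prop :=
  forall phi psi : schwartz, psi = fourier phi :> (R -> R[i]) -> w phi = u psi.

End Schwartz.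
Arguments schwartz : clear implicits.

Section FourierLebesgue.
Context {R : realType}.
Local Open Scope ereal_scope.

Definition dual_exponent (r : R) : R := ((1 - r^-1)^-1)%R.

Definition japanese (xi : R) : R := Num.sqrt (1 + xi ^+ 2)%R.

(* [f] is a function representing the Fourier transform of [u]; it is unique
   almost everywhere. *)
Definition fourier_function (u : schwartz R -> R[i]) (f : R -> R[i]) : Prop :=
  [/\ cmeasurable f,
      forall phi : schwartz R, cintegrable (fun x => f x * phi x)%R &
      is_fourier u (dist_of f)].

(* All members of the set are equal, so the infimum only serves to pick its
   element and to give +oo when the Fourier transform of [u] is not a
   function. *)
Definition Hhat_norm (s r : R) (u : schwartz R -> R[i]) : \bar R :=
  ereal_inf [set 'N[lebesgue_measure]_((dual_exponent r)%:E)
                   [(fun xi => (japanese xi `^ s * normc (f xi))%:E)]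
            | f in fourier_function u].

Definition Hhat (s r : R) : set (schwartz R -> R[i]) :=
  [set u | tempered u /\ Hhat_norm s r u < +oo].

End FourierLebesgue.

Section NLSLike.
Context {R : realType}.
Implicit Types (u : R -> R -> R[i]) (t x : R).

(* Space-time functions take the time first: [u t x]. *)
Definition dt u : R -> R -> R[i] := fun t x => cderive (fun t' => u t' x) t.

Definition dx u : R -> R -> R[i] := fun t x => cderive (u t) x.

Definition conjst u : R -> R -> R[i] := fun t x => conjc (u t x).

(* The iterated partial derivative along a word in [dt] (true) and [dx]
   (false). *)
Definition partial (w : seq bool) u : R -> R -> R[i] :=
  foldr (fun (b : bool) v => if b then dt v else dx v) u w.

(* Existence and local boundedness of all iterated partial derivatives make
   [u] jointly C^oo on (-T, T) x R. *)
Definition smooth_rapidly_decaying (T : R) u : Prop :=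
  (forall w t x, `|t| < T ->
     cderivable (fun t' => partial w u t' x) t /\
     cderivable (partial w u t) x) /\
  (forall w m T', T' < T -> exists M : R, forall t x, `|t| <= T' ->
     `|x| ^+ m * normc (partial w u t x) <= M).

(* A family c_{k,alpha,b}; since |alpha| = 2(j-k), the entries of alpha are at
   most 2(j-k), and b_i = true stands for the sign +.  Values at multi-indices
   with |alpha| <> 2(j-k) are not used. *)
Definition coefficients (j : nat) : Type :=
  forall k : nat, {ffun 'I_(2 * k).+1 -> 'I_(2 * (j - k)).+1} ->
    {ffun 'I_(2 * k).+1 -> bool} -> R.

Definition nonlinearity (j : nat) (c : coefficients j) u t x : R[i] :=
  \sum_(1 <= k < j.+1)
  \sum_(b : {ffun 'I_(2 * k).+1 -> bool})
  \sum_(alpha : {ffun 'I_(2 * k).+1 -> 'I_(2 * (j - k)).+1} |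
         (\sum_i alpha i == 2 * (j - k))%N)
    (c k alpha b)%:C *
    \prod_(i < (2 * k).+1)
      iter (alpha i) dx (if b i then u else conjst u) t x.

Definition classical_solution (j : nat) (c : coefficients j) (T : R) u : Prop :=
  smooth_rapidly_decaying T u /\
  forall t x, `|t| < T ->
    (0 +i* 1) * dt u t x + (-1) ^+ j.+1 * iter (2 * j) dx u t x =
    nonlinearity c u t x.

(* A flow map Hhat^s_r x (-T, T) -> Hhat^s_r, encoded as a function whose values
   outside this domain are irrelevant.  No particular notion of rough solution
   is imposed. *)
Definition is_flow_map (j : nat) (c : coefficients j) (s r T : R)
    (S : (schwartz R -> R[i]) -> R -> (schwartz R -> R[i])) : Prop :=
  [/\ forall (u0 : schwartz R -> R[i]) t,
        Hhat s r u0 -> `|t| < T -> Hhat s r (S u0 t),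
      forall u0 : schwartz R -> R[i], Hhat s r u0 -> S u0 0 = u0 &
      forall u, classical_solution c T u ->
        forall t, `|t| < T -> S (dist_of (u 0)) t = dist_of (u t)].

Definition time_interval (T : R) : set R := [set t : R | `|t| < T].

Definition uniformly_continuous_on_bounded (s r T : R)
    (S : (schwartz R -> R[i]) -> R -> (schwartz R -> R[i])) : Prop :=
  forall B : set (schwartz R -> R[i]), B `<=` Hhat s r ->
  (exists M : R, forall u0 : schwartz R -> R[i],
     B u0 -> (Hhat_norm s r u0 <= M%:E)%E) ->
  forall eps : R, 0 < eps ->
  exists2 delta : R, 0 < delta &
    forall u0 v0 : schwartz R -> R[i], B u0 -> B v0 ->
      (Hhat_norm s r (u0 - v0)%R < delta%:E)%E ->
      (ereal_sup [set Hhat_norm s r (S u0 t - S v0 t)%R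
                 | t in time_interval T] < eps%:E)%E.

End NLSLike.

(* Main.v *)
(* The equation is chosen such that it has solitons
     u(t, x) = exp (i (k x + theta t)) w sech (w (x - v t))
   for all frequencies k and all w > 0.  On exp (i k x) Q with Q = w sech (w x),
   the identities Q'' = w^2 Q - 2 Q^3 and Q'^2 = w^2 Q^2 - Q^4 turn the
   derivative of order 2j into a combination of Q and Q', which is compensated
   by a suitable phase and velocity, plus terms (i k)^a w^(2b) Q^c and
   (i k)^a w^(2b) Q^(c-1) Q' with c >= 3.  All of the latter are values of
   differential polynomials in u and its conjugate, with real coefficients that
   do not depend on k, w: powers of w^2 come from (Q^2)'' = 4 w^2 Q^2 - 6 Q^4,
   and powers of i k from conj(u) u^(n) = (i k)^n Q^2 + lower powers of k.  The
   velocity is v = Im (k + i w)^(2j) / w.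

   With p = r' and w = N^(-s p) the data of frequencies N and N + theta w are
   bounded in the norm for N >= 1, and their distance is small with theta,
   uniformly in N.  At a time t > 0 they are separated by at least
   theta t N^(2 (j - 1 - s p)) widths 1 / w.  As s p < j - 1 this tends to
   infinity with N, and as s p > -1 the frequency spread w is small compared
   with N.  Testing the difference of the solutions with a Gaussian wave packet
   located at the first soliton and using Hoelder's inequality on the Fourier
   side bounds its norm from below independently of theta. *)

From HB Require Import structures.
Require Import Defs.
From mathcomp Require Import all_boot all_order all_algebra.
From mathcomp Require Import complex.
From mathcomp Require Import all_classical all_reals all_analysis measurable_realfun.
From mathcomp Require Import ring lra zify.

Set Implicit Arguments.
Unset Strict Implicit.
Unset Printing Implicit Defensive.

Import Order.TTheory GRing.Theory Num.Theory.
Import numFieldNormedType.Exports.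
Import ComplexField.Normc.

Local Open Scope classical_set_scope.
Local Open Scope ring_scope.
Local Open Scope complex_scope.

(** * Derivatives of complex functions *)

(** The scale [w] is forced by the norm: a bump around [N] on the frequency scale [w] has weighted
    [L^p] norm of order [N^s w^(1/p)], and [w = N^(- s p)] makes this one. Raising the frequency by
    [theta w] translates the rescaled transform by [theta], so the distance of the data is
    controlled by [theta] alone. The velocity is homogeneous of degree [2 j - 1] in [(k, w)]; since
    [N / w = N^(1 + s p)] is large, its increment, measured in units of [1 / w], has the order
    [theta w^2 N^(2 j - 2)], which is the separation rate. A flow map is tied to the equation only
    along smooth rapidly decaying solutions. The solitons are Schwartz functions at all times, so
    they carry the whole argument. The test function has to be controlled on both sides of the
    Fourier transform: its weighted norm is taken in frequency, whereas the separation of the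
    solitons is visible only in space. A Gaussian is its own transform and serves both purposes. *)

Section ComplexDerivative.
Context {R : realType}.
Implicit Types (f g : R -> R[i]) (x : R) (d : R[i]).

(** Differentiability and the value of the derivative form one predicate, so that the product and
    chain rules compose without side conditions. *)
Definition cder f x d :=
  is_derive x 1 (fun y => complex.Re (f y)) (complex.Re d) /\
  is_derive x 1 (fun y => complex.Im (f y)) (complex.Im d).

Lemma cder_cderivable f x d : cder f x d -> cderivable f x.
Proof. by case=> [[? _] [? _]]. Qed.

Lemma cder_cderive f x d : cder f x d -> cderive f x = d.
Proof. by case: d => a b [[? /= A] [? /= B]]; rewrite /cderive !derive1E A B. Qed.

Lemma cderivable_cder f x : cderivable f x -> cder f x (cderive f x).
Proof. by case=> df dg; split; apply: DeriveDef => //=; rewrite derive1E. Qed.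

Lemma cder_unique f x d d' : cder f x d -> cder f x d' -> d = d'.
Proof. by move=> /cder_cderive <- /cder_cderive <-. Qed.

Lemma eq_cder f g x d d' : cder f x d -> (forall y, f y = g y) -> d = d' ->
  cder g x d'.
Proof. by move=> ? /funext <- <-. Qed.

Lemma is_deriveE (h h' : R -> R) x (a b : R) : is_derive x 1 h a ->
  (forall y, h y = h' y) -> a = b -> is_derive x 1 h' b.
Proof. by move=> ? /funext <- <-. Qed.

Lemma cder_cst d x : cder (fun=> d) x 0.
Proof. by split; exact: is_derive_cst. Qed.

Lemma cderD f g x d d' : cder f x d -> cder g x d' ->
  cder (fun y => f y + g y) x (d + d').
Proof.
move=> [a b] [a' b']; split.
  apply: (is_deriveE (is_deriveD a a')) => [y|]; last by case: d d' {a b a' b'} => [? ?] [].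
  by rewrite !fctE; case: (f y) (g y) => [? ?] [].
apply: (is_deriveE (is_deriveD b b')) => [y|]; last by case: d d' {a b a' b'} => [? ?] [].
by rewrite !fctE; case: (f y) (g y) => [? ?] [].
Qed.

Lemma cderM f g x d d' : cder f x d -> cder g x d' ->
  cder (fun y => f y * g y) x (d * g x + f x * d').
Proof.
move=> [a b] [a' b']; split.
  apply: (is_deriveE (is_deriveB (is_deriveM a a') (is_deriveM b b'))) => [y|].
    by rewrite !fctE; case: (f y) (g y) => [? ?] [].
  case: (f x) (g x) d d' {a b a' b'} => [? ?] [? ?] [? ?] [? ?].
  rewrite /= /GRing.scale /=; ring.
apply: (is_deriveE (is_deriveD (is_deriveM a b') (is_deriveM b a'))) => [y|].
  by rewrite !fctE; case: (f y) (g y) => [? ?] [? ?] /=; ring.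
case: (f x) (g x) d d' {a b a' b'} => [? ?] [? ?] [? ?] [? ?].
rewrite /= /GRing.scale /=; ring.
Qed.

Lemma cderZ (a : R[i]) f x d : cder f x d -> cder (fun y => a * f y) x (a * d).
Proof. by move=> /(cderM (cder_cst a x)); rewrite mul0r add0r. Qed.

Lemma cderX f x d n : cder f x d ->
  cder (fun y => f y ^+ n) x (n%:R * f x ^+ n.-1 * d).
Proof.
move=> fd; elim: n => [|n IH]; first by rewrite !mul0r; exact: cder_cst.
apply: (eq_cder (cderM fd IH)) => [y|]; first by rewrite exprS.
case: n {IH} => [|n] /=; first by rewrite !expr0 !mul0r !mul1r mulr0 addr0 mulr1.
by rewrite !exprS (mulrS 1 n.+1); ring.
Qed.

Lemma cder_conj f x d : cder f x d -> cder (fun y => conjc (f y)) x (conjc d).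
Proof.
move=> [a b]; split.
  by apply: (is_deriveE a) => [y|]; rewrite ?fctE; [case: (f y)|case: d a b].
by apply: (is_deriveE (is_deriveN b)) => [y|]; rewrite ?fctE; [case: (f y)|case: d a b].
Qed.

Lemma cder_real (h : R -> R) x a : is_derive x 1 h a ->
  cder (fun y => (h y)%:C) x a%:C.
Proof. by move=> ha; split => //; exact: is_derive_cst. Qed.

Lemma cder_comp (h : R -> R) f x a d : is_derive x 1 h a -> cder f (h x) d ->
  cder (fun y => f (h y)) x (a%:C * d).
Proof.
move=> ha [fr fi]; split.
  apply: (is_deriveE (is_derive1_comp fr ha)) => //; case: d {fr fi} => /= ? ?.
  by rewrite /GRing.scale /=; ring.
apply: (is_deriveE (is_derive1_comp fi ha)) => //; case: d {fr fi} => /= ? ?.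
by rewrite /GRing.scale /=; ring.
Qed.

Lemma conjcM (a b : R[i]) : conjc (a * b) = conjc a * conjc b.
Proof. exact: rmorphM. Qed.

Lemma realcM (a b : R) : (a * b)%:C = a%:C * b%:C.
Proof. exact: rmorphM. Qed.

Lemma realcD (a b : R) : (a + b)%:C = a%:C + b%:C.
Proof. exact: rmorphD. Qed.

Lemma realcN (a : R) : (- a)%:C = - a%:C.
Proof. exact: rmorphN. Qed.

Lemma realcX (a : R) n : (a ^+ n)%:C = a%:C ^+ n.
Proof. exact: rmorphXn. Qed.

Lemma realc_nat n : (n%:R : R)%:C = n%:R.
Proof. exact: rmorph_nat. Qed.

Lemma cder_expi x : cder expi x ('i * expi x).
Proof.
split => /=.
  by apply: (is_deriveE (is_derive_cos x)) => //; ring.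
by apply: (is_deriveE (is_derive_sin x)) => //; ring.
Qed.

Lemma cderiven_S n f : cderiven n.+1 f = cderive (cderiven n f).
Proof. by []. Qed.

Lemma cderiven_Sr n f : cderiven n.+1 f = cderiven n (cderive f).
Proof. by rewrite /cderiven iterSr. Qed.

Lemma iter_dx (u : R -> R -> R[i]) n t : iter n dx u t = cderiven n (u t).
Proof. by elim: n => // n IH; rewrite cderiven_S -IH. Qed.

End ComplexDerivative.

(** * Equations with prescribed solitons *)

Section RealSpan.
Context {R : realType} {P : Type}.
Notation fn := (P -> R -> R[i]).
Implicit Types (F H : fn) (G : fn -> Prop).

(* The functions depend on the parameters of a soliton and on [x]. The span is
   real because the coefficients of the equation have to be real and common to
   all solitons. *)
Inductive rspan G : fn -> Prop :=
| rspan0 : rspan G (fun _ _ => 0)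
| rspanS a F H : G F -> rspan G H -> rspan G (fun p x => a%:C * F p x + H p x).

Lemma eq_fn F H : (forall p x, F p x = H p x) -> F = H.
Proof. by move=> FH; apply/funext => p; apply/funext. Qed.

Lemma eq_rspan G F H : rspan G F -> (forall p x, F p x = H p x) -> rspan G H.
Proof. by move=> FG /eq_fn <-. Qed.

Lemma rspan_gen G F : G F -> rspan G F.
Proof.
move=> GF; apply: (eq_rspan (rspanS 1 GF (rspan0 G))) => p x.
by rewrite mul1r addr0.
Qed.

Lemma rspanD G F H : rspan G F -> rspan G H -> rspan G (fun p x => F p x + H p x).
Proof.
move=> GF GH; elim: GF => [|a F' F'' gF' _ IH].
  by apply: (eq_rspan GH) => p x; rewrite add0r.
by apply: (eq_rspan (rspanS a gF' IH)) => p x; rewrite addrA.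
Qed.

Lemma rspanZ G F a : rspan G F -> rspan G (fun p x => a%:C * F p x).
Proof.
elim=> [|b F' F'' gF' _ IH].
  by apply: (eq_rspan (rspan0 G)) => p x; rewrite mulr0.
apply: (eq_rspan (rspanS (a * b) gF' IH)) => p x.
by rewrite rmorphM mulrDr mulrA.
Qed.

Lemma rspanB G F H : rspan G F -> rspan G H -> rspan G (fun p x => F p x - H p x).
Proof.
move=> GF /(rspanZ (-1)) GH; apply: (eq_rspan (rspanD GF GH)) => p x.
by rewrite rmorphN mulN1r.
Qed.

Lemma rspanM G1 G2 G3 F H :
  (forall F' H', G1 F' -> G2 H' -> rspan G3 (fun p x => F' p x * H' p x)) ->
  rspan G1 F -> rspan G2 H -> rspan G3 (fun p x => F p x * H p x).
Proof.
move=> G123 GF GH; elim: GF => [|a F' F'' gF' _ IH].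
  by apply: (eq_rspan (rspan0 G3)) => p x; rewrite mul0r.
have FH : rspan G3 (fun p x => F' p x * H p x).
  elim: GH {IH} => [|b H' H'' gH' _ IH].
    by apply: (eq_rspan (rspan0 G3)) => p x; rewrite mulr0.
  apply: (eq_rspan (rspanD (rspanZ b (G123 _ _ gF' gH')) IH)) => p x.
  by rewrite mulrDr mulrCA.
apply: (eq_rspan (rspanD (rspanZ a FH) IH)) => p x.
by rewrite mulrDl mulrA.
Qed.

Lemma rspan_bind G1 G2 (L F : fn) :
  (forall F', G1 F' -> rspan G2 (fun p x => L p x * F' p x)) ->
  rspan G1 F -> rspan G2 (fun p x => L p x * F p x).
Proof.
move=> G12; apply: (@rspanM (eq L)) => [F' H' <-|]; first exact: G12.
exact: rspan_gen.
Qed.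

Lemma rspan_sub G1 G2 F : (forall F', G1 F' -> rspan G2 F') ->
  rspan G1 F -> rspan G2 F.
Proof.
move=> G12 GF.
suff : rspan G2 (fun p x => 1 * F p x).
  by move/eq_rspan; apply => p x; rewrite mul1r.
apply: rspan_bind GF => F' /G12 GF'.
by apply: (eq_rspan GF') => p x; rewrite mul1r.
Qed.

Definition isD F F' := forall p x, cder (F p) x (F' p x).

Lemma rspan_isD G1 G2 F :
  (forall F, G1 F -> exists2 F', isD F F' & rspan G2 F') ->
  rspan G1 F -> exists2 F', isD F F' & rspan G2 F'.
Proof.
move=> G12; elim=> [|a F' F'' /G12[H' FH' gH'] _ [H'' FH'' gH'']].
  by exists (fun _ _ => 0); [move=> p x; exact: cder_cst|exact: rspan0].
exists (fun p x => a%:C * H' p x + H'' p x).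
  by move=> p x; exact: cderD (cderZ _ (FH' p x)) (FH'' p x).
exact: rspanD (rspanZ _ _) _.
Qed.

Lemma rspan_isD_eq G1 G2 F F' :
  (forall F, G1 F -> exists2 F', isD F F' & rspan G2 F') ->
  rspan G1 F -> isD F F' -> rspan G2 F'.
Proof.
move=> G12 /(rspan_isD G12)[F'' dF gF] dF'.
by apply: (eq_rspan gF) => p x; exact: cder_unique (dF p x) (dF' p x).
Qed.

End RealSpan.

(** * Derivatives of a soliton as differential polynomials in the soliton and its conjugate *)

Section SolitonAlgebra.
Context {R : realType} {P : Type}.
Notation fn := (P -> R -> R[i]).
(* In the application [E] is [exp (i (k x + c))] and [K = i k], whereas [Q] is
   the profile [w sech (w (x - a))] with the derivative [Q1], and [W = w^2]. *)
Variables (K W : P -> R[i]) (E Q Q1 : fn).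
Hypothesis EconjE : forall p x, conjc (E p x) * E p x = 1.
Hypothesis conjQ : forall p x, conjc (Q p x) = Q p x.
Hypothesis dE : forall p x, cder (E p) x (K p * E p x).
Hypothesis dQ : forall p x, cder (Q p) x (Q1 p x).
Hypothesis dQ1 : forall p x, cder (Q1 p) x (W p * Q p x - 2 * Q p x ^+ 3).
Hypothesis Q1E : forall p x, Q1 p x ^+ 2 = W p * Q p x ^+ 2 - Q p x ^+ 4.

Definition lin n (F : fn) :=
  rspan (fun F' => exists a b, (a + 2 * b = n)%N /\
    F' = fun p _ => K p ^+ a * W p ^+ b) F.

(** [K] has weight 1 and [W] has weight 2. The bound [a < n] excludes only the pure power [K^n]; it
    drives the induction on the power of [K]. *)
Definition lin' n (F : fn) :=
  rspan (fun F' => exists a b, [/\ (a < n)%N, (a + 2 * b = n)%N &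
    F' = fun p _ => K p ^+ a * W p ^+ b]) F.

(** With weight 1 for [Q] and 2 for [Q1], these are the terms of total weight [n + 1] whose degree
    in [Q] and [Q1] together is odd and at least 3. [Q1] occurs at most once. *)
Definition nlin n (F : fn) :=
  rspan (fun F' => exists a b c,
   ((a + 2 * b + 2 * c + 2 = n)%N /\
     F' = fun p x => K p ^+ a * W p ^+ b * Q p x ^+ (2 * c + 3)) \/
   ((a + 2 * b + 2 * c + 3 = n)%N /\
     F' = fun p x => K p ^+ a * W p ^+ b * (Q p x ^+ (2 * c + 2) * Q1 p x))) F.

(* The [n]-th derivative of [E Q] is [E (a Q + b Q1 + N)], where [N] has degree
   at least 3 in [Q] and [Q1], and [lincoef n] is the pair [(a, b)]. *)
Fixpoint lincoef n (p : P) : R[i] * R[i] :=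
  if n is m.+1 then
    (K p * (lincoef m p).1 + W p * (lincoef m p).2,
     (lincoef m p).1 + K p * (lincoef m p).2)
  else (1, 0).

Lemma lin'_lin n F : lin' n F -> lin n F.
Proof.
by apply: rspan_sub => F' [a [b [_ ab ->]]]; apply: rspan_gen; exists a, b.
Qed.

(** [K^n] arises when all derivatives fall on [E]; every other term has exchanged factors [K^2] for
    [W]. The two claims are proved together because the recursion for the first coefficient contains
    [W] times the second. *)
Lemma lincoefP n :
  lin' n (fun p _ => (lincoef n p).1 - K p ^+ n) /\
  lin' n.+1 (fun p _ => W p * (lincoef n p).2).
Proof.
elim: n => [|n [IH1 IH2]] /=.
  split; apply: (eq_rspan (rspan0 _)) => p x; first by rewrite expr0 subrr.
  by rewrite mulr0.
have KIH1 : lin' n.+1 (fun p _ => K p * ((lincoef n p).1 - K p ^+ n)).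
  apply: (@rspan_bind _ _ _ _ (fun p _ => K p)) IH1 => _ [a [b [an ab ->]]].
  apply: rspan_gen; exists a.+1, b; split; [lia|lia|].
  by apply: eq_fn => p x; rewrite exprS mulrA.
split.
  apply: (eq_rspan (rspanD KIH1 IH2)) => p x; rewrite exprS; ring.
have WK : lin' n.+2 (fun p _ => W p * K p ^+ n).
  apply: rspan_gen; exists n, 1%N; split; [lia|lia|].
  by apply: eq_fn => p x; rewrite mulrC.
have WI : lin' n.+2 (fun p _ => W p * ((lincoef n p).1 - K p ^+ n)).
  apply: (@rspan_bind _ _ _ _ (fun p _ => W p)) IH1 => _ [a [b [an ab ->]]].
  apply: rspan_gen; exists a, b.+1; split; [lia|lia|].
  by apply: eq_fn => p x; rewrite exprS; ring.
have KW : lin' n.+2 (fun p _ => K p * (W p * (lincoef n p).2)).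
  apply: (@rspan_bind _ _ _ _ (fun p _ => K p)) IH2 => _ [a [b [an ab ->]]].
  apply: rspan_gen; exists a.+1, b; split; [lia|lia|].
  by apply: eq_fn => p x; rewrite exprS mulrA.
apply: (eq_rspan (rspanD (rspanD WI WK) KW)) => p x; ring.
Qed.

Lemma lincoef2P n : lin n (fun p _ => (lincoef n.+1 p).2).
Proof.
elim: n => [|n IH].
  apply: rspan_gen; exists 0%N, 0%N; split => //.
  by apply: eq_fn => p x; rewrite /= mulr0 addr0 mul1r.
have KI : lin n.+1 (fun p _ => K p * (lincoef n.+1 p).2).
  apply: (@rspan_bind _ _ _ _ (fun p _ => K p)) IH => _ [a [b [<- ->]]].
  apply: rspan_gen; exists a.+1, b; split => //.
  by apply: eq_fn => p x; rewrite exprS mulrA.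
have K0 : lin n.+1 (fun p _ => K p ^+ n.+1).
  apply: rspan_gen; exists n.+1, 0%N; split; first by rewrite muln0 addn0.
  by apply: eq_fn => p x; rewrite mulr1.
have [/lin'_lin L _] := lincoefP n.+1.
by apply: (eq_rspan (rspanD (rspanD L K0) KI)) => p x /=; ring.
Qed.

Lemma nlinK n F : nlin n F -> nlin n.+1 (fun p x => K p * F p x).
Proof.
apply: (@rspan_bind _ _ _ _ (fun p _ => K p)).
move=> F' [a [b [c [[<- ->]|[<- ->]]]]]; apply: rspan_gen; exists a.+1, b, c.
  by left; split; [rewrite !addSn|apply: eq_fn => p x; rewrite exprS; ring].
by right; split; [rewrite !addSn|apply: eq_fn => p x; rewrite exprS; ring].
Qed.

Lemma cder_QX p x n : cder (fun y => Q p y ^+ n.+1) x (n.+1%:R * Q p x ^+ n * Q1 p x).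
Proof. exact: cderX (dQ p x). Qed.

(** Eliminating [Q1^2] by [Q1E] keeps the degree in [Q1] at most one, so the normal form of [nlin]
    is stable under differentiation. *)
Lemma cder_QXQ1 p x n : cder (fun y => Q p y ^+ n.+1 * Q1 p y) x
  (n.+2%:R * W p * Q p x ^+ n.+2 - n.+3%:R * Q p x ^+ n.+4).
Proof.
apply: (eq_cder (cderM (cder_QX p x n) (dQ1 p x))) => //.
have -> : n.+1%:R * Q p x ^+ n * Q1 p x * Q1 p x =
  n.+1%:R * Q p x ^+ n * (Q1 p x ^+ 2) by ring.
rewrite Q1E !exprS expr0 -[n.+3%:R]natr1 -[n.+2%:R]natr1; ring.
Qed.

Lemma nlinD n F : nlin n F -> exists2 F', isD F F' & nlin n.+1 F'.
Proof.
apply: rspan_isD => F' [a [b [c [[<- ->]|[<- ->]]]]].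
  exists (fun p x => ((2 * c + 3)%N%:R : R)%:C *
      (K p ^+ a * W p ^+ b * (Q p x ^+ (2 * c + 2) * Q1 p x))).
    move=> p x; rewrite !addnS addn0.
    apply: (eq_cder (cderZ _ (cder_QX p x _))) => //.
    by rewrite rmorph_nat; ring.
  apply/rspanZ/rspan_gen; exists a, b, c; right; split => //.
  by rewrite !addnS addn0.
exists (fun p x => ((2 * c + 3)%N%:R : R)%:C *
      (K p ^+ a * W p ^+ b.+1 * Q p x ^+ (2 * c + 3)) -
      ((2 * c + 4)%N%:R : R)%:C *
      (K p ^+ a * W p ^+ b * Q p x ^+ (2 * c.+1 + 3))).
  have -> : (2 * c.+1 + 3 = (2 * c + 1).+4)%N by lia.
  move=> p x; rewrite !addnS addn0.
  apply: (eq_cder (cderZ _ (cder_QXQ1 p x _))) => //.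
  by rewrite !rmorph_nat !exprS; ring.
apply: rspanB; apply/rspanZ/rspan_gen.
  exists a, b.+1, c; left; split=> //; lia.
exists a, b, c.+1; left; split=> //; lia.
Qed.

Definition sol p x := E p x * Q p x.
Definition dsol n p x := cderiven n (sol p) x.

Lemma dsolP n : exists2 N : fn, nlin n N &
  forall p x, dsol n p x =
    E p x * ((lincoef n p).1 * Q p x + (lincoef n p).2 * Q1 p x + N p x).
Proof.
elim: n => [|n [N nN DN]].
  exists (fun _ _ => 0); first exact: rspan0.
  by move=> p x; rewrite /= mul1r mul0r !addr0.
have [N' dN nN'] := nlinD nN.
(* The cubic part of the derivative of [Q1] moves the term [b Q^3] from the linear to the nonlinear
   part. At [n = 0] the coefficient [b] vanishes. *)
have bQ : nlin n.+1 (fun p x => (lincoef n p).2 * Q p x ^+ 3).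
  case: n {N nN DN N' dN nN'} => [|n] /=.
    by apply: (eq_rspan (rspan0 _)) => p x; rewrite mul0r.
  suff : nlin n.+2 (fun p x => Q p x ^+ 3 * (lincoef n.+1 p).2).
    by move/eq_rspan; apply => p x; rewrite mulrC.
  apply: rspan_bind (lincoef2P n) => F' [a [b [<- ->]]].
  apply: rspan_gen; exists a, b, 0%N; left; split.
    by rewrite muln0 addn0 addn2.
  by apply: eq_fn => p x; rewrite mulrC.
exists (fun p x => K p * N p x + N' p x - 2%:C * ((lincoef n p).2 * Q p x ^+ 3)).
  exact: rspanB (rspanD (nlinK nN) nN') (rspanZ _ bQ).
move=> p x; rewrite /dsol cderiven_S; apply: cder_cderive.
have H := cderM (dE p x) (cderD (cderD (cderZ (lincoef n p).1 (dQ p x))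
  (cderZ (lincoef n p).2 (dQ1 p x))) (dN p x)).
by apply: (eq_cder H) => [y|]; [rewrite -DN|rewrite /= rmorph_nat; ring].
Qed.

(** [dsol] iterates [cderive], which has a value at every point; that it is a true derivative
    follows from the closed form in [dsolP]. *)
Lemma isD_dsol n : isD (dsol n) (dsol n.+1).
Proof.
have [N nN DN] := dsolP n; have [N' dN _] := nlinD nN.
move=> p x; rewrite /dsol cderiven_S.
have H := cderM (dE p x) (cderD (cderD (cderZ (lincoef n p).1 (dQ p x))
  (cderZ (lincoef n p).2 (dQ1 p x))) (dN p x)).
apply/cderivable_cder/cder_cderivable.
by apply: (eq_cder H) => // y; rewrite -DN.
Qed.

Definition fac (i : nat * bool) : fn := fun p x =>
  if i.2 then dsol i.1 p x else conjc (dsol i.1 p x).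

Definition mon (m : seq (nat * bool)) : fn := fun p x => \prod_(i <- m) fac i p x.

(* A factor with [n] derivatives has weight [n + 1], its exponent under the
   scaling [u (x) -> w u (w x)]. *)
Definition weight (m : seq (nat * bool)) : nat := \sum_(i <- m) i.1.+1.

Lemma isD_fac i : isD (fac i) (fac (i.1.+1, i.2)).
Proof.
case: i => n [] p x; first exact: isD_dsol.
exact: cder_conj (isD_dsol n p x).
Qed.

Lemma monD m : exists2 F', isD (mon m) F' &
  rspan (fun F => exists2 m', size m' = size m /\ weight m' = (weight m).+1 &
    F = mon m') F'.
Proof.
elim: m => [|i m [F' dF rF]].
  exists (fun _ _ => 0); last exact: rspan0.
  move=> p x; apply: (eq_cder (cder_cst 1 x)) => // y.
  by rewrite /mon big_nil.
exists (fun p x => fac (i.1.+1, i.2) p x * mon m p x + fac i p x * F' p x).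
  move=> p x; apply: (eq_cder (cderM (isD_fac i p x) (dF p x))) => // y.
  by rewrite /mon big_cons.
apply: rspanD.
  apply: rspan_gen; exists ((i.1.+1, i.2) :: m).
    by rewrite /weight !big_cons.
  by apply: eq_fn => p x; rewrite /mon big_cons.
apply: rspan_bind rF => _ [m' [sm wm] ->]; apply: rspan_gen.
exists (i :: m'); last by apply: eq_fn => p x; rewrite /mon big_cons.
by rewrite /= sm /weight !big_cons -!/(weight _) wm addnS.
Qed.

(** The length is even and positive, so that one further factor [sol] produces an odd number
    [2 k + 1] of factors with [k] at least 1, as in the nonlinearity. *)
Definition Rep w (F : fn) := rspan (fun F' =>
  exists2 m, [/\ ~~ odd (size m), (0 < size m)%N & weight m = w] & F' = mon m) F.

Lemma RepM w w' F F' : Rep w F -> Rep w' F' ->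
  Rep (w + w') (fun p x => F p x * F' p x).
Proof.
apply: rspanM => _ _ [m [om sm wm] ->] [m' [om' sm' wm'] ->].
apply: rspan_gen; exists (m ++ m'); last by apply: eq_fn => p x; rewrite /mon big_cat.
rewrite size_cat oddD (negbTE om) (negbTE om') addn_gt0 sm.
by rewrite /weight big_cat /= -!/(weight _) wm wm'.
Qed.

Lemma RepD w F F' : Rep w F -> isD F F' -> Rep w.+1 F'.
Proof.
apply: rspan_isD_eq => _ [m [om sm wm] ->].
have [F'' dF rF] := monD m; exists F'' => //.
apply: rspan_sub rF => _ [m' [sm' wm'] ->]; apply: rspan_gen; exists m' => //.
by rewrite sm' wm' wm.
Qed.

Lemma Rep_conjsol n : Rep n.+2 (fun p x => conjc (sol p x) * dsol n p x).
Proof.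
apply: rspan_gen; exists [:: (0%N, false); (n, true)].
  by split => //; rewrite /weight !big_cons big_nil addn0.
by apply: eq_fn => p x; rewrite /mon !big_cons big_nil mulr1.
Qed.

Lemma Rep_Q2 : Rep 2 (fun p x => Q p x ^+ 2).
Proof.
apply: (eq_rspan (Rep_conjsol 0)) => p x; rewrite /dsol /= /sol conjcM conjQ.
by rewrite mulrACA EconjE mul1r.
Qed.

(* Multiplication by [W] is realised by [(C Q^2)'' = C (4 W Q^2 - 6 Q^4)]. *)
Lemma Rep_WX a b c : Rep a.+2 (fun p x => K p ^+ a * Q p x ^+ 2) ->
  Rep (a + 2 * b + 2 * c + 2) (fun p x => K p ^+ a * W p ^+ b * Q p x ^+ (2 * c + 2)).
Proof.
move=> Ra; elim: c => [|c IH]; last first.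
  have -> : (a + 2 * b + 2 * c.+1 + 2 = a + 2 * b + 2 * c + 2 + 2)%N.
    by rewrite mulnS; lia.
  apply: (eq_rspan (RepM IH Rep_Q2)) => p x.
  have -> : (2 * c.+1 + 2 = (2 * c + 2) + 2)%N by lia.
  by rewrite (exprD _ (2 * c + 2)%N 2) mulrA.
elim: b => [|b IH].
  by rewrite !muln0 !addn0 addn2; apply: (eq_rspan Ra) => p x; rewrite expr0 mulr1.
have d1 : isD (fun p x => K p ^+ a * W p ^+ b * Q p x ^+ (2 * 0 + 2))
   (fun p x => K p ^+ a * W p ^+ b * (2 * (Q p x ^+ 1 * Q1 p x))).
  move=> p x; apply: (eq_cder (cderZ _ (cder_QX p x 1))) => //.
  by ring.
have d2 : isD (fun p x => K p ^+ a * W p ^+ b * (2 * (Q p x ^+ 1 * Q1 p x)))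
   (fun p x => K p ^+ a * W p ^+ b * (2 * (2 * W p * Q p x ^+ 2 - 3 * Q p x ^+ 4))).
  move=> p x; apply: (eq_cder (cderZ _ (cderZ _ (cder_QXQ1 p x 0)))) => //.
have R2 := RepD (RepD IH d1) d2.
have R4 := RepM IH Rep_Q2.
rewrite [X in Rep X]((_ : _ = a + 2 * b.+1 + 2 * 0 + 2)%N) in R2; last by lia.
rewrite [X in Rep X]((_ : _ = a + 2 * b.+1 + 2 * 0 + 2)%N) in R4; last by lia.
apply: (eq_rspan (rspanZ (4^-1) (rspanD R2 (rspanZ 6 R4)))) => p x.
rewrite fmorphV !rmorph_nat muln0 add0n [W p ^+ b.+1]exprS; by field.
Qed.

(** Up to the factor [2 c + 2], [Q^(2 c + 1) Q1] is the derivative of [Q^(2 c + 2)]. *)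
Lemma Rep_WXQ1 a b c : Rep a.+2 (fun p x => K p ^+ a * Q p x ^+ 2) ->
  Rep (a + 2 * b + 2 * c + 3)
    (fun p x => K p ^+ a * W p ^+ b * (Q p x ^+ (2 * c + 1) * Q1 p x)).
Proof.
move=> /(@Rep_WX a b c) Ra.
have e : (2 * c + 2 = (2 * c + 1).+1)%N by lia.
have d1 : isD (fun p x => K p ^+ a * W p ^+ b * Q p x ^+ (2 * c + 2))
   (fun p x => K p ^+ a * W p ^+ b *
      ((2 * c + 2)%N%:R * (Q p x ^+ (2 * c + 1) * Q1 p x))).
  move=> p x; rewrite e; apply: (eq_cder (cderZ _ (cder_QX p x _))) => //.
  by rewrite -!mulrA.
have R2 := RepD Ra d1.
have -> : (a + 2 * b + 2 * c + 3 = (a + 2 * b + 2 * c + 2).+1)%N by lia.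
have H : ((2 * c + 2)%N%:R : R[i]) != 0 by rewrite pnatr_eq0 addn2.
apply: (eq_rspan (rspanZ ((2 * c + 2)%N%:R^-1) R2)) => p x.
by rewrite fmorphV !rmorph_nat (mulrCA (K p ^+ a * _)) mulKf.
Qed.

(* The product of [conjc u] and the [n]-th derivative of [u] is [K^n Q^2] up to
   terms with lower powers of [K]. *)
Lemma Rep_K n : Rep n.+2 (fun p x => K p ^+ n * Q p x ^+ 2).
Proof.
elim/ltn_ind: n => n IH.
have [N nN DN] := dsolP n.
(* By [dsolP] the product is [Q (a Q + b Q1 + N)]. Its deviation from [K^n Q^2] splits into three
   errors, which contain only powers of [K] below [n] and are covered by the induction
   hypothesis. *)
have RA : Rep n.+2 (fun p x => Q p x ^+ 2 * ((lincoef n p).1 - K p ^+ n)).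
  have [L _] := lincoefP n.
  apply: rspan_bind L => _ [a [b [an <- ->]]].
  have := Rep_WX b 0 (IH _ an); rewrite muln0 addn0 addn2 => /eq_rspan; apply.
  by move=> p x; rewrite mulrC.
have RB : Rep n.+2 (fun p x => (Q p x * Q1 p x) * (lincoef n p).2).
  case: n IH {N nN DN RA} => [|n] IH.
    by apply: (eq_rspan (rspan0 _)) => p x; rewrite mulr0.
  apply: rspan_bind (lincoef2P n) => _ [a [b [ab ->]]].
  have an : (a < n.+1)%N by lia.
  have := Rep_WXQ1 b 0 (IH _ an); rewrite muln0 addn0 ab addn3 => /eq_rspan; apply.
  by move=> p x; rewrite mulrC.
have RC : Rep n.+2 (fun p x => Q p x * N p x).
  apply: rspan_bind nN => _ [a [b [c [[ab ->]|[ab ->]]]]];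
    have an : (a < n)%N by [lia].
    have := Rep_WX b c.+1 (IH _ an).
    have -> : (a + 2 * b + 2 * c.+1 + 2 = n.+2)%N by lia.
    move=> /eq_rspan; apply => p x.
    have -> : (2 * c.+1 + 2 = (2 * c + 3).+1)%N by lia.
    by rewrite exprS mulrCA.
  have := Rep_WXQ1 b c.+1 (IH _ an).
  have -> : (a + 2 * b + 2 * c.+1 + 3 = n.+2)%N by lia.
  move=> /eq_rspan; apply => p x.
  have -> : (2 * c.+1 + 1 = (2 * c + 2).+1)%N by lia.
  by rewrite exprS; ring.
apply: (eq_rspan (rspanB (rspanB (rspanB (Rep_conjsol n) RA) RB) RC)) => p x.
rewrite DN /sol conjcM conjQ.
have -> : forall z, (conjc (E p x) * Q p x) * (E p x * z) = (conjc (E p x) * E p x) * (Q p x * z).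
  by move=> z; ring.
by rewrite EconjE; ring.
Qed.

Definition NRep w (F : fn) := rspan (fun F' =>
  exists2 m, [/\ odd (size m), (1 < size m)%N & weight m = w] & F' = mon m) F.

(** Each term of the nonlinear part contains a factor [Q]. Together with [E] it forms one factor
    [sol], and the cofactor has even degree and is representable. *)
Lemma dsol_NRep n : exists2 F : fn, NRep n.+1 F &
  forall p x, dsol n p x =
    E p x * ((lincoef n p).1 * Q p x + (lincoef n p).2 * Q1 p x) + F p x.
Proof.
have [N nN DN] := dsolP n.
exists (fun p x => E p x * N p x); last by move=> p x; rewrite DN mulrDr.
have solM F : Rep n F -> NRep n.+1 (fun p x => sol p x * F p x).
  apply: rspan_bind => _ [m [om sm wm] ->]; apply: rspan_gen.
  exists ((0%N, true) :: m); last first.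
    by apply: eq_fn => p x; rewrite /mon big_cons.
  by rewrite /= om ltnS sm /weight big_cons -/(weight _) wm.
apply: (@rspan_bind _ _ _ _ E) nN => _ [a [b [c [[ab ->]|[ab ->]]]]].
  have := Rep_WX b c (Rep_K a); rewrite ab => /solM /eq_rspan; apply => p x.
  by rewrite /sol (_ : (2 * c + 3 = (2 * c + 2).+1)%N) ?exprS; [ring|lia].
have := Rep_WXQ1 b c (Rep_K a); rewrite ab => /solM /eq_rspan; apply => p x.
by rewrite /sol (_ : (2 * c + 2 = (2 * c + 1).+1)%N) ?exprS; [ring|lia].
Qed.

(** The nonlinearity contains no time derivative, so it depends only on the spatial function at the
    time considered. *)
Lemma nonlinearity_ext j (c : @coefficients R j) (u : R -> R -> R[i]) t x p :
  u t = sol p -> nonlinearity c u t x =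
  \sum_(1 <= k < j.+1) \sum_(b : {ffun 'I_(2 * k).+1 -> bool})
  \sum_(alpha : {ffun 'I_(2 * k).+1 -> 'I_(2 * (j - k)).+1} |
         (\sum_i alpha i == 2 * (j - k))%N)
    (c k alpha b)%:C * \prod_(i < (2 * k).+1) fac (nat_of_ord (alpha i), b i) p x.
Proof.
move=> ut; apply: eq_bigr => k _; apply: eq_bigr => b _; apply: eq_bigr => al _.
congr (_ * _); apply: eq_bigr => i _; rewrite iter_dx /fac /=.
case: (b i); first by rewrite ut.
rewrite /dsol.
have -> : conjst u t = fun y => conjc (sol p y) by apply/funext => y; rewrite /conjst ut.
suff -> : cderiven (al i) (fun y => conjc (sol p y)) =
          fun y => conjc (cderiven (al i) (sol p) y) by [].
elim: (nat_of_ord (al i)) => // n IH; rewrite cderiven_S IH.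
apply/funext => y; apply: cder_cderive.
exact: cder_conj (isD_dsol n p y).
Qed.

(** A monomial with [2 k + 1] factors and weight [2 j + 1] has exactly [2 (j - k)] derivatives, and
    [k] is at most [j] because every factor weighs at least 1. It therefore changes exactly one
    coefficient of the equation. *)
Lemma NRep_coef j F : NRep (2 * j).+1 F -> exists c : @coefficients R j,
  forall (u : R -> R -> R[i]) t x p, u t = sol p -> nonlinearity c u t x = F p x.
Proof.
elim=> [|a F' F'' [m [om sm wm] ->] _ [c cP]].
  exists (fun _ _ _ => 0) => u t x p _; apply: big1 => k _; apply: big1 => b _.
  by apply: big1 => al _; rewrite mul0r.
pose k0 := (size m)./2.
have sk : size m = (2 * k0).+1 by rewrite -[LHS]odd_double_half om mul2n.
(* Indicator of the index that spells out [m]. For [k = k0] the list has [2 k + 1] entries, so the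
   default of [nth] is never reached. *)
pose ind k (alpha : {ffun 'I_(2 * k).+1 -> 'I_(2 * (j - k)).+1})
  (b : {ffun 'I_(2 * k).+1 -> bool}) : bool :=
  (k == k0) && [forall i, nth (0%N, true) m (nat_of_ord i) == (nat_of_ord (alpha i), b i)].
exists (fun k alpha b => a * (ind k alpha b)%:R + c k alpha b) => u t x p ut.
rewrite -(cP u t x p ut) !(nonlinearity_ext _ _ ut).
have wk : (\sum_(i <- m) i.1 = 2 * (j - k0))%N.
  have : weight m = (\sum_(i <- m) i.1 + size m)%N.
    rewrite /weight; elim: (m) => [|i m' IH]; first by rewrite !big_nil.
    by rewrite !big_cons IH /= addSn addnS addnA.
  by rewrite wm sk; lia.
have k0j : (0 < k0 < j.+1)%N.
  have : (size m <= weight m)%N.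
    rewrite /weight; elim: (m) => [|i m' IH] //.
    by rewrite big_cons /=; apply: leq_trans (leq_add (ltn0Sn i.1) IH).
  by move: sm; rewrite wm sk; lia.
have le_wk (i : 'I_(2 * k0).+1) : ((nth (0%N, true) m i).1 < (2 * (j - k0)).+1)%N.
  rewrite ltnS -wk (big_nth (0%N, true)) big_mkord.
  have im : (i < size m)%N by rewrite sk.
  by rewrite (bigD1 (Ordinal im)) //= leq_addr.
pose b0 : {ffun 'I_(2 * k0).+1 -> bool} := [ffun i => (nth (0%N, true) m (nat_of_ord i)).2].
pose al0 : {ffun 'I_(2 * k0).+1 -> 'I_(2 * (j - k0)).+1} :=
  [ffun i => Ordinal (le_wk i)].
have indP b al : ind k0 al b = (b == b0) && (al == al0).
  rewrite /ind eqxx /=; apply/forallP/andP => [H|[/eqP-> /eqP->] i]; last first.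
    by rewrite !ffunE /= -surjective_pairing.
  by split; apply/eqP/ffunP => i; rewrite ffunE; have /eqP e := H i;
    [rewrite e|apply: val_inj; rewrite /= e].
have sum_al0 : (\sum_i al0 i == 2 * (j - k0))%N.
  apply/eqP/(etrans _ wk); rewrite [RHS](big_nth (0%N, true)) big_mkord sk.
  by apply: eq_bigr => i _; rewrite ffunE.
transitivity (a%:C * \sum_(1 <= k < j.+1) \sum_(b : {ffun 'I_(2 * k).+1 -> bool})
  \sum_(alpha : {ffun 'I_(2 * k).+1 -> 'I_(2 * (j - k)).+1} |
         (\sum_i alpha i == 2 * (j - k))%N)
    (ind k alpha b)%:R * \prod_(i < (2 * k).+1) fac (nat_of_ord (alpha i), b i) p x +
  \sum_(1 <= k < j.+1) \sum_(b : {ffun 'I_(2 * k).+1 -> bool})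
  \sum_(alpha : {ffun 'I_(2 * k).+1 -> 'I_(2 * (j - k)).+1} |
         (\sum_i alpha i == 2 * (j - k))%N)
    (c k alpha b)%:C * \prod_(i < (2 * k).+1) fac (nat_of_ord (alpha i), b i) p x).
  rewrite mulr_sumr -big_split; apply: eq_bigr => k _.
  rewrite mulr_sumr -big_split; apply: eq_bigr => b _.
  rewrite mulr_sumr -big_split; apply: eq_bigr => al _ /=.
  by rewrite rmorphD rmorphM rmorph_nat mulrDl mulrA.
congr (_ * _ + _).
rewrite (bigD1_seq k0) ?mem_index_iota ?iota_uniq //= [X in _ + X]big1 ?addr0; last first.
  move=> k /negbTE kk0; apply: big1 => b _; apply: big1 => al _.
  by rewrite /ind kk0 mul0r.
rewrite (bigD1 b0) //= [X in _ + X]big1 ?addr0; last first.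
  by move=> b /negbTE bb0; apply: big1 => al _; rewrite indP bb0 mul0r.
rewrite (bigD1 al0) //= [X in _ + X]big1 ?addr0; last first.
  by move=> al /andP[_ /negbTE aa0]; rewrite indP aa0 andbF mul0r.
rewrite indP !eqxx mul1r /mon (big_nth (0%N, true)) big_mkord sk.
by apply: eq_bigr => i _; rewrite !ffunE /= -surjective_pairing.
Qed.

End SolitonAlgebra.

(** * Schwartz functions *)

Section RealDerivative.
Context {R : realType}.
Implicit Types (f g : R -> R) (x a b : R).

Lemma rderD f g x a b : is_derive x 1 f a -> is_derive x 1 g b ->
  is_derive x 1 (fun y => f y + g y) (a + b).
Proof. by move=> fa gb; apply: (is_deriveE (is_deriveD fa gb)). Qed.

Lemma rderM f g x a b : is_derive x 1 f a -> is_derive x 1 g b ->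
  is_derive x 1 (fun y => f y * g y) (a * g x + f x * b).
Proof.
move=> fa gb; apply: (is_deriveE (is_deriveM fa gb)) => //.
by rewrite /GRing.scale /=; ring.
Qed.

Lemma rderZ f x a b : is_derive x 1 f a -> is_derive x 1 (fun y => b * f y) (b * a).
Proof. by move=> fa; apply: (is_deriveE (is_deriveZ b fa)). Qed.

Lemma rder_comp f g x a b : is_derive (g x) 1 f a -> is_derive x 1 g b ->
  is_derive x 1 (fun y => f (g y)) (a * b).
Proof. by move=> fa gb; apply: (is_deriveE (is_derive1_comp fa gb)). Qed.

Lemma rder_affine x a b : is_derive x 1 (fun y => a * y + b) a.
Proof.
apply: (is_deriveE (rderD (rderZ a (is_derive_id x 1)) (is_derive_cst b x 1))) => //.
by rewrite mulr1 addr0.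
Qed.

Lemma rder_derivable f x a : is_derive x 1 f a -> derivable f x 1.
Proof. by case. Qed.

Lemma rderV f x a : f x != 0 -> is_derive x 1 f a ->
  is_derive x 1 (fun y => (f y)^-1) (- (f x) ^- 2 * a).
Proof.
move=> fx0 fa; have df := rder_derivable fa.
apply: DeriveDef; first exact: derivableV.
by rewrite (@deriveV _ _ _ _ _ fx0 df) derive_val.
Qed.

Lemma rder_continuous f : (forall x, derivable f x 1) -> continuous f.
Proof. by move=> df x; apply/differentiable_continuous/derivable1_diffP. Qed.

End RealDerivative.

(** * Hyperbolic secant and tangent *)

Section Hyperbolic.
Context {R : realType}.
Implicit Types x : R.

Definition sech x : R := 2 / (expR x + expR (- x)).
Definition tanh x : R := (expR x - expR (- x)) / (expR x + expR (- x)).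

Lemma cosh_gt0 x : 0 < expR x + expR (- x).
Proof. by rewrite addr_gt0 ?expR_gt0. Qed.

Lemma sech_gt0 x : 0 < sech x.
Proof. by rewrite divr_gt0 ?cosh_gt0. Qed.

Lemma is_derive_expRN x : is_derive x 1 (fun y : R => expR (- y)) (- expR (- x)).
Proof.
apply: (is_deriveE (rder_comp (is_derive_expR (- x)) (is_deriveNid x 1))) => //.
by rewrite mulrN mulr1.
Qed.

Lemma is_derive_cosh x :
  is_derive x 1 (fun y : R => expR y + expR (- y)) (expR x - expR (- x)).
Proof. exact: rderD (is_derive_expR x) (is_derive_expRN x). Qed.

Lemma is_derive_sinh x :
  is_derive x 1 (fun y : R => expR y - expR (- y)) (expR x + expR (- x)).
Proof.
apply: (is_deriveE (rderD (is_derive_expR x) (rderZ (-1) (is_derive_expRN x)))).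
  by move=> y; rewrite mulN1r.
by rewrite mulN1r opprK.
Qed.

Lemma sech_tanh2 x : sech x ^+ 2 = 1 - tanh x ^+ 2.
Proof.
have := cosh_gt0 x; rewrite /sech /tanh => /lt0r_neq0 h.
have e : expR (- x) = (expR x)^-1 := expRN x.
by move: h; rewrite e; move: (expR_gt0 x) => /lt0r_neq0 ? ?; field; rewrite ?h; apply/andP.
Qed.

Lemma is_derive_sech x : is_derive x 1 sech (- (sech x * tanh x)).
Proof.
have h := lt0r_neq0 (cosh_gt0 x).
have dV := @rderV _ (fun y => expR y + expR (- y)) _ _ h (is_derive_cosh x).
apply: (is_deriveE (rderZ 2 dV)) => //.
by rewrite /sech /tanh; field.
Qed.

Lemma is_derive_tanh x : is_derive x 1 tanh (1 - tanh x ^+ 2).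
Proof.
have h := lt0r_neq0 (cosh_gt0 x).
have dV := @rderV _ (fun y => expR y + expR (- y)) _ _ h (is_derive_cosh x).
apply: (is_deriveE (rderM (is_derive_sinh x) dV)) => //.
by rewrite /tanh; field.
Qed.

Lemma tanh_le1 x : `|tanh x| <= 1.
Proof.
rewrite -(@expr_le1 _ 2) // -normrX ger0_norm ?sqr_ge0 //.
by have := sqr_ge0 (sech x); rewrite sech_tanh2 subr_ge0.
Qed.

Lemma sech_le x : sech x <= 2 * expR (- `|x|).
Proof.
rewrite /sech ler_pM2l // (expRN `|x|) lef_pV2 ?posrE ?expR_gt0 ?cosh_gt0 //.
by have [_|_] := ger0P x; rewrite ?lerDl ?lerDr expR_ge0.
Qed.

Lemma exprn_expR_bound n : exists M : R, forall x, `|x| ^+ n * expR (- `|x|) <= M.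
Proof.
exists (n`!%:R) => x; rewrite expRN ler_pdivrMr ?expR_gt0 //.
case: n => [|n].
  by rewrite expr0 fact0 mul1r (le_trans _ (expR_ge1Dx _)) // lerDl.
have := expR_ge1Dxn n (normr_ge0 x).
have f0 : 0 < (n.+1)`!%:R :> R by rewrite ltr0n fact_gt0.
by rewrite addrC -lerBrDr ler_pdivrMr // mulrC => /le_trans; apply; rewrite ler_pM2l // gerBl.
Qed.

End Hyperbolic.

Section ComplexModulus.
Context {R : realType}.
Implicit Types (z w : R[i]) (x : R).

Lemma normc_ge0 z : 0 <= normc z.
Proof. by case: z => ? ?; exact: sqrtr_ge0. Qed.

Lemma normc_real x : normc (x%:C) = `|x|.
Proof. by rewrite /normc /= expr0n /= addr0 sqrtr_sqr. Qed.

Lemma normc_expi x : normc (expi x) = 1.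
Proof. by rewrite /normc /= cos2Dsin2 sqrtr1. Qed.

Lemma Re_le_normc z : `|complex.Re z| <= normc z.
Proof. by case: z => a b /=; rewrite -sqrtr_sqr ler_wsqrtr // lerDl sqr_ge0. Qed.

Lemma Im_le_normc z : `|complex.Im z| <= normc z.
Proof. by case: z => a b /=; rewrite -sqrtr_sqr ler_wsqrtr // lerDr sqr_ge0. Qed.

Lemma normc_le_ReIm z : normc z <= `|complex.Re z| + `|complex.Im z|.
Proof.
case: z => a b /=; rewrite -(ger0_norm (addr_ge0 (normr_ge0 a) (normr_ge0 b))).
rewrite -sqrtr_sqr ler_wsqrtr // sqrrD !real_normK ?num_real //.
by rewrite lerD2r lerDl mulrn_wge0 // mulr_ge0.
Qed.

Lemma expiD x y : expi (x + y) = expi x * expi y :> R[i].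
Proof.
rewrite /expi cosD sinD; transitivity ((cos x * cos y - sin x * sin y) +i*
  (cos x * sin y + sin x * cos y)) => //; congr (_ +i* _); exact: addrC.
Qed.

Lemma expi0 : expi 0 = 1 :> R[i].
Proof. by rewrite /expi cos0 sin0. Qed.

Lemma conjc_expi x : conjc (expi x) = expi (- x) :> R[i].
Proof. by rewrite /expi cosN sinN. Qed.

End ComplexModulus.

Section SchwartzClosure.
Context {R : realType}.
Implicit Types (f g : R -> R[i]).

(** Replaces formulas for iterated derivatives: one only has to find a family that contains [f], is
    stable under differentiation and decays rapidly. *)
Lemma schwartz_class (C : (R -> R[i]) -> Prop) :
  (forall f, C f -> exists2 f', (forall x, cder f x (f' x)) & C f') ->
  (forall f m, C f -> exists M : R, forall x, `|x| ^+ m * normc (f x) <= M) ->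
  forall f, C f -> is_schwartz f.
Proof.
move=> Cd Cb f Cf.
have Cn n : C (cderiven n f).
  elim: n => // n /Cd[f' df Cf'].
  have -> : cderiven n.+1 f = f' by apply/funext => x; exact: cder_cderive (df x).
  by [].
split=> [n x|m n]; last exact: Cb.
by have [f' df _] := Cd _ (Cn n); exact: cder_cderivable (df x).
Qed.

Lemma schwartzP f : is_schwartz f -> f \in schwartz_pred.
Proof. by move=> ?; apply/asboolP. Qed.

Lemma is_schwartz_lin (a : R[i]) f g : is_schwartz f -> is_schwartz g ->
  is_schwartz (fun x => a * f x + g x).
Proof.
move=> /schwartzP sf /schwartzP sg.
have [_ /(_ a f g sf sg)] := @schwartz_submod_closed R.
by move=> /asboolP.
Qed.

Lemma is_schwartzZ (a : R[i]) f : is_schwartz f -> is_schwartz (fun x => a * f x).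
Proof.
move=> sf; have s0 : is_schwartz (fun _ : R => 0 : R[i]).
  by have [/asboolP] := @schwartz_submod_closed R.
have := is_schwartz_lin a sf s0.
by under eq_fun do rewrite addr0.
Qed.

Lemma is_schwartz_derive f : is_schwartz f -> is_schwartz (cderive f).
Proof.
move=> [df bf]; split=> [n x|m n]; first by rewrite -cderiven_Sr; exact: df.
by have := bf m n.+1; rewrite cderiven_Sr.
Qed.

Lemma is_schwartz_cder f : is_schwartz f -> forall x, cder f x (cderive f x).
Proof. by move=> [df _] x; apply: cderivable_cder; exact: (df 0%N). Qed.

Lemma expr1D_le (x : R) m : (1 + `|x|) ^+ m <= 2 ^+ m * (1 + `|x| ^+ m).
Proof.
have [x1|x1] := leP `|x| 1.
  apply: (@le_trans _ _ (2 ^+ m)).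
    by rewrite lerXn2r ?nnegrE //; lra.
  by rewrite ler_peMr ?exprn_ge0 // lerDl exprn_ge0.
apply: (@le_trans _ _ ((2 * `|x|) ^+ m)).
  by rewrite lerXn2r ?nnegrE //; lra.
by rewrite exprMn ler_wpM2l ?exprn_ge0 // lerDr.
Qed.

Lemma is_schwartz_bound f m : is_schwartz f ->
  exists2 M : R, 0 <= M & forall x, (1 + `|x|) ^+ m * normc (f x) <= M.
Proof.
move=> [_ bf].
have [M0 b0] := bf 0%N 0%N; have [M1 b1] := bf m 0%N.
exists (2 ^+ m * (M0 + M1)).
  rewrite mulr_ge0 ?exprn_ge0 // addr_ge0 //.
    by apply: le_trans (b0 0); rewrite mulr_ge0 ?normc_ge0.
  by apply: le_trans (b1 0); rewrite mulr_ge0 ?exprn_ge0 ?normc_ge0.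
move=> x.
apply: le_trans (ler_wpM2r (normc_ge0 _) (expr1D_le x m)) _.
rewrite -mulrA ler_wpM2l ?exprn_ge0 // mulrDl mul1r lerD //.
by have := b0 x; rewrite expr0 mul1r.
Qed.

Lemma cder_mod (k c : R) f x d : cder f x d ->
  cder (fun y => expi (k * y + c) * f y) x
    (expi (k * x + c) * (0 +i* k * f x + d)).
Proof.
move=> fd; apply: (eq_cder (cderM (cder_comp (rder_affine x k c) (cder_expi _)) fd)) => //.
have -> : 0 +i* k = k%:C * 'i by rewrite /= /GRing.mul /=; congr (_ +i* _); ring.
ring.
Qed.

Lemma is_schwartz_mod (k c : R) f : is_schwartz f ->
  is_schwartz (fun x => expi (k * x + c) * f x).
Proof.
move=> sf; pose C h := exists2 g, is_schwartz g & h = fun x => expi (k * x + c) * g x.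
apply: (@schwartz_class C); last by exists f.
  move=> _ [g sg ->]; exists (fun x => expi (k * x + c) * (0 +i* k * g x + cderive g x)).
    by move=> x; apply/cder_mod/is_schwartz_cder.
  exists (fun x => 0 +i* k * g x + cderive g x) => //.
  exact/is_schwartz_lin/is_schwartz_derive.
move=> _ m [g [_ bg] ->]; have [M Mg] := bg m 0%N; exists M => x.
by rewrite normcM normc_expi mul1r; exact: Mg.
Qed.

Lemma affine_weight (a b : R) : a != 0 -> exists2 A : R, 0 <= A &
  forall x, 1 + `|x| <= A * (1 + `|a * x + b|).
Proof.
move=> a0; exists (1 + (1 + `|b|) / `|a|).
  by rewrite addr_ge0 // divr_ge0 // addr_ge0.
move=> x; have e : x = (a * x + b - b) / a by rewrite addrK mulrC mulKf.
have na : 0 < `|a| by rewrite normr_gt0.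
rewrite mulrDl mul1r lerD ?lerDl //.
rewrite {1}e normrM normfV mulrAC ler_pM2r ?invr_gt0 //.
apply: le_trans (ler_normB _ _) _.
move: (normr_ge0 (a * x + b)) (normr_ge0 b); nra.
Qed.

Lemma is_schwartz_affine (a b : R) f : a != 0 -> is_schwartz f ->
  is_schwartz (fun x => f (a * x + b)).
Proof.
move=> a0 sf; pose C h := exists2 g, is_schwartz g & h = fun x => g (a * x + b).
apply: (@schwartz_class C); last by exists f.
  move=> _ [g sg ->]; exists (fun x => a%:C * cderive g (a * x + b)).
    by move=> x; exact: cder_comp (rder_affine x a b) (is_schwartz_cder sg _).
  exists (fun x => a%:C * cderive g x) => //.
  exact/is_schwartzZ/is_schwartz_derive.
move=> _ m [g sg ->]; have [M M0 Mg] := is_schwartz_bound m sg.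
have [A A0 Aw] := affine_weight b a0.
exists (A ^+ m * M) => x.
apply: (@le_trans _ _ ((1 + `|x|) ^+ m * normc (g (a * x + b)))).
  by rewrite ler_wpM2r ?normc_ge0 // lerXn2r ?nnegrE ?addr_ge0 // lerDr.
apply: (@le_trans _ _ ((A * (1 + `|a * x + b|)) ^+ m * normc (g (a * x + b)))).
  by rewrite ler_wpM2r ?normc_ge0 // lerXn2r ?nnegrE ?addr_ge0 ?mulr_ge0 ?addr_ge0.
by rewrite exprMn -mulrA ler_wpM2l ?exprn_ge0.
Qed.

Lemma horner_bound (p : {poly R}) (x : R) : `|p.[x]| <= \sum_(i < size p) `|p`_i| * `|x| ^+ i.
Proof.
rewrite horner_coef; apply: le_trans (ler_norm_sum _ _ _) _.
by apply: ler_sum => i _; rewrite normrM normrX.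
Qed.

(** The products of [sech] with polynomials in [tanh] are stable under differentiation, and the
    polynomial factor stays bounded because [tanh] does. *)
Lemma is_schwartz_sech : is_schwartz (fun x : R => (sech x)%:C).
Proof.
pose C h := exists p : {poly R}, h = fun x => (sech x * p.[tanh x])%:C.
apply: (@schwartz_class C); last first.
- by exists 1; apply/funext => x; rewrite hornerC mulr1.
- move=> _ m [p ->]; have [M bM] := @exprn_expR_bound R m.
  exists (2 * M * \sum_(i < size p) `|p`_i|) => x.
  rewrite normc_real normrM (gtr0_norm (sech_gt0 x)) mulrA.
  apply: ler_pM => //; first by rewrite mulr_ge0 ?exprn_ge0 // ltW // sech_gt0.
    apply: le_trans (ler_wpM2l (exprn_ge0 m (normr_ge0 x)) (sech_le x)) _.
    by rewrite mulrCA ler_pM2l.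
  apply: le_trans (horner_bound _ _) _; apply: ler_sum => i _.
  by rewrite ler_piMr // exprn_ile1 // tanh_le1.
- move=> _ [p ->].
  exists (fun x => (sech x * (- 'X * p + p^`() * (1 - 'X ^+ 2)).[tanh x])%:C); last first.
    by eexists; reflexivity.
  move=> x; apply: cder_real.
  have dp := rder_comp (is_derive_poly p _) (is_derive_tanh x).
  apply: (is_deriveE (rderM (is_derive_sech x) dp)) => //.
  have -> : (- 'X * p + p^`() * (1 - 'X ^+ 2)).[tanh x] =
    - tanh x * p.[tanh x] + p^`().[tanh x] * (1 - tanh x ^+ 2) by rewrite !hornerE.
  by ring.
Qed.

Definition gauss (x : R) : R := expR (- (x ^+ 2 / 2)).

Lemma is_derive_gauss (x : R) : is_derive x 1 gauss (- x * gauss x).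
Proof.
have h : is_derive x 1 (fun y : R => - (y ^+ 2 / 2)) (- x).
  apply: (is_deriveE (rderZ (- 2^-1) (rderM (is_derive_id x 1) (is_derive_id x 1)))).
    by move=> y; rewrite expr2; field.
  by field.
by apply: (is_deriveE (rder_comp (is_derive_expR _) h)) => //; rewrite mulrC.
Qed.

Lemma gauss_le (x : R) : gauss x <= expR 1 * expR (- `|x|).
Proof.
rewrite -expRD ler_expR -(@real_normK _ x) ?num_real //.
by have := sqr_ge0 (`|x| - 1); rewrite expr2; lra.
Qed.

Lemma is_schwartz_gauss : is_schwartz (fun x : R => (gauss x)%:C).
Proof.
pose C h := exists p : {poly R}, h = fun x => (p.[x] * gauss x)%:C.
apply: (@schwartz_class C); last first.
- by exists 1; apply/funext => x; rewrite hornerC mul1r.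
- move=> _ m [p ->].
  have [b bP] := boolp.choice (@exprn_expR_bound R).
  exists (expR 1 * \sum_(i < size p) `|p`_i| * b (m + i)%N) => x.
  have pb := horner_bound p x.
  rewrite normc_real normrM (ger0_norm (expR_ge0 _)).
  apply: (@le_trans _ _ (`|x| ^+ m * (\sum_(i < size p) `|p`_i| * `|x| ^+ i * (expR 1 * expR (- `|x|))))).
    by rewrite ler_wpM2l ?exprn_ge0 // -mulr_suml; apply: ler_pM; rewrite ?expR_ge0 ?gauss_le.
  rewrite mulr_sumr mulr_sumr; apply: ler_sum => i _.
  have -> : `|x| ^+ m * (`|p`_i| * `|x| ^+ i * (expR 1 * expR (- `|x|))) =
    expR 1 * (`|p`_i| * (`|x| ^+ (m + i) * expR (- `|x|))) by rewrite exprD; ring.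
  by rewrite ler_wpM2l ?expR_ge0 // ler_wpM2l.
- move=> _ [p ->].
  exists (fun x => ((p^`() - 'X * p).[x] * gauss x)%:C); last first.
    by eexists; reflexivity.
  move=> x; apply: cder_real.
  apply: (is_deriveE (rderM (is_derive_poly p x) (is_derive_gauss x))) => //.
  have -> : (p^`() - 'X * p).[x] = p^`().[x] - x * p.[x] by rewrite !hornerE.
  by ring.
Qed.

End SchwartzClosure.

(** * Solitons *)

Section TravellingWave.
Context {R : realType}.
Implicit Types (k th v : R) (f : R -> R[i]).

Definition wave k th v f : R -> R -> R[i] := fun t x =>
  expi (k * x + th * t) * f (x - v * t).

Lemma wave_dx k th v f d t x : cder f (x - v * t) d ->
  cder (wave k th v f t) x (expi (k * x + th * t) * (0 +i* k * f (x - v * t) + d)).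
Proof.
move=> fd; apply: (@cder_mod _ k (th * t) (fun y => f (y - v * t))).
apply: (eq_cder (cder_comp (rder_affine x 1 (- (v * t))) _)) => [|y|].
- by rewrite mul1r; exact: fd.
- by rewrite mul1r.
- by rewrite mul1r.
Qed.

Lemma wave_dt k th v f d t x : cder f (x - v * t) d ->
  cder (fun t' => wave k th v f t' x) t
    (expi (k * x + th * t) * (0 +i* th * f (x - v * t) + (- v)%:C * d)).
Proof.
move=> fd.
have H : cder (fun t' => f (x - v * t')) t ((- v)%:C * d).
  apply: (eq_cder (cder_comp (rder_affine t (- v) x) _)) => [|y|].
  - by rewrite addrC mulNr; exact: fd.
  - by rewrite addrC mulNr.
  - by [].
apply: (eq_cder (@cder_mod _ th (k * x) _ _ _ H)) => [y|]; last by rewrite addrC.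
by rewrite addrC.
Qed.

(** A derivative in time or space changes only the profile and leaves phase and velocity alone. All
    mixed partial derivatives are thus controlled by Schwartz profiles. *)
Lemma partial_wave k th v f w : is_schwartz f ->
  exists2 g, is_schwartz g & partial w (wave k th v f) = wave k th v g.
Proof.
move=> sf; elim: w => [|b w [g sg e]]; first by exists f.
rewrite /= e; case: b.
  exists (fun x => 0 +i* th * g x + (- v)%:C * cderive g x).
    exact/is_schwartz_lin/is_schwartzZ/is_schwartz_derive.
  apply/funext => t; apply/funext => x; apply: cder_cderive.
  exact/wave_dt/is_schwartz_cder.
exists (fun x => 0 +i* k * g x + cderive g x).
  exact/is_schwartz_lin/is_schwartz_derive.
apply/funext => t; apply/funext => x; apply: cder_cderive.
exact/wave_dx/is_schwartz_cder.
Qed.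

Lemma wave_smooth k th v f T : is_schwartz f ->
  smooth_rapidly_decaying T (wave k th v f).
Proof.
move=> sf; split=> [w t x _|w m T' _]; have [g sg ->] := partial_wave k th v w sf.
  by split; apply: cder_cderivable; [apply: wave_dt|apply: wave_dx]; exact: is_schwartz_cder.
have [M M0 Mg] := is_schwartz_bound m sg.
(* For [|t| <= T'], translation by [v t] changes the weight [1 + |x|] at most by the factor
   [1 + |v| |T'|]. *)
exists ((1 + `|v| * `|T'|) ^+ m * M) => t x tT'.
rewrite /wave normcM normc_expi mul1r.
apply: (@le_trans _ _ (((1 + `|v| * `|T'|) * (1 + `|x - v * t|)) ^+ m * normc (g (x - v * t)))).
  rewrite ler_wpM2r ?normc_ge0 // lerXn2r ?nnegrE ?mulr_ge0 ?addr_ge0 ?mulr_ge0 //.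
  have vt : `|v * t| <= `|v| * `|T'|.
    by rewrite normrM ler_wpM2l // (le_trans tT') // ler_norm.
  have : `|x| <= `|x - v * t| + `|v * t|.
    by rewrite -[in leLHS](subrK (v * t) x) ler_normD.
  move: (normr_ge0 (x - v * t)) (normr_ge0 (v * t)); nra.
by rewrite exprMn -mulrA ler_wpM2l ?exprn_ge0 ?addr_ge0 ?mulr_ge0.
Qed.

End TravellingWave.

Section Soliton.
Context {R : realType}.
Implicit Types (k w th v : R).

(* The real and imaginary parts of [(k + i w)^n], the latter divided by [w]. *)
Fixpoint cpow k w (n : nat) : R * R :=
  if n is m.+1 then
    (k * (cpow k w m).1 - w ^+ 2 * (cpow k w m).2,
     (cpow k w m).1 + k * (cpow k w m).2)
  else (1, 0).

Definition profile w : R -> R[i] := fun x => (w * sech (w * x))%:C.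

(** The phase speed cancels the [Q] term and the velocity the [Q'] term of the linear part of the
    equation. *)
Definition soliton (j : nat) k w : R -> R -> R[i] :=
  wave k (- (cpow k w (2 * j)).1) (cpow k w (2 * j)).2 (profile w).

Lemma is_schwartz_profile w : w != 0 -> is_schwartz (profile w).
Proof.
move=> w0; have := is_schwartzZ (w%:C) (is_schwartz_affine 0 w0 is_schwartz_sech).
congr is_schwartz; apply/funext => x.
by rewrite /profile addr0 realcM.
Qed.

(** Frequency, scale, phase and position. Time enters a soliton only through the last two, so a
    relation valid for all parameters holds at all times. *)
Let par : Type := R * R * R * R.
Let pk (p : par) := p.1.1.1.
Let pw (p : par) := p.1.1.2.
Let pc (p : par) := p.1.2.
Let pa (p : par) := p.2.
Let K (p : par) : R[i] := 0 +i* pk p.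
Let W (p : par) : R[i] := (pw p ^+ 2)%:C.
Let E (p : par) x : R[i] := expi (pk p * x + pc p).
Let Q (p : par) x : R[i] := profile (pw p) (x - pa p).
Let Q1 (p : par) x : R[i] :=
  (- (pw p ^+ 2 * (sech (pw p * (x - pa p)) * tanh (pw p * (x - pa p)))))%:C.

(** With [K = i k] and [W = w^2] the recursion for the coefficients [(a, b)] reads
    [a + w b = (i k + w)^n = i^n (k - i w)^n]. *)
Lemma lincoef_cpow (p : par) n :
  lincoef K W n p = ('i ^+ n * ((cpow (pk p) (pw p) n).1)%:C,
                     - ('i ^+ n.+1 * ((cpow (pk p) (pw p) n).2)%:C)).
Proof.
have KE : K p = 'i * (pk p)%:C.
  by apply/eqP; rewrite eq_complex /=; apply/andP; split; apply/eqP; ring.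
have i2 : 'i * 'i = -1 :> R[i] by rewrite -expr2 sqr_i.
elim: n => [|n IH] /=.
  by rewrite mulr0 oppr0 expr0 mul1r.
rewrite IH /= KE /W; congr pair.
  rewrite !exprS realcD realcN !realcM.
  by ring: i2.
rewrite !exprS realcD !realcM.
by ring: i2.
Qed.

Lemma soliton_equation j : exists c : @coefficients R j,
  forall T k w, w != 0 -> classical_solution c T (soliton j k w).
Proof.
have EconjE p x : conjc (E p x) * E p x = 1.
  by rewrite conjc_expi -expiD addNr expi0.
have conjQ p x : conjc (Q p x) = Q p x.
  by rewrite /Q /profile /conjc /= oppr0.
have dE p x : cder (E p) x (K p * E p x).
  apply: (eq_cder (@cder_mod _ (pk p) (pc p) _ x _ (cder_cst 1 x))) => [y|].
    by rewrite mulr1.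
  by rewrite mulr1 addr0 mulrC.
have arg (p : par) (x : R) : is_derive x 1 (fun y => pw p * (y - pa p)) (pw p).
  by apply: (is_deriveE (rder_affine x (pw p) (- (pw p * pa p)))) => // y; ring.
have dQ p x : cder (Q p) x (Q1 p x).
  apply: cder_real.
  apply: (is_deriveE (rderZ (pw p) (rder_comp (is_derive_sech _) (arg p x)))) => //.
  by ring.
have dQ1 p x : cder (Q1 p) x (W p * Q p x - 2 * Q p x ^+ 3).
  have := rderM (is_derive_sech (pw p * (x - pa p))) (is_derive_tanh (pw p * (x - pa p))).
  move=> /(fun H => rder_comp H (arg p x)) /(rderZ (- pw p ^+ 2)) H.
  have e : W p * Q p x - 2 * Q p x ^+ 3 =
    (pw p ^+ 2 * (pw p * sech (pw p * (x - pa p))) -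
     2 * (pw p * sech (pw p * (x - pa p))) ^+ 3)%:C.
    by rewrite /W /Q /profile realcD realcN !(realcM, realcX, realc_nat).
  rewrite e; apply: cder_real; apply: (is_deriveE H) => [y|]; first by rewrite mulNr.
  move: (sech_tanh2 (pw p * (x - pa p))) => h.
  have -> : 1 - tanh (pw p * (x - pa p)) ^+ 2 = sech (pw p * (x - pa p)) ^+ 2 by rewrite h.
  have {}h : tanh (pw p * (x - pa p)) * tanh (pw p * (x - pa p)) = 1 - sech (pw p * (x - pa p)) ^+ 2.
    by rewrite h expr2; ring.
  by ring: h.
have Q1E p x : Q1 p x ^+ 2 = W p * Q p x ^+ 2 - Q p x ^+ 4.
  rewrite /Q1 /W /Q /profile -!realcX -realcM -realcN -realcD; congr (_%:C).
  have h : tanh (pw p * (x - pa p)) * tanh (pw p * (x - pa p)) = 1 - sech (pw p * (x - pa p)) ^+ 2.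
    by rewrite sech_tanh2 expr2; ring.
  by ring: h.
have [F NF DF] := dsol_NRep EconjE conjQ dE dQ dQ1 Q1E (2 * j).
have NF' := rspanZ ((-1) ^+ j.+1) NF.
have [c cP] := NRep_coef dE dQ dQ1 Q1E NF'.
exists c => T k w w0; split; first exact/wave_smooth/is_schwartz_profile.
move=> t x tT.
pose X := (cpow k w (2 * j)).1; pose Y := (cpow k w (2 * j)).2.
pose p : par := (k, w, - X * t, Y * t).
have up : soliton j k w t = sol E Q p by [].
rewrite (cP _ _ _ _ up) iter_dx up -/(dsol E Q (2 * j) p x) DF lincoef_cpow.
have -> : dt (soliton j k w) t x = E p x * (0 +i* (- X) * Q p x + (- Y)%:C * Q1 p x).
  apply: cder_cderive; apply: wave_dt.
  have := dQ (k, w, 0, 0) (x - Y * t); rewrite /Q /Q1 /pw /pa /= subr0.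
  by move=> H; apply: (eq_cder H) => // y; rewrite subr0.
have -> : 0 +i* (- X) = - 'i * X%:C.
  by apply/eqP; rewrite eq_complex /=; apply/andP; split; apply/eqP; ring.
have -> : 'i ^+ (2 * j) = (-1) ^+ j :> R[i] by rewrite exprM sqr_i.
have -> : 'i ^+ (2 * j).+1 = (-1) ^+ j * 'i :> R[i] by rewrite exprSr exprM sqr_i.
have i2 : 'i * 'i = -1 :> R[i] by rewrite -expr2 sqr_i.
have s2 : (-1) ^+ j * (-1) ^+ j = 1 :> R[i] by rewrite -expr2 sqrr_sign.
rewrite -[pk p]/k -[pw p]/w -/X -/Y realcX !realcN exprS.
(* The imaginary unit of the equation is spelled [0 +i* 1]; it is identified with ['i] so that
   [ring] can use [i2]. *)
set z := (X in X * (E p x * (_ + (- _) * _)) + _); have -> : z = 'i%R by [].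
by rewrite /=; ring: i2 s2.
Qed.

End Soliton.

(** * Integrals over the real line *)

Section RealIntegral.
Context {R : realType}.
Implicit Types (f g F G : R -> R) (x a b : R).
Notation mu := (@lebesgue_measure R).

Definition rint f := mu.-integrable setT (EFin \o f).

(* Domination by a multiple of [1 / (1 + x^2)], whose primitive is [atan]. *)
Definition dominated f :=
  continuous f /\ exists C, forall x, `|f x| <= C * (oneDsqr x)^-1.

Lemma oneDsqrV_ge0 x : 0 <= (oneDsqr x)^-1.
Proof. by rewrite invr_ge0 (le_trans _ (oneDsqr_ge1 x)). Qed.

Lemma continuous_mu f : continuous f -> measurable_fun setT f.
Proof. exact: continuous_measurable_fun. Qed.

Lemma ftcT f F (l l' : R) : continuous f -> (forall x, 0 <= f x) ->
  (forall x, is_derive x 1 F (f x)) ->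
  F x @[x --> +oo] --> l -> F (- x) @[x --> +oo] --> l' ->
  (\int[mu]_x (f x)%:E = (l - l')%:E)%E.
Proof.
move=> cf f0 dF Fl Fl'.
have cF : continuous F by apply: rder_continuous => x; exact: rder_derivable (dF x).
have mf := continuous_mu cf.
rewrite -(setUv [set` `]-oo, (0 : R)]]) ge0_integral_setU //=; first last.
- exact/disj_setPCl.
- by move=> x _; rewrite lee_fin.
- by apply/measurable_EFinP; rewrite setUv.
- exact: measurableC.
rewrite setCitvl /=.
have -> : (\int[mu]_(x in `]0%R, +oo[) (f x)%:E = l%:E - (F 0)%:E)%E.
  rewrite integral_itv_obnd_cbnd; last exact/measurable_EFinP/measurable_funTS.
  apply: ge0_continuous_FTC2y Fl _ _ _ => //.
  - exact: continuous_subspaceT.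
  - by apply: cvg_at_right_filter; exact: cF.
  - by move=> x _; rewrite derive1E; have [_ ->] := dF x.
(* The left half line is reflected onto the right one, where [- F (- x)] is a primitive of the
   reflected integrand. *)
have -> : (\int[mu]_(x in `]-oo, 0%R]) (f x)%:E = (F 0)%:E - l'%:E)%E.
  rewrite -{1}oppr0 ge0_integration_by_substitutionNy //; last first.
    exact: continuous_subspaceT.
  have -> : ((F 0)%:E - l'%:E)%E = ((- l')%:E - (- F (- 0))%:E)%E.
    by rewrite oppr0 -!EFinD opprK addrC.
  have dN (y : R) : is_derive y 1 (fun x => - F (- x)) (f (- y)).
    have H := rderZ (-1) (rder_comp (dF (- y)) (is_deriveNid y 1)).
    by apply: (is_deriveE H) => [z|]; rewrite ?mulN1r // mulrN1 opprK.
  apply: (@ge0_continuous_FTC2y _ (f \o -%R) (fun x => - F (- x))).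
  - by move=> x _; exact: f0.
  - apply: continuous_subspaceT => x; apply: continuous_comp; last exact: cf.
    exact: opp_continuous.
  - exact: cvgN.
  - by move=> x _; exact: rder_derivable (dN x).
  - apply: cvg_at_right_filter; move: (0 : R).
    by apply: rder_continuous => x; exact: rder_derivable (dN x).
  - by move=> x _; rewrite derive1E; have [_ ->] := dN x.
by rewrite -!EFinD; congr EFin; ring.
Qed.

Lemma ftcT_rint f F (l l' : R) : continuous f -> (forall x, 0 <= f x) ->
  (forall x, is_derive x 1 F (f x)) ->
  F x @[x --> +oo] --> l -> F (- x) @[x --> +oo] --> l' ->
  rint f /\ \int[mu]_x f x = l - l'.
Proof.
move=> cf f0 dF Fl Fl'; have e := ftcT cf f0 dF Fl Fl'; split; last by rewrite /Rintegral e.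
apply/integrableP; split; first by apply/measurable_EFinP; exact: continuous_mu cf.
have -> : (\int[mu]_x `|(EFin \o f) x| = \int[mu]_x (f x)%:E)%E.
  by apply: eq_integral => x _ /=; rewrite ger0_norm.
by rewrite e ltry.
Qed.

Lemma is_derive_atan_oneDsqr x : is_derive x 1 atan (oneDsqr x)^-1.
Proof. exact: is_derive1_atan. Qed.

Lemma cvg_atanN : atan (- x) @[x --> +oo] --> - (pi / 2 : R).
Proof.
have -> : (fun x => atan (- x)) = (fun x : R => - atan x).
  by apply/funext => x; rewrite atanN.
by apply: cvgN; exact: cvgy_atan.
Qed.

Lemma rint_oneDsqr : rint (fun x => (oneDsqr x)^-1) /\
  \int[mu]_x (oneDsqr x)^-1 = pi.
Proof.
have [? ->] := ftcT_rint (@continuous_oneDsqrV R) oneDsqrV_ge0 is_derive_atan_oneDsqr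
  (@cvgy_atan R) cvg_atanN.
by split=> //; field.
Qed.

Lemma rintZ (a : R) f : rint f -> rint (fun x => a * f x).
Proof. by move=> rf; apply: (integrableZl _ a rf). Qed.

Lemma rintD f g : rint f -> rint g -> rint (fun x => f x + g x).
Proof. by move=> rf rg; apply: (integrableD _ rf rg). Qed.

Lemma rintB f g : rint f -> rint g -> rint (fun x => f x - g x).
Proof. by move=> rf rg; apply: (integrableB _ rf rg). Qed.

Lemma le_rint f g : measurable_fun setT f -> (forall x, `|f x| <= g x) ->
  rint g -> rint f.
Proof.
move=> mf fg; apply: le_integrable => //; first exact/measurable_EFinP.
by move=> x _; rewrite lee_fin (le_trans (fg x)) // ler_norm.
Qed.

Lemma dominated_rint f : dominated f -> rint f.
Proof.
move=> [cf [C fC]]; apply: le_rint fC _; first exact: continuous_mu.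
exact/rintZ/(rint_oneDsqr.1).
Qed.

Lemma dominated_ge0 f : dominated f ->
  exists2 C, 0 <= C & forall x, `|f x| <= C * (oneDsqr x)^-1.
Proof.
move=> [_ [C fC]]; exists C => //.
by have := fC 0; rewrite /oneDsqr expr0n /= addr0 invr1 mulr1; apply: le_trans.
Qed.

Lemma cvg_oneDsqrV : (oneDsqr x)^-1 @[x --> +oo] --> (0 : R).
Proof.
apply/cvgrPdist_le => e e0; near=> x.
have x1 : 1 <= x by near: x; exact: nbhs_pinfty_ge.
have xe : e^-1 <= x by near: x; apply: nbhs_pinfty_ge; exact: num_real.
rewrite sub0r normrN ger0_norm ?oneDsqrV_ge0 // -[leRHS]invrK lef_pV2 ?posrE ?invr_gt0 //.
  by apply: le_trans xe _; rewrite /oneDsqr expr2; nra.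
Unshelve. all: by end_near. Qed.

Lemma dominated_cvg0 f : dominated f -> f x @[x --> +oo] --> 0.
Proof.
move=> /dominated_ge0[C C0 fC].
apply/norm_cvg0P.
apply: (@squeeze_cvgr _ _ _ _ (cst 0) (fun x => C * (oneDsqr x)^-1)).
- by apply: nearW => x; rewrite normr_ge0 fC.
- exact: cvg_cst.
- by rewrite -(mulr0 C); apply: cvgMr; exact: cvg_oneDsqrV.
Qed.

Lemma oneDsqrN x : oneDsqr (- x) = oneDsqr x.
Proof. by rewrite /oneDsqr sqrrN. Qed.

(* [f + C / (1 + x^2)] is nonnegative and has the primitive [F + C atan]. *)
Lemma integral_derive_dominated f F : dominated f -> dominated F ->
  (forall x, is_derive x 1 F (f x)) -> \int[mu]_x f x = 0.
Proof.
move=> df dF FD; have rf := dominated_rint df.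
have [C C0 fC] := dominated_ge0 df.
pose g x := f x + C * (oneDsqr x)^-1.
have cg : continuous g.
  move=> x; apply: cvgD; first exact: df.1.
  by apply: cvgMr; exact: continuous_oneDsqrV.
have g0 x : 0 <= g x by have := fC x; rewrite ler_norml /g => /andP[]; lra.
have dg x : is_derive x 1 (fun y => F y + C * atan y) (g x).
  exact: rderD (FD x) (rderZ C (is_derive_atan_oneDsqr x)).
have dF' : dominated (fun x => F (- x)).
  split; last by have [_ [M FM]] := dF; exists M => x; rewrite -oneDsqrN.
  by move=> x; apply: continuous_comp; [exact: opp_continuous|exact: dF.1].
have l1 : F x + C * atan x @[x --> +oo] --> 0 + C * (pi / 2).
  by apply: cvgD; [exact: dominated_cvg0|apply: cvgMr; exact: cvgy_atan].
have l2 : F (- x) + C * atan (- x) @[x --> +oo] --> 0 + C * (- (pi / 2)).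
  by apply: cvgD; [exact: dominated_cvg0 dF'|apply: cvgMr; exact: cvg_atanN].
have [_ e] := ftcT_rint cg g0 dg l1 l2.
have [r1 e1] := rint_oneDsqr.
have : \int[mu]_x g x = \int[mu]_x f x + C * \int[mu]_x (oneDsqr x)^-1.
  rewrite /g RintegralD ?RintegralZl //; exact: rintZ.
by rewrite e e1 => H; lra.
Qed.

Lemma integral_affine_ge0 f a b : 0 < a -> continuous f -> (forall x, 0 <= f x) ->
  (\int[mu]_x (f x)%:E = a%:E * \int[mu]_x (f (a * x + b))%:E)%E.
Proof.
move=> a0 cf f0; pose F x := a * x + b.
have dF x : is_derive x 1 F a by exact: rder_affine.
have F' : derive1 F = cst a by apply/funext => x; rewrite derive1E; have [_ ->] := dF x.
have cF : continuous F by apply: rder_continuous => x; exact: rder_derivable (dF x).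
rewrite (@increasing_ge0_integration_by_substitutionT _ F f) //.
- rewrite F' -ge0_integralZl //.
  + by apply: eq_integral => x _; rewrite /= -EFinM mulrC.
  + apply/measurable_EFinP; apply: continuous_mu => x.
    by apply: continuous_comp; [exact: cF|exact: cf].
  + by move=> x _; rewrite lee_fin.
  + by rewrite lee_fin ltW.
- by move=> x y xy; rewrite /F ltrD2r ltr_pM2l.
- by rewrite F' => x; exact: cvg_cst.
- by rewrite F'; exact: is_cvg_cst.
- by rewrite F'; exact: is_cvg_cst.
- by apply/cvgrNyPle => M; near=> x; rewrite /F -lerBrDr -ler_pdivlMl.
- by apply/cvgryPge => M; near=> x; rewrite /F -lerBlDr -ler_pdivrMl.
Unshelve. all: by end_near. Qed.

Lemma oneDsqr_le x : oneDsqr x <= (1 + `|x|) ^+ 2.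
Proof.
rewrite /oneDsqr -(@real_normK _ x) ?num_real //.
by have := normr_ge0 x; rewrite !expr2; nra.
Qed.

Lemma oneDsqr_affine a b : a != 0 ->
  exists2 A, 0 <= A & forall x, (oneDsqr (a * x + b))^-1 <= A * (oneDsqr x)^-1.
Proof.
move=> a0; have [A A0 hA] := affine_weight b a0.
exists (2 * A ^+ 2); first by rewrite mulr_ge0 ?sqr_ge0.
move=> x; rewrite ler_pdivlMr ?(lt_le_trans _ (oneDsqr_ge1 x)) //.
rewrite ler_pdivrMl ?(lt_le_trans _ (oneDsqr_ge1 _)) //.
have e : (1 + `|a * x + b|) ^+ 2 <= 2 * oneDsqr (a * x + b).
  rewrite /oneDsqr -(@real_normK _ (a * x + b)) ?num_real //.
  by have := sqr_ge0 (1 - `|a * x + b|); rewrite !expr2; nra.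
apply: le_trans (oneDsqr_le x) _.
apply: (@le_trans _ _ ((A * (1 + `|a * x + b|)) ^+ 2)).
  by rewrite lerXn2r ?nnegrE ?addr_ge0 ?mulr_ge0 ?addr_ge0.
by rewrite exprMn; have := sqr_ge0 A; nra.
Qed.

Lemma dominated_affine f a b : a != 0 -> dominated f ->
  dominated (fun x => f (a * x + b)).
Proof.
move=> a0 df; split.
  move=> x; apply: continuous_comp; last exact: df.1.
  by move: x; apply: rder_continuous => x; exact: rder_derivable (rder_affine x a b).
have [C C0 fC] := dominated_ge0 df; have [A A0 hA] := oneDsqr_affine b a0.
exists (C * A) => x; apply: le_trans (fC _) _.
by rewrite -mulrA ler_wpM2l.
Qed.

Lemma fineZ a (z : \bar R) : 0 < a -> fine (a%:E * z)%E = a * fine z.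
Proof.
move=> a0; case: z => [r| |] //=.
  by rewrite gt0_muley ?lte_fin //= mulr0.
by rewrite gt0_muleNy ?lte_fin //= mulr0.
Qed.

(** Substitution is available for nonnegative functions. Both [f + C / (1 + x^2)] and
    [C / (1 + x^2)] are nonnegative, and their difference is [f]. *)
Lemma integral_affine f a b : 0 < a -> dominated f ->
  \int[mu]_x f x = a * \int[mu]_x f (a * x + b).
Proof.
move=> a0 df; have a0' := lt0r_neq0 a0.
have [C C0 fC] := dominated_ge0 df.
pose g x := f x + C * (oneDsqr x)^-1; pose h x : R := C * (oneDsqr x)^-1.
have dh : dominated h.
  split; last by exists C => x; rewrite ger0_norm // mulr_ge0 ?oneDsqrV_ge0.
  by move=> x; apply: cvgMr; exact: continuous_oneDsqrV.
have cg : continuous g by move=> x; apply: cvgD; [exact: df.1|exact: dh.1].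
have g0 x : 0 <= g x by have := fC x; rewrite ler_norml /g => /andP[]; lra.
have h0 x : 0 <= h x by rewrite mulr_ge0 ?oneDsqrV_ge0.
have rf := dominated_rint df; have rh := dominated_rint dh.
have rf' := dominated_rint (dominated_affine b a0' df).
have rh' := dominated_rint (dominated_affine b a0' dh).
have E (u : R -> R) : continuous u -> (forall x, 0 <= u x) ->
    \int[mu]_x u x = a * \int[mu]_x u (a * x + b).
  by move=> cu u0; rewrite /Rintegral (integral_affine_ge0 b a0 cu u0) fineZ.
have e1 := E g cg g0; have e2 := E h dh.1 h0.
have : \int[mu]_x g x = \int[mu]_x f x + \int[mu]_x h x by exact: RintegralD.
have : \int[mu]_x g (a * x + b) = \int[mu]_x f (a * x + b) + \int[mu]_x h (a * x + b).
  exact: RintegralD.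
by rewrite e1 e2 => ->; rewrite mulrDr => /addIr.
Qed.

End RealIntegral.

Section ComplexIntegral.
Context {R : realType}.
Implicit Types (f g F : R -> R[i]) (x a b : R).
Notation mu := (@lebesgue_measure R).

Definition ccont f :=
  continuous (fun x => complex.Re (f x)) /\ continuous (fun x => complex.Im (f x)).

Definition cdominated f :=
  ccont f /\ exists C, forall x, normc (f x) <= C * (oneDsqr x)^-1.

Lemma cder_ccont f f' : (forall x, cder f x (f' x)) -> ccont f.
Proof.
by move=> df; split; apply: rder_continuous => x; have [a b] := df x;
  exact: rder_derivable.
Qed.

Lemma ccontM f g : ccont f -> ccont g -> ccont (fun x => f x * g x).
Proof.
move=> [fr fi] [gr gi]; split.
  rewrite (_ : (fun x => _) = fun x => complex.Re (f x) * complex.Re (g x) -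
     complex.Im (f x) * complex.Im (g x)); last first.
    by apply/funext => x; case: (f x) (g x) => ? ? [? ?].
  by move=> x; apply: cvgB; apply: cvgM; [exact: fr|exact: gr|exact: fi|exact: gi].
rewrite (_ : (fun x => _) = fun x => complex.Re (f x) * complex.Im (g x) +
   complex.Im (f x) * complex.Re (g x)); last first.
  by apply/funext => x; case: (f x) (g x) => ? ? [? ?].
by move=> x; apply: cvgD; apply: cvgM; [exact: fr|exact: gi|exact: fi|exact: gr].
Qed.

Lemma ccontD f g : ccont f -> ccont g -> ccont (fun x => f x + g x).
Proof.
move=> [fr fi] [gr gi]; split.
  rewrite (_ : (fun x => _) = fun x => complex.Re (f x) + complex.Re (g x)); last first.
    by apply/funext => x; case: (f x) (g x) => ? ? [? ?].
  by move=> x; apply: cvgD; [exact: fr|exact: gr].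
rewrite (_ : (fun x => _) = fun x => complex.Im (f x) + complex.Im (g x)); last first.
  by apply/funext => x; case: (f x) (g x) => ? ? [? ?].
by move=> x; apply: cvgD; [exact: fi|exact: gi].
Qed.

Lemma ccont_cst (c : R[i]) : ccont (fun=> c).
Proof. by split => x; exact: cvg_cst. Qed.

Lemma ccont_expi a b : ccont (fun x => expi (a * x + b)).
Proof.
apply: (@cder_ccont _ (fun x => expi (a * x + b) * (0 +i* a * 1 + 0))) => x.
by apply: (eq_cder (cder_mod a b (cder_cst 1 x))) => // y; rewrite mulr1.
Qed.

Lemma cdominated_Re f : cdominated f -> dominated (fun x => complex.Re (f x)).
Proof.
move=> [[cf _] [C fC]]; split=> //; exists C => x.
exact: le_trans (Re_le_normc _) (fC x).
Qed.

Lemma cdominated_Im f : cdominated f -> dominated (fun x => complex.Im (f x)).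
Proof.
move=> [[_ cf] [C fC]]; split=> //; exists C => x.
exact: le_trans (Im_le_normc _) (fC x).
Qed.

Lemma cdominated_cintegrable f : cdominated f -> cintegrable f.
Proof.
by move=> df; split; apply: dominated_rint; [exact: cdominated_Re|exact: cdominated_Im].
Qed.

Lemma ccont_cmeasurable f : ccont f -> cmeasurable f.
Proof. by move=> [? ?]; split; exact: continuous_mu. Qed.

Lemma measurable_normc f : cmeasurable f -> measurable_fun setT (fun x => normc (f x)).
Proof.
move=> [fr fi].
have -> : (fun x => normc (f x)) =
  (fun x => Num.sqrt (complex.Re (f x) ^+ 2 + complex.Im (f x) ^+ 2)).
  by apply/funext => x; case: (f x).
apply: (measurableT_comp (continuous_mu (@sqrt_continuous R))).
by apply: measurable_funD; exact: measurable_funX.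
Qed.

Lemma cdominatedM f g B : ccont g -> (forall x, normc (g x) <= B) ->
  cdominated f -> cdominated (fun x => g x * f x).
Proof.
move=> cg gB [cf [C fC]]; split; first exact: ccontM.
exists (B * C) => x; rewrite normcM -mulrA.
by apply: ler_pM; rewrite ?normc_ge0.
Qed.

Lemma cdominatedD f g : cdominated f -> cdominated g -> cdominated (fun x => f x + g x).
Proof.
move=> [cf [C fC]] [cg [D gD]]; split; first exact: ccontD.
exists (C + D) => x; apply: le_trans (normcD_le _ _) _.
by rewrite mulrDl lerD.
Qed.

Lemma cdominatedZ (c : R[i]) f : cdominated f -> cdominated (fun x => c * f x).
Proof. by apply: (@cdominatedM _ _ (normc c)) => //; exact: ccont_cst. Qed.

Lemma cdominated_expi a b f : cdominated f ->
  cdominated (fun x => expi (a * x + b) * f x).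
Proof.
by apply: (@cdominatedM _ _ 1) => [|x]; [exact: ccont_expi|rewrite normc_expi].
Qed.

Lemma weight2_oneDsqr x (c M : R) : (1 + `|x|) ^+ 2 * c <= M -> 0 <= c ->
  c <= M * (oneDsqr x)^-1.
Proof.
move=> cM c0; rewrite ler_pdivlMr ?(lt_le_trans _ (oneDsqr_ge1 x)) //.
by apply: le_trans cM; rewrite mulrC ler_wpM2r // oneDsqr_le.
Qed.

Lemma schwartz_cdominated f : is_schwartz f -> cdominated f.
Proof.
move=> sf; split; first exact: cder_ccont (is_schwartz_cder sf).
have [M _ fM] := is_schwartz_bound 2 sf; exists M => x.
exact: weight2_oneDsqr (fM x) (normc_ge0 _).
Qed.

Lemma cintegral_lin (c : R[i]) f g : cintegrable f -> cintegrable g ->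
  cintegral (fun x => c * f x + g x) = c * cintegral f + cintegral g.
Proof.
case: c => a b [fr fi] [gr gi]; rewrite /cintegral.
have -> : \int[mu]_x complex.Re ((a +i* b) * f x + g x) =
  a * (\int[mu]_x complex.Re (f x)) - b * (\int[mu]_x complex.Im (f x)) + \int[mu]_x complex.Re (g x).
  rewrite -!RintegralZl // -RintegralB //; [|exact: rintZ|exact: rintZ].
  rewrite -RintegralD //; last exact: rintB (rintZ _ _) (rintZ _ _).
  by apply: eq_Rintegral => x _; case: (f x) (g x) => ? ? [? ?].
have -> : \int[mu]_x complex.Im ((a +i* b) * f x + g x) =
  a * (\int[mu]_x complex.Im (f x)) + b * (\int[mu]_x complex.Re (f x)) + \int[mu]_x complex.Im (g x).
  rewrite -!RintegralZl // -RintegralD //; [|exact: rintZ|exact: rintZ].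
  rewrite -RintegralD //; last exact: rintD (rintZ _ _) (rintZ _ _).
  by apply: eq_Rintegral => x _; case: (f x) (g x) => ? ? [? ?].
by [].
Qed.

Lemma cintegral0 : cintegral (fun _ : R => 0 : R[i]) = 0.
Proof. by rewrite /cintegral /= !Rintegral_cst // !mul0r. Qed.

Lemma cintegralZ (c : R[i]) f : cintegrable f ->
  cintegral (fun x => c * f x) = c * cintegral f.
Proof.
move=> cf; rewrite -[RHS]addr0 -cintegral0 -cintegral_lin //.
  by congr cintegral; apply/funext => x; rewrite addr0.
by split; exact: integrable0.
Qed.

(** The factor 2 comes from estimating real and imaginary parts separately. It is harmless because
    all later bounds are up to constants. *)
Lemma normc_cintegral f (g : R -> R) : cintegrable f ->
  (forall x, normc (f x) <= g x) -> rint g -> normc (cintegral f) <= 2 * \int[mu]_x g x.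
Proof.
move=> [fr fi] fg rg; apply: le_trans (normc_le_ReIm _) _.
have H (h : R -> R) : rint h -> (forall x, `|h x| <= g x) -> `|\int[mu]_x h x| <= \int[mu]_x g x.
  move=> rh hg; apply: le_trans (le_normr_Rintegral _ rh) _ => //.
  by apply: le_Rintegral => //; exact: integrable_norm.
rewrite mulrDl mul1r; apply: lerD; apply: H => // x; apply: le_trans (fg x).
  exact: Re_le_normc.
exact: Im_le_normc.
Qed.

Lemma cintegral_derive f F : cdominated f -> cdominated F ->
  (forall x, cder F x (f x)) -> cintegral f = 0.
Proof.
move=> df dF FD; rewrite /cintegral.
have -> : \int[mu]_x complex.Re (f x) = 0.
  by apply: integral_derive_dominated (cdominated_Re df) (cdominated_Re dF) _ => x; have [] := FD x.
have -> : \int[mu]_x complex.Im (f x) = 0.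
  by apply: integral_derive_dominated (cdominated_Im df) (cdominated_Im dF) _ => x; have [] := FD x.
by [].
Qed.

Lemma cintegral_affine f a b : 0 < a -> cdominated f ->
  cintegral f = a%:C * cintegral (fun x => f (a * x + b)).
Proof.
move=> a0 df; rewrite /cintegral (integral_affine b a0 (cdominated_Re df)).
rewrite (integral_affine b a0 (cdominated_Im df)).
by apply/eqP; rewrite eq_complex /=; apply/andP; split; apply/eqP; ring.
Qed.

Lemma cdominated_affine f a b : a != 0 -> cdominated f ->
  cdominated (fun x => f (a * x + b)).
Proof.
move=> a0 df; split; first by split; [exact: (dominated_affine b a0 (cdominated_Re df)).1|
  exact: (dominated_affine b a0 (cdominated_Im df)).1].
have [_ [C fC]] := df; have [A A0 hA] := oneDsqr_affine b a0.
exists (C * A) => x; apply: le_trans (fC _) _.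
have C0 : 0 <= C.
  have := fC 0; rewrite /oneDsqr expr0n /= addr0 invr1 mulr1.
  exact: le_trans (normc_ge0 _).
by rewrite -mulrA ler_wpM2l.
Qed.

Lemma lipschitz_cos x y : `|cos x - cos y| <= `|x - y| :> R.
Proof.
wlog xy : x y / y <= x.
  by move=> H; have [/H//|/ltW/H] := leP y x; rewrite distrC (distrC y).
have [c _ ->] := @MVT_segment R cos (fun x => - sin x) _ _ xy
  (fun z _ => is_derive_cos z) (continuous_subspaceT (@continuous_cos R)).
by rewrite normrM normrN ler_piMl // sin_max.
Qed.

Lemma lipschitz_sin x y : `|sin x - sin y| <= `|x - y| :> R.
Proof.
wlog xy : x y / y <= x.
  by move=> H; have [/H//|/ltW/H] := leP y x; rewrite distrC (distrC y).
have [c _ ->] := @MVT_segment R sin cos _ _ xy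
  (fun z _ => is_derive_sin z) (continuous_subspaceT (@continuous_sin R)).
by rewrite normrM ler_piMl // cos_max.
Qed.

Lemma lipschitz_expi x y : normc (expi x - expi y) <= 2 * `|x - y| :> R.
Proof.
apply: le_trans (normc_le_ReIm _) _.
rewrite mulrDl mul1r; apply: lerD; [exact: lipschitz_cos|exact: lipschitz_sin].
Qed.

End ComplexIntegral.

(** * The Fourier transform *)

Section Fourier.
Context {R : realType}.
Implicit Types (f g : R -> R[i]) (x xi a b : R).
Notation mu := (@lebesgue_measure R).

Definition fourier_cst : R := (Num.sqrt (2 * pi))^-1.

Lemma fourier_cst_gt0 : 0 < fourier_cst.
Proof. by rewrite invr_gt0 sqrtr_gt0 mulr_gt0 ?pi_gt0. Qed.

Lemma fourier_kernel f xi :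
  (fun x => expi (- (x * xi)) * f x) = (fun x => expi ((- xi) * x + 0) * f x).
Proof. by apply/funext => x; rewrite addr0 mulNr (mulrC xi). Qed.

Lemma cdominated_fourier f xi : cdominated f ->
  cdominated (fun x => expi (- (x * xi)) * f x).
Proof. by move=> df; rewrite fourier_kernel; exact: cdominated_expi. Qed.

Lemma fourier_lin (c : R[i]) f g xi : cdominated f -> cdominated g ->
  fourier (fun x => c * f x + g x) xi = c * fourier f xi + fourier g xi.
Proof.
move=> df dg; rewrite /fourier mulrCA -mulrDr -cintegral_lin.
- congr (_ * cintegral _); apply/funext => x; ring.
- exact/cdominated_cintegrable/cdominated_fourier.
- exact/cdominated_cintegrable/cdominated_fourier.
Qed.

Lemma fourier_le f (g : R -> R) xi : cdominated f ->
  (forall x, normc (f x) <= g x) -> rint g ->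
  normc (fourier f xi) <= fourier_cst * (2 * \int[mu]_x g x).
Proof.
move=> df fg rg; rewrite /fourier -/fourier_cst normcM normc_real (gtr0_norm fourier_cst_gt0).
rewrite ler_pM2l ?fourier_cst_gt0 //; apply: normc_cintegral => //.
- exact/cdominated_cintegrable/cdominated_fourier.
- by move=> x; rewrite normcM normc_expi mul1r.
Qed.

Lemma fourier_bounded f : cdominated f ->
  exists C, forall xi, normc (fourier f xi) <= C.
Proof.
move=> df; have [_ [C fC]] := df; eexists => xi.
by apply: fourier_le fC _ => //; exact/rintZ/(rint_oneDsqr.1).
Qed.

Lemma fourier_cderive f xi : is_schwartz f ->
  fourier (cderive f) xi = 'i * xi%:C * fourier f xi.
Proof.
move=> sf; have sf' := is_schwartz_derive sf.
have df := schwartz_cdominated sf; have df' := schwartz_cdominated sf'.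
have d1 : cdominated (fun x => 0 +i* (- xi) * f x + cderive f x).
  exact: cdominatedD (cdominatedZ _ _) _.
have := cintegral_derive (cdominated_expi (- xi) 0 d1) (cdominated_expi (- xi) 0 df)
  (fun x => cder_mod (- xi) 0 (is_schwartz_cder sf x)).
have -> : (fun x => expi ((- xi) * x + 0) * (0 +i* (- xi) * f x + cderive f x)) =
  (fun x => 0 +i* (- xi) * (expi (- (x * xi)) * f x) + expi (- (x * xi)) * cderive f x).
  by apply/funext => x; rewrite addr0 mulNr (mulrC xi); ring.
rewrite cintegral_lin; last 2 first.
- exact/cdominated_cintegrable/cdominated_fourier.
- exact/cdominated_cintegrable/cdominated_fourier.
have -> : 0 +i* (- xi) = - ('i * xi%:C).
  by apply/eqP; rewrite eq_complex /=; apply/andP; split; apply/eqP; ring.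
move=> /eqP; rewrite mulNr addrC subr_eq0 => /eqP e.
by rewrite /fourier e; ring.
Qed.

(** Every derivative of [f] gains one factor [xi], and the transforms of all derivatives are
    bounded. *)
Lemma fourier_decay f n : is_schwartz f ->
  exists2 C, 0 <= C & forall xi, (1 + `|xi|) ^+ n * normc (fourier f xi) <= C.
Proof.
move=> sf.
have H m : exists C, forall xi, `|xi| ^+ m * normc (fourier f xi) <= C.
  elim: m f sf => [|m IH] f sf.
    have [C fC] := fourier_bounded (schwartz_cdominated sf).
    by exists C => xi; rewrite expr0 mul1r.
  have [C fC] := IH _ (is_schwartz_derive sf); exists C => xi.
  have := fC xi; rewrite fourier_cderive // (normcM _ (fourier f xi)) (normcM 'i) normc_real.
  have -> : normc ('i : R[i]) = 1 by rewrite /normc /= expr0n expr1n /= add0r sqrtr1.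
  by rewrite mul1r mulrA -exprSr.
have [C0 h0] := H 0%N; have [Cn hn] := H n.
have h xi : (1 + `|xi|) ^+ n * normc (fourier f xi) <= 2 ^+ n * (C0 + Cn).
  apply: le_trans (ler_wpM2r (normc_ge0 _) (expr1D_le xi n)) _.
  rewrite -mulrA ler_wpM2l ?exprn_ge0 // mulrDl mul1r lerD //.
  by have := h0 xi; rewrite expr0 mul1r.
exists (2 ^+ n * (C0 + Cn)) => //; apply: le_trans (h 0).
by rewrite mulr_ge0 ?normc_ge0 // exprn_ge0 // addr_ge0.
Qed.

Lemma fourier_lipschitz f : is_schwartz f ->
  exists2 C, 0 <= C & forall xi eta, normc (fourier f xi - fourier f eta) <= C * `|xi - eta|.
Proof.
move=> sf; have df := schwartz_cdominated sf.
(* One power absorbs the factor [x] from the Lipschitz bound of the kernel; the other two give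
   integrability. *)
have [M M0 fM] := is_schwartz_bound 3 sf.
have M' x : 2 * `|x| * normc (f x) <= 2 * M * (oneDsqr x)^-1.
  rewrite -!mulrA ler_pM2l //; apply: weight2_oneDsqr; last first.
    by rewrite mulr_ge0 ?normc_ge0.
  apply: le_trans (fM x); rewrite mulrA ler_wpM2r ?normc_ge0 // (exprSr _ 2).
  by rewrite ler_wpM2l ?exprn_ge0 ?addr_ge0 // lerDr.
exists (fourier_cst * (2 * (2 * M * pi))).
  by rewrite !mulr_ge0 ?(ltW fourier_cst_gt0) ?pi_ge0.
move=> xi eta; rewrite /fourier -/fourier_cst -mulrBr normcM normc_real (gtr0_norm fourier_cst_gt0).
rewrite -!mulrA ler_pM2l ?fourier_cst_gt0 //.
have -> : cintegral (fun x => expi (- (x * xi)) * f x) -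
          cintegral (fun x => expi (- (x * eta)) * f x) =
   cintegral (fun x => (-1) * (expi (- (x * eta)) * f x) + expi (- (x * xi)) * f x).
  rewrite cintegral_lin; first by rewrite mulN1r addrC.
    exact/cdominated_cintegrable/cdominated_fourier.
  exact/cdominated_cintegrable/cdominated_fourier.
have [r e] := @rint_oneDsqr R.
have -> : 2 * (2 * (M * (pi * `|xi - eta|))) =
    2 * \int[mu]_x (2 * M * `|xi - eta| * (oneDsqr x)^-1).
  by rewrite RintegralZl // e; ring.
apply: normc_cintegral; last exact: rintZ.
  apply: cdominated_cintegrable; apply: cdominatedD; first apply: cdominatedZ.
    exact: cdominated_fourier.
  exact: cdominated_fourier.
move=> x.
have -> : -1 * (expi (- (x * eta)) * f x) + expi (- (x * xi)) * f x =
   (expi (- (x * xi)) - expi (- (x * eta))) * f x by ring.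
rewrite normcM; apply: le_trans (ler_wpM2r (normc_ge0 _) (lipschitz_expi _ _)) _.
have -> : `|- (x * xi) - - (x * eta)| = `|x| * `|xi - eta|.
  by rewrite -normrM -normrN; congr (`|_|); ring.
have -> : 2 * (`|x| * `|xi - eta|) * normc (f x) = `|xi - eta| * (2 * `|x| * normc (f x)) by ring.
have -> : 2 * M * `|xi - eta| / oneDsqr x = `|xi - eta| * (2 * M / oneDsqr x) by ring.
by rewrite ler_wpM2l.
Qed.

Lemma fourier_ccont f : is_schwartz f -> ccont (fourier f).
Proof.
move=> /fourier_lipschitz[C C0 fC].
have H (h : R -> R) : (forall x y, `|h x - h y| <= C * `|x - y|) -> continuous h.
  move=> hC x; apply/cvgrPdist_le => e e0; near=> y.
  apply: le_trans (hC x y) _.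
  apply: (@le_trans _ _ ((C + 1) * `|x - y|)); first by rewrite ler_wpM2r // lerDl.
  rewrite -ler_pdivlMl ?ltr_wpDl //.
  near: y; apply/nbhs_ballP; exists ((C + 1)^-1 * e) => /=.
    by rewrite mulr_gt0 // invr_gt0 ltr_wpDl.
  by move=> y /ltW.
split; apply: H => x y; apply: le_trans (fC x y).
  by have := Re_le_normc (fourier f x - fourier f y); case: (fourier f x) (fourier f y) => ? ? [].
by have := Im_le_normc (fourier f x - fourier f y); case: (fourier f x) (fourier f y) => ? ? [].
Unshelve. all: by end_near. Qed.

Lemma fourier_cdominated f : is_schwartz f -> cdominated (fourier f).
Proof.
move=> sf; split; first exact: fourier_ccont.
have [C _ fC] := fourier_decay 2 sf; exists C => xi.
exact: weight2_oneDsqr (fC xi) (normc_ge0 _).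
Qed.

Lemma fourier_wave f k c w a xi : 0 < w -> cdominated f ->
  fourier (fun x => expi (k * x + c) * (w%:C * f (w * x - w * a))) xi =
  expi (a * (k - xi) + c) * fourier f ((xi - k) / w).
Proof.
move=> w0 df; have w0' := lt0r_neq0 w0.
have d1 := cdominated_affine (- (w * a)) w0' df.
rewrite /fourier mulrCA; congr (_ * _).
rewrite (cintegral_affine (- (w * a)) w0 (cdominated_fourier ((xi - k) / w) df)).
rewrite mulrA -cintegralZ.
  congr cintegral; apply/funext => x.
  have e : expi (- (x * xi)) * expi (k * x + c) =
      expi (a * (k - xi) + c) * expi (- ((w * x - w * a) * ((xi - k) / w))) :> R[i].
    by rewrite -!expiD; congr expi; field.
  by rewrite mulrA e; ring.
apply: cdominated_cintegrable.
have -> : (fun x => expi (- ((w * x - w * a) * ((xi - k) / w))) * f (w * x - w * a)) =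
  (fun x => expi ((k - xi) * x + a * (xi - k)) * f (w * x - w * a)).
  by apply/funext => x; congr (expi _ * _); field.
exact: cdominated_expi.
Qed.

End Fourier.

(** * Duality of the Fourier transform and the distributions of Schwartz functions *)

Section MultiplicationFormula.
Context {R : realType}.
Notation mu := (@lebesgue_measure R).

Implicit Types (f g : R -> R[i]).

Lemma Fubini_dominated (F : R -> R -> R) (C : R) :
  measurable_fun [set: R * R] (fun z => F z.1 z.2) ->
  (forall x y, `|F x y| <= C * ((oneDsqr x)^-1 * (oneDsqr y)^-1)) ->
  \int[mu]_x (\int[mu]_y F x y) = \int[mu]_y (\int[mu]_x F x y).
Proof.
move=> mF FC.
have mF' : measurable_fun [set: R * R] (fun z => (F z.1 z.2)%:E) by apply/measurable_EFinP.
have mx x : measurable_fun setT (F x) by exact: (measurable_fun_pair2 x mF).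
have my y : measurable_fun setT (F ^~ y) by exact: (measurable_fun_pair1 y mF).
have [r e] := @rint_oneDsqr R.
have iF : (mu \x mu)%E.-integrable setT (fun z : R * R => (F z.1 z.2)%:E).
  apply/integrable12ltyP => //=.
  apply: (@le_lt_trans _ _ (\int[mu]_x (C * pi * (oneDsqr x)^-1)%:E)%E).
    apply: ge0_le_integral => //=.
    - by move=> x _; exact: integral_ge0.
    - apply: (@measurable_fun_fubini_tonelli_F _ _ _ _ _ mu
        (fun z : R * R => `|(F z.1 z.2)%:E|)%E) => //=.
      by apply/measurable_EFinP; apply: measurableT_comp.
    - apply/measurable_EFinP; apply: continuous_mu => x.
      by apply: cvgMr; exact: continuous_oneDsqrV.
    move=> x _.
    apply: (@le_trans _ _ (\int[mu]_y (C * (oneDsqr x)^-1 * (oneDsqr y)^-1)%:E)%E).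
      apply: ge0_le_integral => //=.
      + apply/measurable_EFinP.
        exact: (measurableT_comp (@normr_measurable R setT) (mx x)).
      + apply/measurable_EFinP; apply: continuous_mu => y.
        by apply: cvgMr; exact: continuous_oneDsqrV.
      + by move=> y _; rewrite lee_fin -mulrA.
    have rr : rint (fun y => C * (oneDsqr x)^-1 * (oneDsqr y)^-1) by exact: rintZ.
    rewrite -[leLHS]fineK ?(integrable_fin_num _ rr) // lee_fin.
    by rewrite -/(Rintegral _ _ _) RintegralZl // e; lra.
  have rr : rint (fun x => C * pi * (oneDsqr x)^-1) by exact: rintZ.
  by rewrite -[ltLHS]fineK ?(integrable_fin_num _ rr) // ltry.
have sx x : (\int[mu]_y (F x y)%:E = (\int[mu]_y F x y)%:E)%E.
  rewrite -[LHS]fineK //; apply: integrable_fin_num => //.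
  apply: (@le_rint _ (F x) (fun y => (C * (oneDsqr x)^-1) * (oneDsqr y)^-1)).
  - exact: mx.
  - by move=> y; rewrite -mulrA.
  - exact: rintZ.
have sy y : (\int[mu]_x (F x y)%:E = (\int[mu]_x F x y)%:E)%E.
  rewrite -[LHS]fineK //; apply: integrable_fin_num => //.
  apply: (@le_rint _ (F^~ y) (fun x => (C * (oneDsqr y)^-1) * (oneDsqr x)^-1)).
  - exact: my.
  - by move=> x; rewrite -mulrA [X in _ * X]mulrC.
  - exact: rintZ.
rewrite {1 3}/Rintegral; congr fine.
under eq_integral do rewrite -sx.
under [RHS]eq_integral do rewrite -sy.
exact: (Fubini iF).
Qed.

Lemma cFubini_dominated (F : R -> R -> R[i]) (C : R) :
  measurable_fun [set: R * R] (fun z => complex.Re (F z.1 z.2)) ->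
  measurable_fun [set: R * R] (fun z => complex.Im (F z.1 z.2)) ->
  (forall x y, normc (F x y) <= C * ((oneDsqr x)^-1 * (oneDsqr y)^-1)) ->
  cintegral (fun x => cintegral (F x)) = cintegral (fun y => cintegral (F ^~ y)).
Proof.
move=> mr mi FC; rewrite /cintegral /=; congr (_ +i* _).
  by apply: Fubini_dominated mr _ => x y; apply: le_trans (Re_le_normc _) (FC x y).
by apply: Fubini_dominated mi _ => x y; apply: le_trans (Im_le_normc _) (FC x y).
Qed.

Definition cmeasurable2 (F : R * R -> R[i]) :=
  measurable_fun setT (fun z => complex.Re (F z)) /\
  measurable_fun setT (fun z => complex.Im (F z)).

Lemma cmeasurable2M F G : cmeasurable2 F -> cmeasurable2 G ->
  cmeasurable2 (fun z => F z * G z).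
Proof.
move=> [fr fi] [gr gi]; split.
  rewrite (_ : (fun z => _) = fun z => complex.Re (F z) * complex.Re (G z) -
     complex.Im (F z) * complex.Im (G z)); last first.
    by apply/funext => z; case: (F z) (G z) => ? ? [? ?].
  by apply: measurable_funB; exact: measurable_funM.
rewrite (_ : (fun z => _) = fun z => complex.Re (F z) * complex.Im (G z) +
   complex.Im (F z) * complex.Re (G z)); last first.
  by apply/funext => z; case: (F z) (G z) => ? ? [? ?].
by apply: measurable_funD; exact: measurable_funM.
Qed.

Lemma cmeasurable2_fst f : cmeasurable f -> cmeasurable2 (fun z => f z.1).
Proof.
move=> [fr fi]; split; first exact: (measurableT_comp fr measurable_fst).
exact: (measurableT_comp fi measurable_fst).
Qed.

Lemma cmeasurable2_snd f : cmeasurable f -> cmeasurable2 (fun z => f z.2).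
Proof.
move=> [fr fi]; split; first exact: (measurableT_comp fr measurable_snd).
exact: (measurableT_comp fi measurable_snd).
Qed.

Lemma cmeasurable2_kernel : cmeasurable2 (fun z => expi (- (z.1 * z.2))).
Proof.
have H : measurable_fun [set: R * R] (fun z : R * R => - (z.1 * z.2)).
  by apply: measurableT_comp => //; apply: measurable_funM.
split; apply: measurableT_comp H; apply: continuous_mu.
  exact: continuous_cos.
exact: continuous_sin.
Qed.

Lemma fourier_multiplication (f phi : R -> R[i]) : cdominated f -> cdominated phi ->
  cintegral (fun xi => fourier f xi * phi xi) =
  cintegral (fun x => f x * fourier phi x).
Proof.
move=> df dphi; pose c : R[i] := (fourier_cst)%:C.
have [_ [C fC]] := df; have [_ [D phiD]] := dphi.
transitivity (cintegral (fun xi => cintegral (fun x =>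
   (c * phi xi) * (expi (- (x * xi)) * f x)))).
  congr cintegral; apply/funext => xi.
  rewrite cintegralZ; last exact/cdominated_cintegrable/cdominated_fourier.
  by rewrite /fourier -/fourier_cst -/c mulrAC.
rewrite -(@cFubini_dominated (fun x xi => (c * phi xi) * (expi (- (x * xi)) * f x))
  (`|fourier_cst| * D * C)); last 3 first.
- apply: (proj1 (_ : cmeasurable2 (fun z => (c * phi z.2) * (expi (- (z.1 * z.2)) * f z.1)))).
  apply: cmeasurable2M.
    apply: (@cmeasurable2_snd (fun y => c * phi y)); apply: ccont_cmeasurable.
    by apply: ccontM; [exact: ccont_cst|exact: dphi.1].
  apply: cmeasurable2M; first exact: cmeasurable2_kernel.
  by apply: cmeasurable2_fst; exact: ccont_cmeasurable df.1.
- apply: (proj2 (_ : cmeasurable2 (fun z => (c * phi z.2) * (expi (- (z.1 * z.2)) * f z.1)))).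
  apply: cmeasurable2M.
    apply: (@cmeasurable2_snd (fun y => c * phi y)); apply: ccont_cmeasurable.
    by apply: ccontM; [exact: ccont_cst|exact: dphi.1].
  apply: cmeasurable2M; first exact: cmeasurable2_kernel.
  by apply: cmeasurable2_fst; exact: ccont_cmeasurable df.1.
- move=> x xi; rewrite !normcM normc_expi mul1r normc_real -/fourier_cst.
  have -> : `|fourier_cst| * D * C * ((oneDsqr x)^-1 * (oneDsqr xi)^-1) =
    `|fourier_cst| * (D * (oneDsqr xi)^-1) * (C * (oneDsqr x)^-1) :> R by ring.
  by apply: ler_pM; rewrite ?mulr_ge0 ?normc_ge0 // ler_wpM2l.
congr cintegral; apply/funext => x.
have -> : (fun xi => (c * phi xi) * (expi (- (x * xi)) * f x)) =
  (fun xi => (f x * c) * (expi (- (xi * x)) * phi xi)).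
  by apply/funext => xi; rewrite (mulrC xi); ring.
rewrite cintegralZ; last exact/cdominated_cintegrable/cdominated_fourier.
by rewrite /fourier -/fourier_cst -/c mulrA.
Qed.

Lemma schwartz_is_schwartz (phi : schwartz R) : is_schwartz phi.
Proof. by case: phi => f /= /asboolP. Qed.

Lemma is_schwartz_bounded f : is_schwartz f -> exists C : R, forall x, normc (f x) <= C.
Proof.
move=> sf; have [C _ fC] := is_schwartz_bound 0 sf; exists C => x.
by have := fC x; rewrite expr0 mul1r.
Qed.

Lemma fourier_function_dist_of f : is_schwartz f ->
  fourier_function (dist_of f) (fourier f).
Proof.
move=> sf; have df := fourier_cdominated sf; split.
- exact: ccont_cmeasurable df.1.
- move=> phi; have sphi := schwartz_is_schwartz phi.
  have [C phiC] := is_schwartz_bounded sphi.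
  have -> : (fun x => fourier f x * phi x) = (fun x => phi x * fourier f x).
    by apply/funext => x; rewrite mulrC.
  apply/cdominated_cintegrable/(cdominatedM _ phiC df).
  exact: cder_ccont (is_schwartz_cder sphi).
- move=> phi psi psiE; rewrite /dist_of fourier_multiplication.
  + by rewrite psiE.
  + exact: schwartz_cdominated.
  + exact/schwartz_cdominated/schwartz_is_schwartz.
Qed.

Lemma tempered_dist_of f : is_schwartz f -> tempered (dist_of f).
Proof.
move=> sf; have df := schwartz_cdominated sf.
have dfM (phi : schwartz R) : cdominated (fun x => f x * phi x).
  have sphi := schwartz_is_schwartz phi.
  have [C phiC] := is_schwartz_bounded sphi.
  have -> : (fun x => f x * phi x) = (fun x => phi x * f x).
    by apply/funext => x; rewrite mulrC.
  apply: (cdominatedM _ phiC df); exact: cder_ccont (is_schwartz_cder sphi).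
split.
  move=> a phi psi; rewrite /dist_of -cintegral_lin; try exact: cdominated_cintegrable.
  by congr cintegral; apply/funext => x; rewrite mulrDr [X in X + _]mulrCA.
have [_ [C fC]] := df; have C0 : 0 <= C.
  have := fC 0; rewrite /oneDsqr expr0n /= addr0 invr1 mulr1.
  exact: le_trans (normc_ge0 _).
exists 1%N, (2 * (C * pi)) => phi.
rewrite !big_ord1 /dist_of.
have [r e] := @rint_oneDsqr R.
pose S := seminorm 0 0 phi.
have Sphi x : normc (phi x) <= S.
  have [M phiM] := is_schwartz_bounded (schwartz_is_schwartz phi).
  apply: ub_le_sup; last by exists x => //; rewrite expr0 mul1r.
  exists M => _ [y _ <-]. rewrite expr0 mul1r; exact: phiM.
rewrite -[seminorm _ _ phi]/S.
have -> : 2 * (C * pi) * S = 2 * \int[mu]_x (C * S * (oneDsqr x)^-1).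
  by rewrite RintegralZl // e; ring.
apply: normc_cintegral; [exact: cdominated_cintegrable| |exact: rintZ].
move=> x; rewrite normcM mulrAC.
by apply: ler_pM; rewrite ?normc_ge0.
Qed.

Lemma dist_ofB f g : is_schwartz f -> is_schwartz g ->
  (dist_of f - dist_of g)%R = dist_of (fun x => (-1) * g x + f x).
Proof.
move=> sf sg; apply/funext => phi.
have dM h : is_schwartz h -> cintegrable (fun x => h x * phi x).
  move=> sh; have sphi := schwartz_is_schwartz phi.
  have [C phiC] := is_schwartz_bounded sphi.
  have -> : (fun x => h x * phi x) = (fun x => phi x * h x).
    by apply/funext => x; rewrite mulrC.
  apply/cdominated_cintegrable/(cdominatedM _ phiC (schwartz_cdominated sh)).
  exact: cder_ccont (is_schwartz_cder sphi).
transitivity (-1 * dist_of g phi + dist_of f phi); first by rewrite mulN1r addrC.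
rewrite /dist_of -cintegral_lin; try exact: dM.
by congr cintegral; apply/funext => x; rewrite mulrDl mulrA.
Qed.

End MultiplicationFormula.

(** * The Gaussian is its own Fourier transform *)

Section GaussianFourier.
Context {R : realType}.
Notation mu := (@lebesgue_measure R).

Lemma continuous_gauss : continuous (@gauss R).
Proof. by apply: rder_continuous => x; exact: rder_derivable (is_derive_gauss x). Qed.

Lemma dominated_gauss : dominated (@gauss R).
Proof. exact: cdominated_Re (schwartz_cdominated is_schwartz_gauss). Qed.

Lemma integral_gauss : \int[mu]_x gauss x = Num.sqrt (2 * pi).
Proof.
have s2 : 0 < Num.sqrt 2 :> R by rewrite sqrtr_gt0.
rewrite (integral_affine 0 s2 dominated_gauss) sqrtrM //.
congr (_ * _).
have -> : (fun x : R => gauss (Num.sqrt 2 * x + 0)) = gauss_fun.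
  apply/funext => x; rewrite /gauss /gauss_fun addr0 exprMn sqr_sqrtr //.
  by congr expR; field.
by rewrite /Rintegral integralT_gauss.
Qed.

Lemma dominated_xgauss : dominated (fun x => x * gauss x : R).
Proof.
have [c [C hC]] : dominated (fun x => - x * gauss x : R).
  have := cdominated_Re (schwartz_cdominated (is_schwartz_derive (@is_schwartz_gauss R))).
  congr dominated; apply/funext => x.
  by rewrite (cder_cderive (cder_real (is_derive_gauss x))).
split; last by exists C => x; rewrite -normrN -mulNr.
have -> : (fun x : R => x * gauss x) = (fun x => - (- x * gauss x)).
  by apply/funext => x; rewrite mulNr opprK.
by move=> x; apply: cvgN; exact: c.
Qed.

Lemma continuous_kernel (k : R -> R) (xi : R) : continuous k ->
  continuous (fun x : R => k (- (x * xi))).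
Proof.
move=> ck x; apply: continuous_comp; last exact: ck.
by apply: cvgN; apply: cvgMl; exact: cvg_id.
Qed.

Lemma rint_kernel_xgauss (k : R -> R) (xi : R) : (forall x, `|k x| <= 1) ->
  continuous k -> rint (fun x : R => k (- (x * xi)) * (- x * gauss x)).
Proof.
move=> k1 ck.
have cx : continuous (fun x : R => - x * gauss x).
  have -> : (fun x : R => - x * gauss x) = (fun x => - (x * gauss x)).
    by apply/funext => z; rewrite mulNr.
  by move=> x; apply: cvgN; exact: dominated_xgauss.1.
apply: (@le_rint _ _ (fun x => `|x * gauss x|)).
- by apply: continuous_mu => x; apply: cvgM; [exact: continuous_kernel|exact: cx].
- by move=> x; rewrite normrM mulNr normrN ler_piMl.
- exact: integrable_norm (dominated_rint dominated_xgauss).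
Qed.

(** Differentiation under the integral sign, for the cosine and the sine at once; [|x gauss x|]
    dominates the derivative of the integrand for all [xi]. *)
Lemma integral_cos_sin_gauss (k : R -> R) (k' : R -> R) (xi : R) :
  (forall x, `|k x| <= 1) -> (forall x, `|k' x| <= 1) ->
  (forall x : R, is_derive x 1 k (k' x)) -> continuous k' ->
  is_derive xi 1 (fun xi => \int[mu]_x (k (- (x * xi)) * gauss x))
    (\int[mu]_x (k' (- (x * xi)) * (- x * gauss x))).
Proof.
move=> k1 k1' dk ck'.
have ck : continuous k by apply: rder_continuous => x; exact: rder_derivable (dk x).
pose f (xi x : R) : R := k (- (x * xi)) * gauss x.
have dlin (x y : R) : is_derive y 1 (fun z => - (x * z)) (- x).
  by apply: (is_deriveE (rder_affine y (- x) 0)) => // z; rewrite addr0 mulNr.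
have df (x y : R) : is_derive y 1 (f ^~ x) (k' (- (x * y)) * (- x * gauss x)).
  have dkx := @rder_comp _ k (fun z => - (x * z)) _ _ _ (dk (- (x * y))) (dlin x y).
  apply: (is_deriveE (rderM dkx (is_derive_cst (gauss x) y 1))) => //.
  by rewrite /cst mulr0 addr0 -mulrA.
have intf (y : R) : rint (f y).
  apply: (@le_rint _ _ gauss) (dominated_rint dominated_gauss).
    apply: continuous_mu => x; apply: cvgM; last exact: continuous_gauss.
    exact: continuous_kernel.
  by move=> x; rewrite normrM (ger0_norm (expR_ge0 _)) ler_piMl ?expR_ge0.
have dG := dominated_xgauss.
have H := @differentiation_under_integral R _ _ mu f setT measurableT xi (xi - 1) (xi + 1).
have H' := @derivable_under_integral R _ _ mu f setT measurableT xi (xi - 1) (xi + 1).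
have xiI : `]xi - 1, xi + 1[%classic xi by rewrite /= in_itv /=; lra.
have i1 : forall x, `]xi - 1, xi + 1[%classic x -> mu.-integrable setT (EFin \o f x).
  by move=> x _; exact: intf.
have i2 : forall x y, `]xi - 1, xi + 1[%classic x -> setT y -> derivable (f ^~ y) x 1.
  by move=> x y _ _; exact: rder_derivable (df y x).
have i3 : mu.-integrable setT (EFin \o (fun x => `|x * gauss x| : R)).
  exact: integrable_norm (dominated_rint dG).
have i4 : forall x y, `]xi - 1, xi + 1[%classic x -> setT y ->
    `|partial1of2 f x y| <= `|y * gauss y|.
  move=> x y _ _; rewrite /partial1of2 derive1E; have [_ ->] := df y x.
  by rewrite normrM mulNr normrN ler_piMl.
apply: DeriveDef; first exact: H' xiI i1 i2 _ (fun=> normr_ge0 _) i3 i4.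
rewrite -derive1E (H xiI i1 i2 _ (fun=> normr_ge0 _) i3 i4).
by apply: eq_Rintegral => x _; rewrite /partial1of2 derive1E; have [_ ->] := df x xi.
Qed.

(* The real and imaginary parts of the transform solve [h' = - xi h]. *)
Lemma fourier_gauss (xi : R) : fourier (fun x => (gauss x)%:C) xi = (gauss xi)%:C.
Proof.
have sg := @is_schwartz_gauss R.
pose C (xi : R) := \int[mu]_x (cos (- (x * xi)) * gauss x).
pose S (xi : R) := \int[mu]_x (sin (- (x * xi)) * gauss x).
have E y : fourier (fun x => (gauss x)%:C) y = fourier_cst%:C * (C y +i* S y).
  rewrite /fourier -/fourier_cst; congr (_ * _); rewrite /cintegral; congr (_ +i* _).
    by apply: eq_Rintegral => x _ /=; rewrite mulr0 subr0.
  by apply: eq_Rintegral => x _ /=; rewrite mulr0 add0r.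
pose C1 (xi : R) := \int[mu]_x (cos (- (x * xi)) * (- x * gauss x)).
pose S1 (xi : R) := \int[mu]_x (sin (- (x * xi)) * (- x * gauss x)).
have E1 y : fourier (cderive (fun x => (gauss x)%:C)) y = fourier_cst%:C * (C1 y +i* S1 y).
  have -> : cderive (fun x : R => (gauss x)%:C) = fun x => (- x * gauss x)%:C.
    by apply/funext => x; rewrite (cder_cderive (cder_real (is_derive_gauss x))).
  rewrite /fourier -/fourier_cst; congr (_ * _); rewrite /cintegral; congr (_ +i* _).
    by apply: eq_Rintegral => x _ /=; rewrite mulr0 subr0.
  by apply: eq_Rintegral => x _ /=; rewrite mulr0 add0r.
have c0 : fourier_cst%:C != 0 :> R[i].
  by rewrite eq_complex /= negb_and (gt_eqF fourier_cst_gt0).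
(* The transform of the derivative of the Gaussian is computed in two ways, which expresses [C1] and
   [S1] by [S] and [C] and closes the differential equations. *)
have CS y : C1 y = - (y * S y) /\ S1 y = y * C y.
  have := fourier_cderive y sg; rewrite E1 E mulrCA => /(mulfI c0) /eqP.
  rewrite eq_complex /= => /andP[/eqP -> /eqP ->]; split; ring.
have nsin1 (x : R) : `|- sin x| <= 1 by rewrite normrN sin_max.
have cnsin : continuous (fun x : R => - sin x).
  by move=> x; apply: cvgN; exact: continuous_sin.
have dC (y : R) : is_derive y 1 C (- (y * C y)).
  have H := integral_cos_sin_gauss y (@cos_max R) nsin1 (@is_derive_cos R) cnsin.
  apply: (is_deriveE H) => //; rewrite -(CS y).2 /S1 -mulN1r -RintegralZl //; last first.
    exact: rint_kernel_xgauss (@sin_max R) (@continuous_sin R).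
  by apply: eq_Rintegral => x _; ring.
have dS (y : R) : is_derive y 1 S (- (y * S y)).
  have H := integral_cos_sin_gauss y (@sin_max R) (@cos_max R) (@is_derive_sin R)
    (@continuous_cos R).
  by apply: (is_deriveE H) => //; rewrite -(CS y).1.
have key (h : R -> R) : (forall y : R, is_derive y 1 h (- (y * h y))) ->
    forall y, h y = h 0 * gauss y.
  move=> dh y.
  have dg (z : R) : is_derive z 1 (fun z => expR (z ^+ 2 / 2)) (z * expR (z ^+ 2 / 2)).
    have h2 : is_derive z 1 (fun y : R => y ^+ 2 / 2) z.
      apply: (is_deriveE (rderZ (2^-1) (rderM (is_derive_id z 1) (is_derive_id z 1)))).
        by move=> w; rewrite expr2; field.
      by field.
    by apply: (is_deriveE (rder_comp (is_derive_expR _) h2)) => //; rewrite mulrC.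
  have d0 (z : R) : is_derive z (1 : R) (fun z => h z * expR (z ^+ 2 / 2)) 0.
    by apply: (is_deriveE (rderM (dh z) (dg z))) => //; ring.
  have := is_derive_0_is_cst y 0 d0; rewrite expr0n /= mul0r expR0 mulr1 => <-.
  by rewrite -mulrA -expRD subrr expR0 mulr1.
have C0 : C 0 = Num.sqrt (2 * pi).
  by rewrite -integral_gauss; apply: eq_Rintegral => x _; rewrite mulr0 oppr0 cos0 mul1r.
have S0 : S 0 = 0.
  transitivity (\int[mu]_(x in setT) (0 : R)); last by rewrite Rintegral_cst // mul0r.
  by apply: eq_Rintegral => x _; rewrite mulr0 oppr0 sin0 mul0r.
rewrite E (key C dC) (key S dS) C0 S0 mul0r.
have s0 : Num.sqrt (2 * pi) != 0 :> R by rewrite gt_eqF // sqrtr_gt0 mulr_gt0 ?pi_gt0.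
apply/eqP; rewrite eq_complex /= /fourier_cst; apply/andP; split; apply/eqP; last by ring.
by rewrite mul0r subr0 mulrA mulVf // mul1r.
Qed.

End GaussianFourier.

(** * Weighted norms of wave packets *)

Section Weights.
Context {R : realType}.
Implicit Types (N w e xi eta sigma q : R).
Notation mu := (@lebesgue_measure R).

Lemma japanese_ge1 xi : 1 <= japanese xi.
Proof. by rewrite /japanese -{1}sqrtr1 ler_wsqrtr // lerDl sqr_ge0. Qed.

Lemma japanese_gt0 xi : 0 < japanese xi.
Proof. exact: lt_le_trans (japanese_ge1 xi). Qed.

Lemma norm_le_japanese xi : `|xi| <= japanese xi.
Proof. by rewrite /japanese -sqrtr_sqr ler_wsqrtr // lerDr. Qed.

Lemma japanese_le xi : japanese xi <= 1 + `|xi|.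
Proof.
have h : 0 <= 1 + `|xi| by rewrite addr_ge0.
rewrite -(ger0_norm h) -sqrtr_sqr ler_wsqrtr // -(real_normK (num_real xi)).
by have := normr_ge0 xi; rewrite !expr2; nra.
Qed.

Lemma powR_ge1 N sigma : 1 <= N -> 0 <= sigma -> 1 <= N `^ sigma.
Proof. by move=> N1 s0; rewrite -(powRr0 N) ler_powR. Qed.

Lemma scale_le N e : 1 <= N -> 0 < e -> N `^ (1 - e) <= N.
Proof. by move=> N1 e0; apply: ler1_powR => //; lra. Qed.

Lemma japanese_shift_le N e eta : 1 <= N -> 0 < e ->
  japanese (N + N `^ (1 - e) * eta) <= 2 * N * (1 + `|eta|).
Proof.
move=> N1 e0; apply: le_trans (japanese_le _) _.
have := ler_normD N (N `^ (1 - e) * eta).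
rewrite normrM (ger0_norm (powR_ge0 _ _)) (ger0_norm (le_trans ler01 N1)).
have := ler_wpM2r (normr_ge0 eta) (scale_le N1 e0).
by have := normr_ge0 eta; nra.
Qed.

(** Either the shift is at most [N / 2] and the bracket is comparable with [N], or [|eta| > N^e / 2]
    and a power of [1 + |eta|] with exponent at least [1 / e] already exceeds [N]. *)
Lemma japanese_shift_ge e : 0 < e -> exists M : nat, forall N eta, 1 <= N ->
  N <= (2 * (1 + `|eta|)) ^+ M * (2 * japanese (N + N `^ (1 - e) * eta)).
Proof.
move=> e0; pose M := Num.bound e^-1.
have eM : e^-1 <= M%:R by rewrite ltW // archi_boundP // invr_ge0 ltW.
exists M => N eta N1; set w := N `^ (1 - e); set J := japanese _.
have J1 : 1 <= J := japanese_ge1 _.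
have Y2 : 1 <= 2 * (1 + `|eta|) by have := normr_ge0 eta; lra.
have w0 : 0 < w by rewrite powR_gt0 // (lt_le_trans ltr01).
have [h|h] := leP (w * `|eta|) (N / 2).
  have NJ : N <= 2 * J.
    have : `|N| <= `|N + w * eta| + `|w * eta|.
      by rewrite -{1}(addrK (w * eta) N) ler_normB.
    rewrite (normrM w) (gtr0_norm w0) (ger0_norm (le_trans ler01 N1)).
    by have := norm_le_japanese (N + w * eta); rewrite -/J; lra.
  by rewrite (le_trans NJ) // ler_peMl ?exprn_ege1 // mulr_ge0 // (le_trans ler01).
have NY : N `^ e <= 2 * (1 + `|eta|).
  have -> : N `^ e = N / w.
    rewrite /w powRB ?powRr1 ?(le_trans ler01) // ?implybE; last first.
      by rewrite (gt_eqF (lt_le_trans ltr01 N1)) orbT.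
    by rewrite invf_div mulrCA mulfV ?mulr1 // gt_eqF // (lt_le_trans ltr01).
  rewrite ler_pdivrMr //; have := normr_ge0 eta; nra.
apply: (@le_trans _ _ ((2 * (1 + `|eta|)) ^+ M)).
  rewrite -powR_mulrn ?(le_trans ler01) //.
  apply: (@le_trans _ _ ((2 * (1 + `|eta|)) `^ e^-1)); last exact: ler_powR.
  apply: (@le_trans _ _ ((N `^ e) `^ e^-1)).
    by rewrite -powRrM mulfV ?gt_eqF // powRr1 // (le_trans ler01).
  by apply: ge0_ler_powR; rewrite ?nnegrE ?invr_ge0 ?powR_ge0 ?(le_trans ler01 Y2) // ltW.
by rewrite ler_peMr ?exprn_ge0 ?(le_trans ler01 Y2) //; lra.
Qed.

(** A variant of Peetre's inequality: near [N], on the scale [N^(1 - e)], the weight may be replaced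
    by [N^sigma] at a polynomial cost in [eta]. Both signs of [sigma] occur, since solutions carry
    the weight [s] and test functions [- s]. *)
Lemma japanese_shift_powR e sigma : 0 < e ->
  exists (L : nat) (C : R), 0 < C /\ forall N eta, 1 <= N ->
    japanese (N + N `^ (1 - e) * eta) `^ sigma <= C * N `^ sigma * (1 + `|eta|) ^+ L.
Proof.
move=> e0; have [s0|s0] := leP 0 sigma.
  pose L := Num.bound sigma.
  have sL : sigma <= L%:R by rewrite ltW // archi_boundP.
  exists L, (2 `^ sigma); split; first exact: powR_gt0.
  move=> N eta N1; have N0 := le_trans ler01 N1.
  have Y1 : 1 <= 1 + `|eta| by rewrite lerDl.
  have Y0 := le_trans ler01 Y1.
  apply: (@le_trans _ _ ((2 * N * (1 + `|eta|)) `^ sigma)).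
    apply: ge0_ler_powR; rewrite ?nnegrE ?mulr_ge0 ?(ltW (japanese_gt0 _)) //.
    exact: japanese_shift_le.
  rewrite !powRM ?mulr_ge0 // ler_wpM2l ?mulr_ge0 ?powR_ge0 //.
  by rewrite -powR_mulrn // ler_powR.
have [M HM] := japanese_shift_ge e0.
pose L := Num.bound (M%:R * - sigma).
have sL : M%:R * - sigma <= L%:R.
  by rewrite ltW // archi_boundP // mulr_ge0 // oppr_ge0 ltW.
exists L, ((2 ^+ M * 2) `^ (- sigma)); split.
  by rewrite powR_gt0 // mulr_gt0 // exprn_gt0.
move=> N eta N1; have N0 := le_trans ler01 N1.
have Y1 : 1 <= 1 + `|eta| by rewrite lerDl.
have Y0 := le_trans ler01 Y1.
set J := japanese _; have J0 : 0 < J := japanese_gt0 _.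
have h := HM N eta N1; rewrite -/J in h.
have h' : N `^ (- sigma) <= (2 ^+ M * 2) `^ (- sigma) * (1 + `|eta|) ^+ L * J `^ (- sigma).
  apply: (@le_trans _ _ (((2 ^+ M * 2) * (1 + `|eta|) ^+ M * J) `^ (- sigma))).
    apply: ge0_ler_powR; rewrite ?nnegrE ?mulr_ge0 ?exprn_ge0 ?(ltW J0) //.
      by rewrite oppr_ge0 ltW.
    by move: h; rewrite exprMn; congr (_ <= _); ring.
  rewrite !powRM ?mulr_ge0 ?exprn_ge0 ?(ltW J0) //.
  rewrite ler_wpM2r ?powR_ge0 // ler_wpM2l ?mulr_ge0 ?powR_ge0 //.
  by rewrite -!powR_mulrn // -powRrM ler_powR.
rewrite (powRN N) (powRN J) in h'.
have NN : 0 < N `^ sigma by rewrite powR_gt0 // (lt_le_trans ltr01).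
have JJ : 0 < J `^ sigma by rewrite powR_gt0.
have := ler_wpM2l (mulr_ge0 (ltW JJ) (ltW NN)) h'.
rewrite mulfK ?gt_eqF //.
set k := _ `^ (- sigma); set y := _ ^+ L.
have -> // : J `^ sigma * N `^ sigma * (k * y * (J `^ sigma)^-1) = k * N `^ sigma * y.
by field; rewrite gt_eqF.
Qed.

Lemma measurable_japanese_powR sigma :
  measurable_fun setT (fun xi : R => japanese xi `^ sigma).
Proof.
apply: (measurableT_comp (measurable_powR sigma)).
apply: (measurableT_comp (continuous_mu (@sqrt_continuous R))).
by apply: continuous_mu; exact: continuous_oneDsqr.
Qed.

(** In the variable [eta = (xi - N) / w] the weight becomes [N^sigma] and the measure contributes
    the factor [w = N^(1 - e)]. The constants do not depend on [N], which gives all uniform bounds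
    below. *)
Lemma weighted_Lnorm_le e sigma q : 0 < e -> 1 <= q ->
  exists (m : nat) (C : R), 0 < C /\ forall N A (f : R -> R[i]), 1 <= N -> 0 <= A ->
    ccont f ->
    (forall xi, (1 + `|(xi - N) / N `^ (1 - e)|) ^+ m * normc (f xi) <= A) ->
    ('N[mu]_(q%:E) [(fun xi => (japanese xi `^ sigma * normc (f xi))%:E)] <=
      (C * A * (N `^ (sigma * q) * N `^ (1 - e)) `^ q^-1)%:E)%E.
Proof.
move=> e0 q1; have [L [C [C0 HC]]] := japanese_shift_powR sigma e0.
have q0 : 0 < q := lt_le_trans ltr01 q1.
(* [L] powers pay for the replacement of the weight, two for integrability. *)
exists (L + 2)%N, (C * pi `^ q^-1); split; first by rewrite mulr_gt0 // powR_gt0 // pi_gt0.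
move=> N A f N1 A0 cf fA; have N0 := lt_le_trans ltr01 N1.
set w := N `^ (1 - e); have w0 : 0 < w by exact: powR_gt0.
have J0 xi : 0 <= japanese xi := ltW (japanese_gt0 xi).
have P xi : (japanese xi `^ sigma * normc (f xi)) `^ q <=
    (C * A) `^ q * N `^ (sigma * q) * (oneDsqr ((xi - N) / w))^-1.
  set eta := (xi - N) / w; set Y := 1 + `|eta|.
  have Y1 : 1 <= Y by rewrite lerDl.
  have Y0 := lt_le_trans ltr01 Y1.
  have xiE : N + w * eta = xi by rewrite /eta mulrCA mulfV ?gt_eqF // mulr1 addrC subrK.
  have h1 := HC N eta N1; rewrite -/w xiE -/Y in h1.
  have h2 := fA xi; rewrite -/w -/eta -/Y exprD in h2.
  have h3 : japanese xi `^ sigma * normc (f xi) <= C * A * N `^ sigma * Y ^- 2.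
    rewrite ler_pdivlMr ?exprn_gt0 //.
    apply: (@le_trans _ _ ((C * N `^ sigma * Y ^+ L) * (normc (f xi) * Y ^+ 2))).
      by rewrite -[X in X <= _]mulrA ler_wpM2r ?mulr_ge0 ?normc_ge0 ?exprn_ge0 ?(ltW Y0).
    have -> : C * N `^ sigma * Y ^+ L * (normc (f xi) * Y ^+ 2) =
      C * N `^ sigma * (Y ^+ L * Y ^+ 2 * normc (f xi)) by ring.
    have -> : C * A * N `^ sigma = C * N `^ sigma * A by ring.
    by rewrite ler_wpM2l ?mulr_ge0 ?powR_ge0 ?(ltW C0).
  have YV0 : 0 <= Y ^- 2 by rewrite invr_ge0 exprn_ge0 ?(ltW Y0).
  apply: (@le_trans _ _ ((C * A * N `^ sigma * Y ^- 2) `^ q)).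
    by apply: ge0_ler_powR; rewrite ?nnegrE ?mulr_ge0 ?powR_ge0 ?normc_ge0 ?(ltW q0) ?(ltW C0).
  rewrite !powRM ?mulr_ge0 ?powR_ge0 ?(ltW C0) // -powRrM.
  rewrite ler_wpM2l ?mulr_ge0 ?powR_ge0 //.
  (* [Y^-2] is at most 1, so raising it to the power [q >= 1] only decreases it. *)
  apply: (@le_trans _ _ (Y ^- 2)).
    apply: ge1r_powR => //; rewrite invr_gt0 exprn_gt0 //=.
    by rewrite invf_le1 ?exprn_gt0 // exprn_ege1.
  rewrite lef_pV2 ?posrE ?exprn_gt0 ?(lt_le_trans ltr01 (oneDsqr_ge1 _)) //.
  exact: oneDsqr_le.
have K0 : 0 <= (C * A) `^ q * N `^ (sigma * q) by rewrite mulr_ge0 ?powR_ge0.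
have cB : continuous (fun xi : R => (oneDsqr ((xi - N) / w))^-1).
  move=> x; apply: (@continuous_comp _ _ _ (fun xi : R => (xi - N) / w)
    (fun y : R => (oneDsqr y)^-1)); last exact: continuous_oneDsqrV.
  by apply: cvgMl; apply: cvgB; [exact: cvg_id|exact: cvg_cst].
have mJ := measurable_japanese_powR sigma.
have mf := measurable_normc (ccont_cmeasurable cf).
have hint : (\int[mu]_xi ((oneDsqr ((xi - N) / w))^-1)%:E = (w * pi)%:E)%E.
  have [r1 e1] := @rint_oneDsqr R.
  have wV0 : 0 < w^-1 by rewrite invr_gt0.
  have := integral_affine_ge0 (- (N / w)) wV0 (@continuous_oneDsqrV R) oneDsqrV_ge0.
  have -> : (\int[mu]_x (oneDsqr x)^-1%:E = pi%:E)%E.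
    by rewrite -e1 /Rintegral fineK // (integrable_fin_num _ r1).
  under [X in (_ = _ * X)%E -> _]eq_integral => x _.
    rewrite (_ : w^-1 * x - N / w = (x - N) / w); last by rewrite mulrBl mulrC.
    over.
  move=> H; rewrite EFinM H muleA -EFinM mulfV ?gt_eqF // mul1e //.
have -> : (C * pi `^ q^-1 * A * (N `^ (sigma * q) * w) `^ q^-1) =
   (((C * A) `^ q * N `^ (sigma * q)) * (w * pi)) `^ q^-1.
  rewrite !powRM ?mulr_ge0 ?powR_ge0 ?(ltW C0) ?pi_ge0 ?(ltW w0) //.
  rewrite -[(C `^ q) `^ _]powRrM -[(A `^ q) `^ _]powRrM mulfV ?gt_eqF // !powRr1 ?(ltW C0) //.
  ring.
rewrite unlock /Lnorm -poweR_EFin.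
apply: gt0_ler_poweR; rewrite ?invr_ge0 ?(ltW q0) //.
- by rewrite in_itv /= leey andbT integral_ge0 // => x _; exact: poweR_ge0.
- by rewrite in_itv /= leey andbT lee_fin !mulr_ge0 ?powR_ge0 ?pi_ge0 ?(ltW w0).
rewrite EFinM -hint -ge0_integralZl //; last first.
  by apply/measurable_EFinP; apply: continuous_mu.
apply: ge0_le_integral => //.
- by move=> x _; exact: poweR_ge0.
- apply: (measurableT_comp (measurable_poweR q)).
  apply: measurableT_comp => //; apply/measurable_EFinP.
  exact: measurable_funM.
- by apply/measurable_EFinP; apply: measurable_funM => //; exact: continuous_mu.
- move=> x _; rewrite abse_EFin poweR_EFin lee_fin ger0_norm; first exact: P.
  by rewrite mulr_ge0 ?powR_ge0 ?normc_ge0.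
Qed.

End Weights.

(** * Transforms of the initial data, and lower bounds of the norm by duality *)

Section SolitonNorm.
Context {R : realType}.
Implicit Types (N w xi eta theta : R).
Notation mu := (@lebesgue_measure R).

Definition sech_hat : R -> R[i] := fourier (fun x : R => (sech x)%:C).

Lemma soliton_at0 j (k w x : R) :
  soliton j k w 0 x = expi (k * x + 0) * (w%:C * (sech (w * x - w * 0))%:C).
Proof. by rewrite /soliton /wave /profile !mulr0 !subr0 -realcM. Qed.

(** A change of the frequency by [theta w] becomes a translation by [theta] in a variable that no
    longer refers to [N] or [w]. *)
Lemma fourier_soliton j N w theta xi : 0 < w ->
  fourier (soliton j (N + theta * w) w 0) xi = sech_hat ((xi - N) / w - theta).
Proof.
move=> w0; have -> : soliton j (N + theta * w) w 0 =
   (fun x => expi ((N + theta * w) * x + 0) * (w%:C * (sech (w * x - w * 0))%:C)).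
  by apply/funext => x; rewrite soliton_at0.
rewrite (@fourier_wave _ (fun x => (sech x)%:C)) //; last first.
  exact: schwartz_cdominated is_schwartz_sech.
rewrite mul0r addr0 expi0 mul1r; congr sech_hat.
by rewrite opprD addrA mulrBl mulfK ?gt_eqF.
Qed.

Lemma is_schwartz_soliton j (k w t : R) : w != 0 -> is_schwartz (soliton j k w t).
Proof.
move=> w0; have := is_schwartz_mod k (- (cpow k w (2 * j)).1 * t)
  (is_schwartz_affine (- ((cpow k w (2 * j)).2 * t)) (oner_neq0 R) (is_schwartz_profile w0)).
by congr is_schwartz; apply/funext => x; rewrite mul1r.
Qed.

Lemma weight_shift eta theta : `|theta| <= 1 ->
  1 + `|eta| <= 2 * (1 + `|eta - theta|).
Proof.
move=> t1; have := ler_normD (eta - theta) theta; rewrite subrK.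
by have := normr_ge0 (eta - theta); lra.
Qed.

Lemma sech_hat_shift_decay m : exists2 C, 0 <= C & forall eta theta, `|theta| <= 1 ->
  (1 + `|eta|) ^+ m * normc (sech_hat (eta - theta)) <= C.
Proof.
have [C C0 hC] := fourier_decay m (@is_schwartz_sech R).
exists (2 ^+ m * C); first by rewrite mulr_ge0 ?exprn_ge0.
move=> eta theta t1; apply: le_trans (ler_wpM2l _ (hC (eta - theta))); last exact: exprn_ge0.
rewrite mulrA -exprMn ler_wpM2r ?normc_ge0 // lerXn2r ?nnegrE ?addr_ge0 ?mulr_ge0 ?addr_ge0 //.
exact: weight_shift.
Qed.

(* Interpolation between the Lipschitz bound and the decay of [sech_hat]. *)
Lemma sech_hat_diff_decay m : exists2 C, 0 <= C & forall eta theta, 0 <= theta <= 1 ->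
  (1 + `|eta|) ^+ m * normc (sech_hat eta - sech_hat (eta - theta)) <= Num.sqrt (C * theta).
Proof.
(* Twice the weight, because [(Y d)^2 = (Y Y d) d]: the first factor is bounded by decay, the second
   by the Lipschitz estimate. *)
have [C1 C10 h1] := sech_hat_shift_decay (m + m).
have [C2 C20 h2] := fourier_lipschitz (@is_schwartz_sech R).
exists (2 * C1 * C2); first by rewrite !mulr_ge0.
move=> eta theta /andP[t0 t1].
set d := normc _; set Y := (1 + `|eta|) ^+ m.
have d0 : 0 <= d := normc_ge0 _.
have Y0 : 0 <= Y by rewrite exprn_ge0 // addr_ge0.
rewrite -(ger0_norm (mulr_ge0 Y0 d0)) -sqrtr_sqr ler_wsqrtr //.
have -> : (Y * d) ^+ 2 = (Y * Y * d) * d by ring.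
have -> : 2 * C1 * C2 * theta = (2 * C1) * (C2 * theta) by ring.
apply: ler_pM; rewrite ?mulr_ge0 //.
  rewrite -exprD; apply: (@le_trans _ _ ((1 + `|eta|) ^+ (m + m) *
    (normc (sech_hat (eta - 0)) + normc (sech_hat (eta - theta))))).
    rewrite ler_wpM2l ?exprn_ge0 ?addr_ge0 // subr0.
    by apply: le_trans (le_normcD _ _) _; rewrite normcN.
  rewrite mulrDr mulrDl mul1r; apply: lerD; apply: h1; first by rewrite normr0.
  by rewrite ger0_norm.
apply: le_trans (h2 _ _) _.
by rewrite opprB addrCA subrr addr0 ger0_norm.
Qed.

Lemma Hhat_norm_dist_of_le (s r : R) f : is_schwartz f ->
  (Hhat_norm s r (dist_of f) <= 'N[mu]_((dual_exponent r)%:E)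
     [(fun xi => (japanese xi `^ s * normc (fourier f xi))%:E)])%E.
Proof.
by move=> sf; apply: ereal_inf_lbound; exists (fourier f) => //; exact: fourier_function_dist_of.
Qed.

(** For every [f] representing the transform of [D], pairing [f] with [phi] equals pairing [D] with
    [psi]; Hoelder's inequality is applied with the weights of order [s] and [- s]. Since the bound
    holds for each representative, it passes to the infimum. *)
Lemma Hhat_norm_dist_of_ge (s r : R) (D : R -> R[i]) (phi psi : schwartz R) (K : R) :
  1 < r -> is_schwartz D -> psi = fourier phi :> (R -> R[i]) -> 0 < K ->
  ('N[mu]_(r%:E) [(fun xi => (japanese xi `^ (- s) * normc (phi xi))%:E)] <= K%:E)%E ->
  ((normc (cintegral (fun x => D x * psi x)) / (2 * K))%:E <= Hhat_norm s r (dist_of D))%E.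
Proof.
move=> r1 sD psiE K0 phiK; apply/ereal_infP => _ [f [mf If Ff] <-].
have := Ff phi psi psiE; rewrite /dist_of => <-.
have r0 := lt_trans ltr01 r1.
have rV1 : r^-1 < 1 by rewrite invf_lt1.
have p0 : 0 < dual_exponent r by rewrite invr_gt0 subr_gt0.
have mphi : cmeasurable phi.
  exact/ccont_cmeasurable/cder_ccont/is_schwartz_cder/schwartz_is_schwartz.
have [Ir Ii] := If phi.
have mfphi : cmeasurable (fun x => f x * phi x).
  by split; apply/measurable_EFinP; [exact: measurable_int Ir|exact: measurable_int Ii].
have rg : rint (fun x => normc (f x * phi x)).
  apply: (@le_rint _ _ (fun x => `|complex.Re (f x * phi x)| + `|complex.Im (f x * phi x)|)).
  - exact: measurable_normc.
  - by move=> x; rewrite ger0_norm ?normc_ge0 // normc_le_ReIm.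
  - by apply: rintD; exact: integrable_norm.
have := normc_cintegral (If phi) (fun x => lexx _) rg.
set I := \int[mu]_x _ => cI.
have H := @hoelder _ _ _ mu (fun xi => japanese xi `^ s * normc (f xi))
  (fun xi => japanese xi `^ (- s) * normc (phi xi)) (dual_exponent r) r
  (measurable_funM (measurable_japanese_powR s) (measurable_normc mf))
  (measurable_funM (measurable_japanese_powR (- s)) (measurable_normc mphi)) p0 r0.
have {}H := H _; rewrite Lnorm1 in H.
have IE : (\int[mu]_x `|(EFin \o ((fun xi => japanese xi `^ s * normc (f xi)) \*
   (fun xi => japanese xi `^ (- s) * normc (phi xi)))%R) x| = I%:E)%E.
  rewrite /I /Rintegral fineK ?(integrable_fin_num _ rg) //.
  apply: eq_integral => x _ /=; congr EFin.
  rewrite ger0_norm ?mulr_ge0 ?powR_ge0 ?normc_ge0 // mulrACA normcM.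
  rewrite powRN mulfV ?mul1r // gt_eqF // powR_gt0 //.
  exact: japanese_gt0.
rewrite IE in H.
set n := Lnorm _ _ _.
have n0 : (0 <= n)%E by exact: Lnorm_ge0.
have h1 : (I%:E <= n * K%:E)%E.
  apply: le_trans (H _) _; first by rewrite /dual_exponent invrK subrK.
  by rewrite lee_wpmul2l.
have h2 : ((normc (cintegral (fun x => f x * phi x)) / 2)%:E <= n * K%:E)%E.
  by apply: le_trans h1; rewrite lee_fin ler_pdivrMr // mulrC.
rewrite invfM mulrA EFinM.
by rewrite lee_pdivrMr.
Qed.

End SolitonNorm.

(** * Velocities of solitons *)

Section Velocity.
Context {R : realType}.
Implicit Types k w t theta : R.

(** Homogeneity, [(k w + i w)^n = w^n (k + i)^n], reduces all velocity estimates to the scale 1. *)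
Lemma cpow_scale k w n :
  (cpow (k * w) w n).1 = w ^+ n * (cpow k 1 n).1 /\
  w * (cpow (k * w) w n).2 = w ^+ n * (cpow k 1 n).2.
Proof.
elim: n => [|n [IH1 IH2]] /=; first by rewrite expr0 !mul1r mulr0.
rewrite (exprS w n); split.
  have -> : w ^+ 2 * (cpow (k * w) w n).2 = w * (w * (cpow (k * w) w n).2) by ring.
  by rewrite IH1 IH2; ring.
have -> : w * ((cpow (k * w) w n).1 + k * w * (cpow (k * w) w n).2) =
  w * (cpow (k * w) w n).1 + w * k * (w * (cpow (k * w) w n).2) by ring.
by rewrite IH1 IH2; ring.
Qed.

(** Real and imaginary parts of the derivative [n (k + i)^(n - 1)] of [(k + i)^n]. *)
Lemma is_derive_cpow n k :
  is_derive k 1 (fun k => (cpow k 1 n).1) (n%:R * (cpow k 1 n.-1).1) /\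
  is_derive k 1 (fun k => (cpow k 1 n).2) (n%:R * (cpow k 1 n.-1).2).
Proof.
elim: n => [|n [IH1 IH2]] /=.
  by rewrite !mul0r; split; exact: is_derive_cst.
have D1 := rderM (is_derive_id k (1 : R)) IH1.
have D2 := rderM (is_derive_id k (1 : R)) IH2.
(* One step of the recursion backwards. The factor [n%:R] covers [n = 0], where [n.-1] does not
   precede [n] and the identity alone would fail. *)
have S0 : n%:R * (cpow k 1 n).1 = n%:R * (k * (cpow k 1 n.-1).1 - (cpow k 1 n.-1).2).
  by case: n {IH1 IH2 D1 D2} => [|n] /=; rewrite ?mulr0n ?mul0r // expr1n mul1r.
have S1 : n%:R * (cpow k 1 n).2 = n%:R * ((cpow k 1 n.-1).1 + k * (cpow k 1 n.-1).2).
  by case: n {IH1 IH2 D1 D2 S0} => [|n] /=; rewrite ?mulr0n ?mul0r.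
split.
  apply: (is_deriveE (rderD D1 (rderZ (-1) IH2))) => [y|].
    by rewrite expr1n mul1r mulN1r.
  by rewrite -natr1 mulrDl mul1r S0; ring.
apply: (is_deriveE (rderD IH1 D2)) => //.
by rewrite -natr1 mulrDl mul1r S1; ring.
Qed.

(** For large [k] the real part is [k^n] and the imaginary part is small, both up to a relative
    error of order [1 / k]. Multiplying by [k] avoids the exponent [n - 1]. *)
Lemma cpow_asymptotics n : exists2 A, 0 <= A & forall k, 1 <= k ->
  k * `|(cpow k 1 n).1 - k ^+ n| <= A * k ^+ n /\ k * `|(cpow k 1 n).2| <= A * k ^+ n.
Proof.
elim: n => [|n [A A0 IH]].
  by exists 0 => // k _ /=; rewrite expr0 subrr normr0 mulr0 mul0r.
exists (A + A + 1); first by rewrite !addr_ge0.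
move=> k k1; have [IH1 IH2] := IH k k1; rewrite /= expr1n mul1r !exprS.
have k0 := le_trans ler01 k1.
have kn0 : 0 <= k ^+ n by rewrite exprn_ge0.
set X := (cpow k 1 n).1 in IH1 *; set Y := (cpow k 1 n).2 in IH2 *.
have h1 : `|k * X - Y - k * k ^+ n| <= k * `|X - k ^+ n| + `|Y|.
  have -> : k * X - Y - k * k ^+ n = k * (X - k ^+ n) - Y by ring.
  by apply: le_trans (ler_normB _ _) _; rewrite normrM (ger0_norm k0).
have h2 : `|X + k * Y| <= `|X - k ^+ n| + k ^+ n + k * `|Y|.
  have -> : X + k * Y = (X - k ^+ n) + k ^+ n + k * Y by ring.
  apply: le_trans (ler_normD _ _) _; rewrite normrM (ger0_norm k0) lerD2r.
  by apply: le_trans (ler_normD _ _) _; rewrite (ger0_norm kn0).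
have Ak : A * k ^+ n <= A * (k * k ^+ n).
  by rewrite ler_wpM2l // ler_peMl.
have kk : 0 <= k * k ^+ n by rewrite mulr_ge0.
have h3 := ler_wpM2l k0 IH1; have h4 := ler_wpM2l k0 IH2.
have h1' := ler_wpM2l k0 h1; have h2' := ler_wpM2l k0 h2.
split.
  apply: le_trans h1' _; rewrite mulrDr; apply: le_trans (lerD h3 IH2) _.
  by rewrite !mulrDl mul1r (mulrCA k A); lra.
apply: le_trans h2' _; rewrite !mulrDr.
move: h4; rewrite (mulrCA k A) => h4.
by rewrite !mulrDl mul1r; lra.
Qed.

(** The argument of [k + i] tends to 0, so for large [k] the power stays in the first quadrant,
    close to the real axis. *)
Lemma cpow_lower n : exists2 k0, 1 <= k0 & forall k, k0 <= k ->
  0 <= (cpow k 1 n).2 /\ k ^+ n / 2 <= (cpow k 1 n).1.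
Proof.
elim: n => [|n [k0 k01 IH]].
  by exists 1 => // k _ /=; rewrite expr0; split=> //; lra.
have [A A0 HA] := cpow_asymptotics n.+1.
(* [k >= 2 A] makes the error in the real part at most half of the leading term. *)
exists (k0 + 2 * A); first by rewrite (le_trans k01) // lerDl mulr_ge0.
move=> k kk; have kk0 : k0 <= k by rewrite (le_trans _ kk) // lerDl mulr_ge0.
have k1 := le_trans k01 kk0; have k0' := lt_le_trans ltr01 k1.
have [Y0 X0] := IH k kk0; split.
  by rewrite /= addr_ge0 ?mulr_ge0 ?(ltW k0') // (le_trans _ X0) // divr_ge0 // exprn_ge0 // ltW.
have [h _] := HA k k1.
have kn : 0 < k ^+ n.+1 by rewrite exprn_gt0.
have h' : `|(cpow k 1 n.+1).1 - k ^+ n.+1| <= k ^+ n.+1 / 2.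
  rewrite -(ler_pM2l k0') (le_trans h) //.
  have : 2 * A <= k by rewrite (le_trans _ kk) // lerDr (le_trans ler01).
  nra.
by move: h'; rewrite ler_distlC => /andP[]; lra.
Qed.

(** By the mean value theorem, as the derivative [2 j Im (x + i)^(2 j - 1)] is at least
    [2 j Re (x + i)^(2 j - 2)], hence at least [j x^(2 j - 2)]. *)
Lemma cpow_increment j : (0 < j)%N -> exists2 k0, 1 <= k0 &
  forall k theta, k0 <= k -> 0 < theta ->
  theta * k ^+ (2 * j - 2) <= (cpow (k + theta) 1 (2 * j)).2 - (cpow k 1 (2 * j)).2.
Proof.
move=> j0; have [n jn] : exists n, (2 * j)%N = n.+2 by exists (2 * j - 2)%N; lia.
rewrite jn !subSS subn0; have [k0 k01 H] := cpow_lower n.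
exists k0 => // k theta kk t0.
have kt : k < k + theta by rewrite ltrDl.
have D (x : R) := (is_derive_cpow n.+2 x).2.
have [x] := @MVT R _ _ _ _ kt (fun x _ => D x)
  (continuous_subspaceT (rder_continuous (fun x => rder_derivable (D x)))).
rewrite in_itv /= => /andP[kx xk] ->.
rewrite [k + theta]addrC addrK mulrC ler_wpM2r ?(ltW t0) //.
have k1 := lt_le_trans ltr01 (le_trans k01 kk).
have [Y0 X0] := H x (le_trans kk (ltW kx)).
have x0 := lt_trans k1 kx.
have kn : k ^+ n <= x ^+ n by rewrite lerXn2r ?nnegrE ?(ltW k1) ?(ltW x0) // ltW.
have -> : n.+2%:R = n%:R + 2 :> R by rewrite -addn2 natrD.
have n0 : 0 <= n%:R :> R by [].
have h : x ^+ n / 2 <= (cpow x 1 n).1 + x * (cpow x 1 n).2.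
  by rewrite (le_trans X0) // lerDl mulr_ge0 // ltW.
have xn : 0 <= x ^+ n by rewrite exprn_ge0 // ltW.
apply: (le_trans kn); apply: (@le_trans _ _ ((n%:R + 2) * (x ^+ n / 2))).
  by have : 0 <= n%:R * (x ^+ n / 2); [rewrite !mulr_ge0|lra].
by rewrite ler_wpM2l // addr_ge0.
Qed.

End Velocity.

(** * Two separating solitons *)

Section UniformBounds.
Context {R : realType}.
Variables (j : nat) (r s : R).
Hypothesis r1 : 1 < r.
Local Notation p := (dual_exponent r).
Local Notation e := (1 + s * p).
Hypothesis e0 : 0 < e.
Notation mu := (@lebesgue_measure R).

(** The spread in frequency, equal to [N^(- s p)]; the length in space is its inverse. The exponent
    [1 - e] displays that the spread relative to [N] is [N^(- e)]. *)
Definition width (N : R) : R := N `^ (1 - e).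

Lemma width_gt0 N : 1 <= N -> 0 < width N.
Proof. by move=> N1; rewrite powR_gt0 // (lt_le_trans ltr01). Qed.

Lemma dual_exponent_ge1 : 1 <= p.
Proof.
have r0 := lt_trans ltr01 r1; rewrite invf_ge1 ?subr_gt0 ?invf_lt1 //.
by rewrite lerBlDr lerDl invr_ge0 ltW.
Qed.

(** This is [N^s w^(1/p) = 1] raised to the power [p]: the powers of [N] in the norm of the data
    cancel. *)
Lemma width_normalised N : 1 <= N -> N `^ (s * p) * N `^ (1 - e) = 1.
Proof.
move=> N1; rewrite -powRD; last by rewrite (gt_eqF (lt_le_trans ltr01 N1)) implybT.
by rewrite (_ : _ + _ = 0) ?powRr0 //; ring.
Qed.

Lemma soliton_norm_bounded : exists M : R, forall N theta, 1 <= N -> 0 <= theta <= 1 ->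
  (Hhat_norm s r (dist_of (soliton j (N + theta * width N) (width N) 0)) <= M%:E)%E.
Proof.
have [m [C [C0 HC]]] := weighted_Lnorm_le s e0 dual_exponent_ge1.
have [A A0 HA] := @sech_hat_shift_decay R m.
exists (C * A) => N theta N1 /andP[t0 t1]; have w0 := width_gt0 N1.
have ss : is_schwartz (soliton j (N + theta * width N) (width N) 0).
  by apply: is_schwartz_soliton; rewrite gt_eqF.
apply: le_trans (Hhat_norm_dist_of_le s r ss) _.
have := HC N A (fourier (soliton j (N + theta * width N) (width N) 0)) N1 A0
  (fourier_ccont ss).
rewrite width_normalised // powR1 mulr1; apply => xi.
rewrite fourier_soliton //; apply: HA.
by rewrite ger0_norm.
Qed.

Lemma soliton_norm_close (d : R) : 0 < d -> exists2 theta, 0 < theta <= 1 & forall N, 1 <= N ->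
  (Hhat_norm s r (dist_of (soliton j N (width N) 0) -
     dist_of (soliton j (N + theta * width N) (width N) 0))%R < d%:E)%E.
Proof.
move=> d0; have [m [C [C0 HC]]] := weighted_Lnorm_le s e0 dual_exponent_ge1.
have [A A0 HA] := @sech_hat_diff_decay R m.
(* Chosen to give [Num.sqrt (A * theta) <= d / (2 * C)], hence a distance of at most [d / 2]. The
   denominator [A + 1] is positive even if [A = 0]. *)
pose theta := Num.min 1 ((d / (2 * C)) ^+ 2 / (A + 1)).
have A1 : 0 < A + 1 by rewrite ltr_wpDl.
have t0 : 0 < theta by rewrite lt_min ltr01 /= divr_gt0 // exprn_gt0 // divr_gt0 // mulr_gt0.
have t1 : theta <= 1 by rewrite ge_min lexx.
exists theta; first by rewrite t0.
move=> N N1; have w0 := width_gt0 N1; have w0' := lt0r_neq0 w0.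
have s1 : is_schwartz (soliton j N (width N) 0) by exact: is_schwartz_soliton.
have s2 : is_schwartz (soliton j (N + theta * width N) (width N) 0).
  exact: is_schwartz_soliton.
have s3 := is_schwartz_lin (-1) s2 s1.
rewrite dist_ofB //; apply: le_lt_trans (Hhat_norm_dist_of_le s r s3) _.
have := HC N (Num.sqrt (A * theta)) _ N1 (sqrtr_ge0 _) (fourier_ccont s3).
rewrite width_normalised // powR1 mulr1 => H.
apply: le_lt_trans (H _) _.
  move=> xi; rewrite fourier_lin; try exact: schwartz_cdominated.
  have F0 := @fourier_soliton _ j N (width N) 0 xi w0; rewrite mul0r addr0 subr0 in F0.
  rewrite F0 fourier_soliton // mulN1r [- _ + _]addrC; apply: HA.
  by rewrite (ltW t0).
rewrite lte_fin.
have h : Num.sqrt (A * theta) <= d / (2 * C).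
  have dC : 0 <= d / (2 * C) by rewrite divr_ge0 ?mulr_ge0 // ltW.
  rewrite -(ger0_norm dC) -sqrtr_sqr ler_wsqrtr //.
  apply: (@le_trans _ _ ((A + 1) * theta)); first by rewrite ler_wpM2r ?(ltW t0) // lerDl.
  by rewrite mulrC -ler_pdivlMr // ge_min lexx orbT.
apply: (@le_lt_trans _ _ (C * (d / (2 * C)))); first by rewrite ler_wpM2l // ltW.
have -> : C * (d / (2 * C)) = d / 2 by field; rewrite gt_eqF.
by lra.
Qed.

(* The Fourier transform of [packet N a] is a Gaussian wave packet at the
   position [a] with the frequency [-N] and the width of the soliton. *)
Definition packet (N a : R) : R -> R[i] := fun xi =>
  expi (a * xi + 0) * (((width N)^-1)%:C *
    (gauss ((width N)^-1 * xi - (width N)^-1 * N))%:C).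

Lemma is_schwartz_packet N a : 1 <= N -> is_schwartz (packet N a).
Proof.
move=> /width_gt0 w0; apply: is_schwartz_mod; apply: is_schwartzZ.
apply: (is_schwartz_affine _ _ is_schwartz_gauss).
by rewrite gt_eqF // invr_gt0.
Qed.

Definition packet_hat (N a : R) : R -> R[i] := fun x =>
  expi (N * (a - x) + 0) * (gauss ((x - a) / (width N)^-1))%:C.

Lemma fourier_packet N a : 1 <= N -> fourier (packet N a) = packet_hat N a.
Proof.
move=> /width_gt0 w0; apply/funext => x; rewrite /packet_hat -fourier_gauss.
apply: (@fourier_wave _ (fun y => (gauss y)%:C)); first by rewrite invr_gt0.
exact: schwartz_cdominated is_schwartz_gauss.
Qed.

Lemma is_schwartz_packet_hat N a : 1 <= N -> is_schwartz (packet_hat N a).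
Proof.
move=> /width_gt0 w0.
have w0' : width N != 0 by rewrite gt_eqF.
have := is_schwartz_mod (- N) (N * a)
  (is_schwartz_affine (- (width N * a)) w0' (@is_schwartz_gauss R)).
congr is_schwartz; apply/funext => x; rewrite /packet_hat invrK.
by congr (expi _ * (gauss _)%:C); ring.
Qed.

(** The amplitude [1 / w] balances the exponents: [w^-1 N^(- s) w^(1/r) = N^(- s) w^(- 1/p) = 1]. *)
Lemma packet_norm_bounded : exists2 K : R, 0 < K & forall N a, 1 <= N ->
  ('N[mu]_(r%:E) [(fun xi => (japanese xi `^ (- s) * normc (packet N a xi))%:E)] <= K%:E)%E.
Proof.
have r0 := lt_trans ltr01 r1.
have [m [C [C0 HC]]] := weighted_Lnorm_le (- s) e0 (ltW r1).
have [A A0 HA] := is_schwartz_bound m (@is_schwartz_gauss R).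
exists (C * (A + 1)); first by rewrite mulr_gt0 // ltr_wpDl.
move=> N a N1; have w0 := width_gt0 N1.
have B0 : 0 <= (width N)^-1 * A by rewrite mulr_ge0 // invr_ge0 ltW.
have cpk : ccont (packet N a) := cder_ccont (is_schwartz_cder (is_schwartz_packet a N1)).
have := HC N ((width N)^-1 * A) (packet N a) N1 B0 cpk.
have N0 : N != 0 by rewrite gt_eqF // (lt_le_trans ltr01).
have -> : C * ((width N)^-1 * A) * (N `^ (- s * r) * N `^ (1 - e)) `^ r^-1 = C * A.
  have -> : (width N)^-1 = N `^ (- (1 - e)) by rewrite powRN.
  rewrite -powRD ?N0 ?implybT // -powRrM.
  have -> : C * (N `^ (- (1 - e)) * A) * N `^ ((- s * r + (1 - e)) / r) =
     C * A * (N `^ (- (1 - e)) * N `^ ((- s * r + (1 - e)) / r)) by ring.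
  rewrite -powRD ?N0 ?implybT // (_ : _ + _ = 0) ?powRr0 ?mulr1 //.
  rewrite /dual_exponent; field.
  by rewrite (gt_eqF r0) subr_eq0 (gt_eqF r1).
move=> H; apply: le_trans (H _) _; last by rewrite lee_fin ler_wpM2l ?(ltW C0) // lerDl.
move=> xi.
have -> : normc (packet N a xi) = (width N)^-1 *
    normc (gauss ((width N)^-1 * xi - (width N)^-1 * N))%:C.
  rewrite /packet (normcM (expi _)) normc_expi mul1r (normcM ((width N)^-1)%:C).
  by rewrite (normc_real (width N)^-1) gtr0_norm ?invr_gt0.
rewrite mulrCA ler_wpM2l ?invr_ge0 ?(ltW w0) //.
have <- : (width N)^-1 * xi - (width N)^-1 * N = (xi - N) / N `^ (1 - e).
  by rewrite -mulrBr mulrC.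
exact: HA.
Qed.

End UniformBounds.

(** * Pairings of the solitons with the wave packet *)

Section Overlap.
Context {R : realType}.
Notation mu := (@lebesgue_measure R).

Definition overlap : R := \int[mu]_y (sech y * gauss y).

Lemma gauss_ge0 (y : R) : 0 <= gauss y.
Proof. exact: expR_ge0. Qed.

Lemma sech_le1 (y : R) : sech y <= 1.
Proof.
have : sech y ^+ 2 <= 1 by rewrite sech_tanh2 gerBl sqr_ge0.
by rewrite expr_le1 // ltW // sech_gt0.
Qed.

Lemma continuous_sech : continuous (@sech R).
Proof. by apply: rder_continuous => x; exact: rder_derivable (is_derive_sech x). Qed.

Lemma dominated_sech_gauss (D : R) : dominated (fun y : R => sech (y - D) * gauss y).
Proof.
split.
  move=> y; apply: cvgM; last exact: continuous_gauss.
  apply: (@continuous_comp _ _ _ (fun y => y - D) (@sech R)); last exact: continuous_sech.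
  by apply: cvgB; [exact: cvg_id|exact: cvg_cst].
have [C C0 hC] := dominated_ge0 (@dominated_gauss R); exists C => y.
apply: le_trans (hC y); rewrite normrM ler_piMl // gtr0_norm ?sech_gt0 //.
exact: sech_le1.
Qed.

Lemma overlap_gt0 : 0 < overlap.
Proof.
have rs : rint (fun y : R => sech y * gauss y).
  have := dominated_rint (dominated_sech_gauss 0).
  by congr rint; apply/funext => y; rewrite subr0.
have i01 : rint (\1_(`[0, 1]%classic) : R -> R) by exact: integrable_indic_itv.
have gm (y : R) : `|y| <= 1 -> expR (- 1) <= gauss y.
  move=> y1; rewrite ler_expR lerN2 -(real_normK (num_real y)).
  by have := normr_ge0 y; rewrite expr2; nra.
have sm (y : R) : `|y| <= 1 -> expR (- 1) <= sech y.
  move=> y1; rewrite /sech ler_pdivlMr ?cosh_gt0 // mulrDr -!expRD.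
  have h z : `|z| <= 1 -> expR (- 1 + z) <= 1 :> R.
    by move=> z1; rewrite expR_le1; have := ler_norm z; lra.
  by have := h y y1; have := h (- y); rewrite normrN => /(_ y1); lra.
have : \int[mu]_y (expR (- 1) * expR (- 1) * \1_(`[0, 1]%classic) y) <= overlap.
  apply: le_Rintegral => //; first exact: rintZ.
  move=> y _; rewrite indicE; case: (boolP (y \in _)) => [|_]; last first.
    by rewrite mulr0 mulr_ge0 ?gauss_ge0 // ltW // sech_gt0.
  rewrite inE /= in_itv /= => /andP[y0 y1]; rewrite mulr1.
  have ny : `|y| <= 1 by rewrite ger0_norm.
  by apply: ler_pM; rewrite ?expR_ge0 ?sm ?gm.
apply: lt_le_trans; rewrite RintegralZl // mulr_gt0 ?mulr_gt0 ?expR_gt0 //.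
have m01 : mu `[0, 1]%classic = 1%:E.
  by rewrite lebesgue_measure_itv /= lte_fin ltr01 -EFinB subr0.
by rewrite /Rintegral integral_indic // setIT [X in fine X]m01 ltr01.
Qed.

(** [|D| <= |y| + |y - D|] bounds [sech (y - D)] by [exp (|y| - |D|)] up to a constant. The Gaussian
    supplies [exp (- 2 |y|)]: one half cancels the growth, the other yields integrability. *)
Lemma sech_gauss_bound : exists2 B : R, 0 < B & forall D y,
  sech (y - D) * gauss y <= B * expR (- `|D|) * (oneDsqr y)^-1.
Proof.
have [M0 h0] := @exprn_expR_bound R 0; have [M2 h2] := @exprn_expR_bound R 2.
have M0p : 0 < M0.
  by apply: lt_le_trans (h0 0); rewrite expr0 mul1r expR_gt0.
have M2p : 0 <= M2.
  by apply: le_trans (h2 0); rewrite mulr_ge0 ?expR_ge0.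
exists (2 * expR 2 * (M0 + M2)).
  by rewrite !mulr_gt0 ?expR_gt0 // ltr_pwDl.
move=> D y.
have e1 : sech (y - D) <= 2 * (expR `|y| * expR (- `|D|)).
  apply: le_trans (sech_le _) _; rewrite ler_pM2l // -expRD ler_expR.
  have := ler_normD (y - (y - D)) (y - D); rewrite subrK.
  have -> : y - (y - D) = D by ring.
  have := ler_normB y (y - D); have -> : y - (y - D) = D by ring.
  lra.
have e2 : gauss y <= expR 2 * (expR (- `|y|) * expR (- `|y|)).
  rewrite -!expRD ler_expR -(real_normK (num_real y)).
  by have := sqr_ge0 (`|y| - 2); rewrite !expr2; lra.
have e3 : expR (- `|y|) <= (M0 + M2) * (oneDsqr y)^-1.
  rewrite ler_pdivlMr ?(lt_le_trans _ (oneDsqr_ge1 y)) //.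
  have := h0 y; have := h2 y; rewrite expr0 mul1r (real_normK (num_real y)) /oneDsqr; lra.
apply: (@le_trans _ _ (2 * (expR `|y| * expR (- `|D|)) *
   (expR 2 * (expR (- `|y|) * expR (- `|y|))))).
  by apply: ler_pM; rewrite ?gauss_ge0 // ltW // sech_gt0.
have -> : 2 * (expR `|y| * expR (- `|D|)) * (expR 2 * (expR (- `|y|) * expR (- `|y|))) =
  2 * expR 2 * expR (- `|D|) * (expR `|y| * expR (- `|y|)) * expR (- `|y|) by ring.
rewrite expRxMexpNx_1 mulr1.
have -> : 2 * expR 2 * (M0 + M2) * expR (- `|D|) / oneDsqr y =
  2 * expR 2 * expR (- `|D|) * ((M0 + M2) / oneDsqr y) by ring.
by rewrite ler_wpM2l // !mulr_ge0 ?expR_ge0.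
Qed.

Variables (j : nat) (r s : R).
Local Notation width := (width r s).
Local Notation packet_hat := (packet_hat r s).
Local Notation velocity k w := (cpow k w (2 * j)).2.

(** The packet has the opposite frequency and moves with the soliton, so the phases in [x] cancel. A
    constant phase of modulus 1 remains, and [y = w (x - a)] removes [N] and [t] from the
    integral. *)
Lemma soliton_packet_same N t : 1 <= N ->
  normc (cintegral (fun x => soliton j N (width N) t x *
    packet_hat N (velocity N (width N) * t) x)) = overlap.
Proof.
move=> N1; have w0 := width_gt0 r s N1.
set w := width N in w0 *; set a := _ * t.
pose F y : R[i] := (sech y * gauss y)%:C.
have dF : cdominated F.
  have [cF [C hC]] := dominated_sech_gauss 0.
  split; first split; last by exists C => x; rewrite normc_real; have := hC x; rewrite subr0.
    have -> : (fun x => complex.Re (F x)) = (fun y => sech (y - 0) * gauss y) => //.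
    by apply/funext => y; rewrite subr0.
  by move=> x; exact: cvg_cst.
have -> : (fun x => soliton j N w t x * packet_hat N a x) =
  (fun x => expi (N * a + - (cpow N w (2 * j)).1 * t) * (w%:C * F (w * x + - (w * a)))).
  apply/funext => x; rewrite /soliton /wave /profile /packet_hat -/w -/a invrK /F.
  have -> : w * x + - (w * a) = w * (x - a) by ring.
  rewrite (mulrC (x - a)) !realcM.
  have e : expi (N * x + - (cpow N w (2 * j)).1 * t) * expi (N * (a - x) + 0) =
    expi (N * a + - (cpow N w (2 * j)).1 * t) :> R[i].
    by rewrite -expiD; congr expi; ring.
  by rewrite -e; ring.
have dF' := cdominated_affine (- (w * a)) (lt0r_neq0 w0) dF.
rewrite !cintegralZ; last 2 first.
- exact: cdominated_cintegrable.
- exact/cdominated_cintegrable/cdominatedZ.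
rewrite -cintegral_affine // normcM normc_expi mul1r.
have -> : cintegral F = overlap%:C.
  by rewrite /cintegral /F /= Rintegral_cst // mul0r.
by rewrite normc_real gtr0_norm // overlap_gt0.
Qed.

(** Absolute values suffice: the distance [D] of the centres, in rescaled units, gives exponential
    decay, which is weakened to [1 / D] by [D exp (- D) <= 1]. *)
Lemma soliton_packet_other : exists2 K : R, 0 < K & forall N k t, 1 <= N ->
  0 < width N * ((velocity k (width N) - velocity N (width N)) * t) ->
  normc (cintegral (fun x => soliton j k (width N) t x *
    packet_hat N (velocity N (width N) * t) x)) <=
  K / (width N * ((velocity k (width N) - velocity N (width N)) * t)).
Proof.
have [B B0 hB] := sech_gauss_bound.
have [ro eo] := @rint_oneDsqr R.
exists (2 * (B * pi)); first by rewrite !mulr_gt0 // pi_gt0.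
move=> N k t N1; have w0 := width_gt0 r s N1.
set w := width N in w0 *; set a := velocity N w * t; set D := w * _ => D0.
have w0' : w != 0 by rewrite gt_eqF.
have ss : is_schwartz (soliton j k w t) by exact: is_schwartz_soliton.
have sp := is_schwartz_packet_hat r s a N1.
have ci : cintegrable (fun x => soliton j k w t x * packet_hat N a x).
  have [C hC] := is_schwartz_bounded ss.
  apply/cdominated_cintegrable/(cdominatedM _ hC (schwartz_cdominated sp)).
  exact: cder_ccont (is_schwartz_cder ss).
pose g (x : R) := B * expR (- D) * (oneDsqr x)^-1.
have dg : dominated g.
  split; last first.
    exists (B * expR (- D)) => x; rewrite ger0_norm //.
    by rewrite !mulr_ge0 ?expR_ge0 ?oneDsqrV_ge0 // ltW.
  by move=> x; apply: cvgMr; exact: continuous_oneDsqrV.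
have ig : \int[mu]_x (w * g (w * x + - (w * a))) = B * expR (- D) * pi.
  rewrite RintegralZl //; last exact: dominated_rint (dominated_affine _ w0' dg).
  by rewrite -integral_affine // RintegralZl // eo.
apply: le_trans (normc_cintegral ci _ _) _.
- move=> x; apply: (_ : _ <= w * g (w * x + - (w * a))).
  rewrite normcM /soliton /wave /packet_hat !normcM !normc_expi !mul1r !normc_real.
  rewrite -/w invrK (ger0_norm (gauss_ge0 _)) ger0_norm; last first.
    by rewrite mulr_ge0 // ltW // sech_gt0.
  have := hB D (w * x + - (w * a)); rewrite (gtr0_norm D0) -/(g _).
  have -> : w * x + - (w * a) - D = w * (x - velocity k w * t).
    by rewrite /D /a; ring.
  have -> : w * x + - (w * a) = (x - a) * w by ring.
  by move=> h; rewrite -mulrA ler_pM2l.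
- exact/rintZ/dominated_rint/(dominated_affine _ w0' dg).
rewrite ig ler_pdivlMr //.
have -> : 2 * (B * expR (- D) * pi) * D = 2 * (B * pi) * (expR (- D) * D) by ring.
rewrite ler_piMr ?mulr_ge0 ?pi_ge0 ?(ltW B0) //.
rewrite expRN mulrC ler_pdivrMr ?expR_gt0 // mul1r.
by apply: le_trans (expR_ge1Dx D); rewrite lerDr.
Qed.

End Overlap.

Section Separation.
Context {R : realType}.

Lemma powR_unbounded (gamma X : R) : 0 < gamma -> exists2 N0, 1 <= N0 &
  forall N, N0 <= N -> X <= N `^ gamma.
Proof.
move=> g0; exists ((1 + `|X|) `^ gamma^-1).
  by rewrite powR_ge1 ?lerDl // invr_ge0 ltW.
move=> N hN; have X1 : 0 <= 1 + `|X| by rewrite addr_ge0.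
apply: (@le_trans _ _ (1 + `|X|)); first by rewrite (le_trans (ler_norm X)) // lerDr.
apply: (@le_trans _ _ (((1 + `|X|) `^ gamma^-1) `^ gamma)).
  by rewrite -powRrM mulVf ?gt_eqF // powRr1.
by apply: ge0_ler_powR; rewrite ?nnegrE ?powR_ge0 ?(ltW g0) // (le_trans (powR_ge0 _ _) hN).
Qed.

(* At time 1 the distance of the two solitons, in units of their width, is at
   least [theta * N `^ (2 * (j - 1 - s * p))] for large [N]. *)
Lemma soliton_separation (j : nat) (r s theta X : R) : (0 < j)%N ->
  0 < 1 + s * dual_exponent r -> s * dual_exponent r < j%:R - 1 -> 0 < theta ->
  exists2 N, 1 <= N & X <= width r s N *
    ((cpow (N + theta * width r s N) (width r s N) (2 * j)).2 -
     (cpow N (width r s N) (2 * j)).2).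
Proof.
move=> j0; set sp := s * _ => e0 spj t0.
have j2 : (2 <= 2 * j)%N by rewrite leq_pmulr.
have e2j : (2 * j - 2)%:R = 2 * j%:R - 2 :> R by rewrite natrB // natrM.
have [k0 k01 Hk] := @cpow_increment R j j0.
have [N1 N11 H1] := powR_unbounded k0 e0.
have g0 : 0 < 2 * (j%:R - 1 - sp) by rewrite mulr_gt0 // subr_gt0.
have [N2 N21 H2] := powR_unbounded (X / theta) g0.
pose N := Num.max N1 N2.
have NN1 : N1 <= N by rewrite le_max lexx.
have NN2 : N2 <= N by rewrite le_max lexx orbT.
have N1' := le_trans N11 NN1; have N0 := lt_le_trans ltr01 N1'.
exists N => //; have w0 := width_gt0 r s N1'; set w := width r s N in w0 *.
(* The rescaled frequency [N / w]. It exceeds [k0] for large [N] because [1 + s p > 0]. *)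
pose k := N `^ (1 + sp).
have Nn0 : N != 0 by rewrite gt_eqF.
have kw : k * w = N.
  rewrite /k /w /width -powRD ?Nn0 ?implybT // -/sp.
  by rewrite (_ : 1 + sp + (1 - (1 + sp)) = 1) ?powRr1 ?(ltW N0) //; ring.
have k0k : k0 <= k := H1 N NN1.
have kpos := lt_le_trans ltr01 (le_trans k01 k0k).
have -> : N + theta * w = (k + theta) * w by rewrite -kw; ring.
rewrite -[in X in _ - X]kw mulrBr !(cpow_scale _ _ _).2 -mulrBr.
apply: (@le_trans _ _ (w ^+ (2 * j) * (theta * k ^+ (2 * j - 2)))); last first.
  by rewrite ler_pM2l ?exprn_gt0 //; exact: Hk.
(* All but two powers of [w] recombine with [k] to [N]; what is left is
   [theta N^(2 (j - 1 - s p))]. *)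
have -> : w ^+ (2 * j) * (theta * k ^+ (2 * j - 2)) =
    theta * (w ^+ 2 * N ^+ (2 * j - 2)).
  by rewrite -{1}(subnKC j2) (exprD w) -kw exprMn; ring.
rewrite -ler_pdivrMl // mulrC; apply: le_trans (H2 N NN2) _.
rewrite /w /width -!powR_mulrn ?powR_ge0 ?(ltW N0) // -powRrM -powRD ?Nn0 ?implybT //.
apply: ler_powR => //; rewrite -/sp e2j; lra.
Qed.

Lemma le_half (a b c : R) : a <= b + c -> c <= a / 2 -> a / 2 <= b.
Proof. lra. Qed.

End Separation.

Theorem theorem3p6 (R : realType) (j : nat) (r s : R) :
  (2 <= j)%N -> 1 < r -> r <= 2 ->
  - (dual_exponent r)^-1 < s -> s < (j%:R - 1) / dual_exponent r ->
  exists c : @coefficients R j,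
    forall T : R, 0 < T ->
    forall S, is_flow_map c s r T S ->
      ~ uniformly_continuous_on_bounded s r T S.
Proof.
move=> j2 r1 _ s_lo s_hi.
have p1 := dual_exponent_ge1 r1; have p0 := lt_le_trans ltr01 p1.
have e0 : 0 < 1 + s * dual_exponent r.
  by move: s_lo; rewrite -(ltr_pM2r p0) mulNr mulVf ?gt_eqF //; lra.
have spj : s * dual_exponent r < j%:R - 1 by rewrite -ltr_pdivlMr.
have [c solc] := @soliton_equation R j; exists c => T T0 S [_ _ Scl] uc.
pose w := width r s.
pose u (N theta t : R) := soliton j (N + theta * w N) (w N) t.
(* All admissible [N] and [theta] are included, since [B] must be fixed before [delta] is known, and
   [theta] and [N] are chosen only afterwards. *)
pose B := [set U : schwartz R -> R[i] | exists N theta : R,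
  [/\ 1 <= N, 0 <= theta <= 1 & U = dist_of (u N theta 0)]].
have [M HM] := soliton_norm_bounded j r1 e0.
have w0 N : 1 <= N -> 0 < w N by exact: width_gt0.
have su N theta t : 1 <= N -> is_schwartz (u N theta t).
  by move=> N1; apply: is_schwartz_soliton; rewrite gt_eqF // w0.
have BH : B `<=` Hhat s r.
  move=> _ [N [theta [N1 t01 ->]]]; split; first exact/tempered_dist_of/su.
  exact: le_lt_trans (HM N theta N1 t01) (ltry _).
have BM : exists M : R, forall u0, B u0 -> (Hhat_norm s r u0 <= M%:E)%E.
  by exists M => _ [N [theta [N1 t01 ->]]]; exact: HM.
have [K K0 HK] := packet_norm_bounded r1 e0.
have [K' K'0 HK'] := @soliton_packet_other R j r s.
have o0 := @overlap_gt0 R.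
(* At least half of the overlap survives in the difference of the pairings, and the duality bound
   divides it by [2 * K]. *)
pose eps := overlap / (4 * K) : R.
have eps0 : 0 < eps by rewrite divr_gt0 // mulr_gt0.
have [delta delta0 Hdelta] := uc B BH BM eps eps0.
have [theta /andP[t0 t1] close] := soliton_norm_close j r1 e0 delta0.
pose t := T / 2.
have tT : `|t| < T by rewrite ger0_norm /t; lra.
have tpos : 0 < t by rewrite /t; lra.
(* [N] is chosen last, depending on [theta] and [t]. The threshold makes the pairing of the packet
   with the second soliton at most [overlap / 2]. *)
have [N N1 sep] := soliton_separation (2 * K' / overlap / t) (ltnW j2) e0 spj t0.
have wN := w0 N N1.
have uN0 : u N 0 = soliton j N (w N) by rewrite /u mul0r addr0.
have Bu0 : B (dist_of (u N 0 0)) by exists N, 0; split=> //; rewrite lexx ler01.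
have Bv0 : B (dist_of (u N theta 0)) by exists N, theta; split=> //; rewrite (ltW t0).
have d0 : (Hhat_norm s r (dist_of (u N 0 0) - dist_of (u N theta 0))%R < delta%:E)%E.
  by rewrite uN0; exact: close.
have := Hdelta _ _ Bu0 Bv0 d0; apply/negP; rewrite -leNgt.
apply: (@le_trans _ _ (Hhat_norm s r
  (S (dist_of (u N 0 0)) t - S (dist_of (u N theta 0)) t)%R)); last first.
  by apply: ereal_sup_ubound; exists t.
have cu th : classical_solution c T (u N th) by apply: solc; rewrite gt_eqF.
have Su th : S (dist_of (u N th 0)) t = dist_of (u N th t) := Scl _ (cu th) t tT.
have SuB : (S (dist_of (u N 0 0)) t - S (dist_of (u N theta 0)) t)%R =
    dist_of (fun x => -1 * u N theta t x + u N 0 t x).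
  exact: etrans (congr2 (fun U V => U - V)%R (Su 0) (Su theta))
    (dist_ofB (su N 0 t N1) (su N theta t N1)).
rewrite SuB.
pose a := (cpow N (w N) (2 * j)).2 * t.
pose phi := Schwartz (schwartzP (is_schwartz_packet r s a N1)).
pose psi := Schwartz (schwartzP (is_schwartz_packet_hat r s a N1)).
have psiE : psi = fourier phi :> (R -> R[i]) by rewrite /= fourier_packet.
have sD := is_schwartz_lin (-1) (su N theta t N1) (su N 0 t N1).
apply: (le_trans _ (Hhat_norm_dist_of_ge r1 sD psiE K0 (HK N a N1))).
have -> : eps = (overlap / 2) / (2 * K) by rewrite /eps; field; rewrite gt_eqF.
rewrite lee_fin ler_pM2r ?invr_gt0 ?mulr_gt0 //.
have ci th : cintegrable (fun x => u N th t x * psi x).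
  have [C hC] := is_schwartz_bounded (su N th t N1).
  apply/cdominated_cintegrable/(cdominatedM _ hC).
    exact: cder_ccont (is_schwartz_cder (su N th t N1)).
  exact/schwartz_cdominated/schwartz_is_schwartz.
have -> : cintegral (fun x => (-1 * u N theta t x + u N 0 t x) * psi x) =
   -1 * cintegral (fun x => u N theta t x * psi x) + cintegral (fun x => u N 0 t x * psi x).
  by rewrite -cintegral_lin //; congr cintegral; apply/funext => x; ring.
have same : normc (cintegral (fun x => u N 0 t x * psi x)) = overlap.
  by rewrite uN0; exact: soliton_packet_same.
set I1 := cintegral (fun x => u N theta t x * psi x).
set I0 := cintegral (fun x => u N 0 t x * psi x) in same *.
pose D := w N * (((cpow (N + theta * w N) (w N) (2 * j)).2 - (cpow N (w N) (2 * j)).2) * t).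
have Dsep : 2 * K' / overlap <= D.
  by rewrite /D mulrA -ler_pdivrMr.
have D0 : 0 < D.
  by apply: lt_le_trans Dsep; rewrite divr_gt0 // mulr_gt0.
have other : normc I1 <= overlap / 2.
  apply: le_trans (HK' N _ t N1 D0) _; rewrite -/D ler_pdivrMr //.
  by move: Dsep; rewrite ler_pdivrMr // => h; lra.
have le0 : overlap <= normc I0 by rewrite same.
have le1 : normc I0 <= normc (-1 * I1 + I0) + normc I1.
  have {1}-> : I0 = (-1 * I1 + I0) + I1 by ring.
  exact: le_normcD.
exact: le_half (le_trans le0 le1) other.
Qed.
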